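(* Let $A=\mathrm{Mat}(N,\mathbb{C})$ and let $r(u,v)$ be a nondegenerate unitary solution of the AYBE with the Laurent expansion at $u=0$ of the form $r(u,v)=\frac{1\otimes 1}{u}+r_0(v)+ur_1(v)+\ldots$, and let $\overline{r}_0(v)=(\mathrm{pr}\otimes\mathrm{pr})(r_0(v))$. Then: (i) $\overline{r}_0(v)$ is a nondegenerate unitary solution of the CYBE (for $\mathfrak{sl}_N$). (ii) The following conditions are equivalent: (a) $r(u,v)$ satisfies the QYBE in $v$ (for fixed $u$), i.e. $r^{12}(u,v)r^{13}(u,v+v')r^{23}(u,v')=r^{23}(u,v')r^{13}(u,v+v')r^{12}(u,v)$; (b) the product $r(u,v)r(-u,v)$ is a scalar multiple of $1\otimes 1$; (c) $\frac{d}{dv}(r_0(v)-\overline{r}_0(v))$ is a scalar multiple of $1\otimes 1$; (d) $(\mathrm{pr}\otimes\mathrm{pr}\otimes\mathrm{pr})[\overline{r}_0^{12}(v)\overline{r}_0^{13}(v+v')-\overline{r}_0^{23}(v')\overline{r}_0^{12}(v)+\overline{r}_0^{13}(v+v')\overline{r}_0^{23}(v')]=0$. (iii) The equivalent conditions in (ii) hold when $\overline{r}_0(v)$ either admits a period (i.e. $\overline{r}_0(v+p)=\overline{r}_0(v)$ for some $p\in\mathbb{C}^*$) or has no (nonzero) infinitesimal symmetries in $\mathfrak{sl}_N$.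
   Context: For $r\in A\otimes A$: $r^{12}=r\otimes 1\in A^{\otimes 3}$, $r^{13},r^{23}$ similarly, and $r^{21}\in A\otimes A$ is $r$ with factors exchanged. A solution of the AYBE is a meromorphic $A\otimes A$-valued function $r(u,v)$ in a neighborhood of $(0,0)\in\mathbb{C}^2$ with $$r^{12}(-u',v)r^{13}(u+u',v+v')-r^{23}(u+u',v')r^{12}(u,v)+r^{13}(u,v+v')r^{23}(u',v')=0.$$ It is unitary if $r^{21}(-u,-v)=-r(u,v)$ and nondegenerate if $r(u,v)$ is a nondegenerate tensor for generic $(u,v)$. $\mathrm{pr}:A\to\mathfrak{sl}_N$ is the projection along $\mathbb{C}\cdot 1$. The CYBE is $[r^{12}(v),r^{13}(v+v')]-[r^{23}(v'),r^{12}(v)]+[r^{13}(v+v'),r^{23}(v')]=0$; a solution $\rho(v)\in\mathfrak{sl}_N\otimes\mathfrak{sl}_N$ is unitary if $\rho^{21}(-v)=-\rho(v)$ and nondegenerate if $\rho(v)$ is a nondegenerate tensor in $\mathfrak{sl}_N\otimes\mathfrak{sl}_N$ for generic $v$. By Belavin-Drinfeld, nondegenerate solutions of the CYBE for $\mathfrak{sl}_N$ extend meromorphically to $\mathbb{C}$, so periodicity makes sense. ''Scalar multiple of $1\otimes 1$'' means a product of a scalar function with $1\otimes 1$. An infinitesimal symmetry of an $A\otimes A$-valued function $f(x)$ is $a\in A$ with $[a\otimes 1+1\otimes a,f(x)]=0$ for all $x$. *)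

(* Defs.v *)
From HB Require Import structures.
From mathcomp Require Import all_boot all_order all_algebra.
From mathcomp Require Import all_classical all_reals all_analysis.
From mathcomp Require Import complex mxtens ring.

Set Implicit Arguments.
Unset Strict Implicit.
Unset Printing Implicit Defensive.

Import Order.TTheory GRing.Theory Num.Theory.
Import numFieldNormedType.Exports.

Local Open Scope classical_set_scope.
Local Open Scope ring_scope.
Local Open Scope complex_scope.

Notation "A *t B" := (tensmx A B)
  (at level 40, left associativity, format "A  *t  B") : ring_scope.

(* Topology and C-normed module structure on C = R[i], as done in
   numFieldNormedType for the abstract numeric fields. *)
#[non_forgetful_inheritance]
HB.instance Definition _ (R : rcfType) := GRing.ComAlgebra.copy R[i] R[i]^o.
#[non_forgetful_inheritance]
HB.instance Definition _ (R : rcfType) := Vector.copy R[i] R[i]^o.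
#[non_forgetful_inheritance]
HB.instance Definition _ (R : rcfType) := NormedModule.copy R[i] R[i]^o.

(* A meromorphic function is represented by a total function whose values on
   the polar set are arbitrary. Hence identities between meromorphic functions
   are stated with [generically], i.e. off the zero set of some holomorphic
   function that does not vanish identically near the point. *)

Section Meromorphic.
Context {K : numFieldType}.

Definition holomorphic_near {V W : normedModType K} (f : V -> W) (x : V) :=
  \forall y \near x, differentiable f y.

Definition nonzero_holomorphic_near {V : normedModType K}
    (h : V -> K^o) (x : V) :=
  holomorphic_near h x /\ ~ (\forall y \near x, h y = 0).

Definition generically {V : normedModType K} (x : V) (P : V -> Prop) :=
  exists2 h : V -> K^o, nonzero_holomorphic_near h x &
    \forall y \near x, h y != 0 -> P y.

Definition meromorphic_at {V W : normedModType K} (f : V -> W) (x : V) :=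
  exists (g : V -> W) (h : V -> K^o),
    [/\ holomorphic_near g x, nonzero_holomorphic_near h x &
        \forall y \near x, h y != 0 -> f y = (h y)^-1 *: g y].

End Meromorphic.

(* Mat(N) (x) Mat(N) is identified with 'M_(N * N) through the Kronecker
   product, and Mat(N) (x) Mat(N) (x) Mat(N) with 'M_(N * N * N). The linear
   map on a tensor product induced by a bilinear (trilinear) map [B] is
   obtained by expanding along the products of matrix units. *)

Section Tensors.
Context {K : fieldType} {N : nat}.
Local Notation A := 'M[K]_N.
Local Notation AA := 'M[K]_(N * N).
Local Notation AAA := 'M[K]_(N * N * N).

Definition tlift {W : lmodType K} (B : A -> A -> W) (t : AA) : W :=
  \sum_i \sum_j \sum_k \sum_l
    t (mxtens_index (i, k)) (mxtens_index (j, l)) *: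
    B (delta_mx i j) (delta_mx k l).

Definition tlift3 {W : lmodType K} (B : A -> A -> A -> W) (t : AAA) : W :=
  \sum_i \sum_j \sum_k \sum_l \sum_m \sum_n
    t (mxtens_index (mxtens_index (i, k), m))
      (mxtens_index (mxtens_index (j, l), n)) *:
    B (delta_mx i j) (delta_mx k l) (delta_mx m n).

Definition leg12 : AA -> AAA := tlift (fun a b => a *t b *t 1%:M).
Definition leg13 : AA -> AAA := tlift (fun a b => a *t 1%:M *t b).
Definition leg23 : AA -> AAA := tlift (fun a b => 1%:M *t a *t b).
Definition leg21 : AA -> AA := tlift (fun a b => b *t a).

Definition pr (a : A) : A := a - (\tr a / N%:R)%:M.
Definition pr2 : AA -> AA := tlift (fun a b => pr a *t pr b).
Definition pr3 : AAA -> AAA := tlift3 (fun a b c => pr a *t pr b *t pr c).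

Definition sl : {pred A} := [pred a | \tr a == 0].

Definition in_tensor_square (S : {pred A}) (t : AA) :=
  exists (n : nat) (a b : 'I_n -> A),
    (forall i, a i \in S /\ b i \in S) /\ t = \sum_i a i *t b i.

(* For a subspace S and t in S (x) S: the map S^* -> S sending f to
   (f (x) id)(t) is injective, hence an isomorphism since dim S^* = dim S.
   Elements of S^* are given by linear forms on Mat(N) up to those that
   vanish on S. *)
Definition nondegenerate_on (S : {pred A}) (t : AA) :=
  forall f : {linear A -> K^o},
    tlift (fun a b => f a *: b) t = 0 -> {in S, forall a, f a = 0}.

Definition commutator {n : nat} (x y : 'M[K]_n) := x *m y - y *m x.

Let linear_delta (W : lmodType K) (f : A -> W) (x : A) : linear f ->
  f x = \sum_i \sum_j x i j *: f (delta_mx i j).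
Proof.
move=> fl; pose g : {linear A -> W} := HB.pack f (GRing.isLinear.Build _ _ _ _ _ fl).
rewrite -[f]/(g : A -> W) [in LHS](matrix_sum_delta x) linear_sum.
apply: eq_bigr => i _; rewrite linear_sum; apply: eq_bigr => j _.
by rewrite linearZ.
Qed.

Lemma tlift_tens (W : lmodType K) (B : A -> A -> W) (a b : A) :
  (forall x, linear (B x)) -> (forall y, linear (B^~ y)) ->
  tlift B (a *t b) = B a b.
Proof.
move=> Br Bl; rewrite (linear_delta a (Bl b)).
apply: eq_bigr => i _; apply: eq_bigr => j _.
rewrite (linear_delta b (Br _)) scaler_sumr.
apply: eq_bigr => k _; rewrite scaler_sumr.
by apply: eq_bigr => l _; rewrite tensmxE scalerA.
Qed.

Lemma tlift3_tens (W : lmodType K) (B : A -> A -> A -> W) (a b c : A) :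
  (forall x y, linear (B x y)) -> (forall x z, linear (fun y => B x y z)) ->
  (forall y z, linear (fun x => B x y z)) ->
  tlift3 B (a *t b *t c) = B a b c.
Proof.
move=> B3 B2 B1.
rewrite -[RHS](tlift_tens (B := fun a b => B a b c)) //.
apply: eq_bigr => i _; apply: eq_bigr => j _.
apply: eq_bigr => k _; apply: eq_bigr => l _.
rewrite (linear_delta c (B3 _ _)) scaler_sumr.
apply: eq_bigr => m _; rewrite scaler_sumr.
by apply: eq_bigr => n _; rewrite !tensmxE scalerA.
Qed.

Lemma leg12_tens (a b : A) : leg12 (a *t b) = a *t b *t 1%:M.
Proof.
by apply: tlift_tens => x d y z; apply/matrixP=> i j; rewrite !mxE; ring.
Qed.

Lemma leg13_tens (a b : A) : leg13 (a *t b) = a *t 1%:M *t b.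
Proof.
by apply: tlift_tens => x d y z; apply/matrixP=> i j; rewrite !mxE; ring.
Qed.

Lemma leg23_tens (a b : A) : leg23 (a *t b) = 1%:M *t a *t b.
Proof.
by apply: tlift_tens => x d y z; apply/matrixP=> i j; rewrite !mxE; ring.
Qed.

Lemma leg21_tens (a b : A) : leg21 (a *t b) = b *t a.
Proof.
by apply: tlift_tens => x d y z; apply/matrixP=> i j; rewrite !mxE; ring.
Qed.

Lemma pr_linear : linear pr.
Proof.
move=> d x y; apply/matrixP=> i j.
by rewrite /pr mxtraceD mxtraceZ !mxE; case: (i == j); rewrite /= ?mulr1n ?mulr0n; ring.
Qed.

Lemma pr2_tens (a b : A) : pr2 (a *t b) = pr a *t pr b.
Proof.
apply: tlift_tens => x d y z; rewrite pr_linear;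
  by apply/matrixP=> i j; rewrite !mxE; ring.
Qed.

Lemma pr3_tens (a b c : A) : pr3 (a *t b *t c) = pr a *t pr b *t pr c.
Proof.
apply: tlift3_tens => x x' d y z; rewrite pr_linear;
  by apply/matrixP=> i j; rewrite !mxE; ring.
Qed.

End Tensors.

Section YangBaxter.
Context {R : realType} {N : nat}.
Local Notation C := R[i].
Local Notation A := 'M[R[i]]_N.
Local Notation AA := 'M[R[i]]_(N * N).

Definition is_AYBE_solution (r : C -> C -> AA) :=
  meromorphic_at (fun x : C * C => r x.1 x.2) 0 /\
  generically (0 : C * C * C * C) (fun x => let: (u, u', v, v') := x in
    leg12 (r (- u') v) *m leg13 (r (u + u') (v + v'))
    - leg23 (r (u + u') v') *m leg12 (r u v)
    + leg13 (r u (v + v')) *m leg23 (r u' v') = 0).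

Definition is_AYBE_unitary (r : C -> C -> AA) :=
  generically (0 : C * C) (fun x => let: (u, v) := x in
    leg21 (r (- u) (- v)) = - r u v).

Definition is_AYBE_nondegenerate (r : C -> C -> AA) :=
  generically (0 : C * C) (fun x => let: (u, v) := x in
    nondegenerate_on predT (r u v)).

(* r(u, v) = 1 (x) 1 / u + c_0(v) + u c_1(v) + ...; the radius of convergence
   in u may shrink with v. *)
Definition laurent_at_u0 (r : C -> C -> AA) (c : nat -> C -> AA) :=
  (forall k, meromorphic_at (c k) 0) /\
  generically (0 : C) (fun v => \forall u \near (0 : C)^',
    series (fun k => u ^+ k *: c k v) @ \oo --> r u v - u^-1 *: 1%:M).

Definition is_CYBE_solution (rho : C -> AA) :=
  [/\ meromorphic_at rho 0,
      generically (0 : C) (fun v => in_tensor_square sl (rho v)) &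
      generically (0 : C * C) (fun x => let: (v, v') := x in
        commutator (leg12 (rho v)) (leg13 (rho (v + v')))
        - commutator (leg23 (rho v')) (leg12 (rho v))
        + commutator (leg13 (rho (v + v'))) (leg23 (rho v')) = 0)].

Definition is_CYBE_unitary (rho : C -> AA) :=
  generically (0 : C) (fun v => leg21 (rho (- v)) = - rho v).

Definition is_CYBE_nondegenerate (rho : C -> AA) :=
  generically (0 : C) (fun v => nondegenerate_on sl (rho v)).

Definition satisfies_QYBE (r : C -> C -> AA) :=
  generically (0 : C * C * C) (fun x => let: (u, v, v') := x in
    leg12 (r u v) *m leg13 (r u (v + v')) *m leg23 (r u v') =
    leg23 (r u v') *m leg13 (r u (v + v')) *m leg12 (r u v)).

(* The period refers to the meromorphic continuation F of rho to C, which is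
   unique up to its values at a discrete set. *)
Definition admits_period (rho : C -> AA) :=
  exists (F : C -> AA) (p : C),
    [/\ forall z, meromorphic_at F z,
        generically (0 : C) (fun v => F v = rho v),
        p != 0 &
        forall z, generically z (fun v => F (v + p) = F v)].

Definition infinitesimal_symmetry (f : C -> AA) (a : A) :=
  generically (0 : C) (fun v =>
    commutator (a *t 1%:M + 1%:M *t a) (f v) = 0).

End YangBaxter.

(* Main.v *)
(** A tensor [r(u, v)] acts on matrices by [T_(u,v) : y |-> sum tr(b y) a], and with unitarity
    the AYBE reads
      [T_(a,v)(y) T_(b,w)(z) = T_(a+b,v)(y T_(b,w-v)(z)) + T_(a+b,w)(T_(a,v-w)(y) z)].
    For [N > 1] this forces a simple pole along [v = 0] whose residue is a constant [c] times the
    flip: the leading terms determine the residue, a scaling argument excludes poles of higher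
    order, and in the absence of a pole the limit operators at [v = 0] yield a derivation of the
    matrix algebra which cannot be inner.

    As [u -> 0], [pr (x) pr (x) pr] kills the terms [1 (x) 1 / u], so [r_0] satisfies the projected
    AYBE. Antisymmetrizing under the exchange of the outer factors gives the CYBE, and the pole
    gives nondegeneracy. Multiplying the last two factors of the AYBE, then letting [u -> 0] and
    [w -> v], gives [r(-u, v) r(u, v) = - c (M (x) 1 + 1 (x) M) + scalar], where by unitarity the
    traceless matrix [M] depends neither on [u] nor on [v]; it is [pr] of the partial trace of
    [r_0'(v)].

    Each of the conditions (a)-(d) amounts to [M = 0]. The two sides of the QYBE differ by
    [c [M^1, r^13(2u, v+v')]], the derivative in (c) is [(M (x) 1 + 1 (x) M) / N + scalar], and the
    expression in (d) is [- (v r^12(v) M^3 + (v+v') r^13(v+v') M^2 + v' r^23(v') M^1) / N] with [r]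
    the projected [r_0]; if it vanished with [M <> 0], then [r] would have rank at most 2. Since
    [M] is an infinitesimal symmetry, rigidity gives [M = 0]. A period [p] changes only the factors
    [v] and [v+v'] when that identity is continued from [v] to [v+p], so that again [r] would
    degenerate.

    Complex analysis is needed in one variable only, along complex lines: Goursat's lemma for
    triangles, Cauchy expansions on a square, orders of vanishing and the identity theorem. *)
Require Import Defs.
From HB Require Import structures.
From mathcomp Require Import all_boot all_order all_algebra.
From mathcomp Require Import all_classical all_reals all_analysis.
From mathcomp Require Import complex mxtens ring lra.

Set Implicit Arguments.
Unset Strict Implicit.
Unset Printing Implicit Defensive.

Import Order.TTheory GRing.Theory Num.Theory.
Import numFieldNormedType.Exports.

Local Open Scope classical_set_scope.
Local Open Scope ring_scope.
Local Open Scope complex_scope.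

(** * Tensor algebra *)

(** The obstacle is that [r] is controlled only off the zero sets of unspecified holomorphic
    functions, and that nothing is assumed about its behaviour in [v]. So no expansion in two
    variables is used: identities are evaluated at points of one open locus, a single parameter
    tends to 0, and limits are compared by uniqueness. Nondegeneracy enters as injectivity of the
    operators [T_(u,v)]; in finite dimension these are invertible, so that the limit of an unknown
    term can be read off from the remaining ones. The tensor [1 (x) 1] acts as [y |-> tr(y) 1],
    hence on traceless matrices the pole at [u = 0] is invisible and [r_0] is a plain limit of [r].
    The matrix [M] is constant by a separation of variables: the limit computation gives
    [r(-u,v) r(u,v)] as [1 (x) X - c S (x) 1], where [X] depends only on [u] and [S] only on [v];
    unitarity exchanges the tensor factors and forces [pr X = - c pr S]. For [N = 1] there are no
    traceless matrices but 0, no pole is forced, and the statements are checked directly. *)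

Section TensorExtension.
Context {K : fieldType}.

Lemma tensmx_linearl (m n p q : nat) (b : 'M[K]_(p, q)) :
  linear (fun a : 'M[K]_(m, n) => a *t b).
Proof. by move=> c x y; apply/matrixP=> i j; rewrite !mxE; ring. Qed.

Lemma tensmx_linearr (m n p q : nat) (a : 'M[K]_(m, n)) :
  linear (fun b : 'M[K]_(p, q) => a *t b).
Proof. by move=> c x y; apply/matrixP=> i j; rewrite !mxE; ring. Qed.

Lemma linear_delta_sum (m n : nat) (W : lmodType K) (f : 'M[K]_(m, n) -> W) x :
  linear f -> f x = \sum_i \sum_j x i j *: f (delta_mx i j).
Proof.
move=> fl; pose g : {linear 'M[K]_(m, n) -> W} :=
  HB.pack f (GRing.isLinear.Build _ _ _ _ _ fl).
rewrite -[f]/(g : _ -> W) [in LHS](matrix_sum_delta x) linear_sum.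
apply: eq_bigr => i _; rewrite linear_sum; apply: eq_bigr => j _.
by rewrite linearZ.
Qed.

(** The legs, [pr], [pr2] and the contractions below are bare functions with no bundled linear
    structure, so the consequences of the predicate [linear] are needed in this form. *)
Lemma linear_zero (V W : lmodType K) (f : V -> W) : linear f -> f 0 = 0.
Proof. by move=> fl; have := fl (-1) 0 0; rewrite scaleN1r oppr0 addr0 scaleN1r addNr. Qed.

Lemma linear_scale (V W : lmodType K) (f : V -> W) : linear f ->
  forall c x, f (c *: x) = c *: f x.
Proof. by move=> fl c x; have := fl c x 0; rewrite !addr0 (linear_zero fl) addr0. Qed.

Lemma linear_add (V W : lmodType K) (f : V -> W) : linear f ->
  forall x y, f (x + y) = f x + f y.
Proof. by move=> fl x y; have := fl 1 x y; rewrite !scale1r. Qed.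

Lemma linear_opp (V W : lmodType K) (f : V -> W) : linear f ->
  forall x, f (- x) = - f x.
Proof. by move=> fl x; rewrite -scaleN1r linear_scale // scaleN1r. Qed.

Lemma linear_sub (V W : lmodType K) (f : V -> W) : linear f ->
  forall x y, f (x - y) = f x - f y.
Proof. by move=> fl x y; rewrite linear_add // linear_opp. Qed.

Lemma delta_mx_tens (m n : nat) (i j : 'I_m) (k l : 'I_n) :
  delta_mx (mxtens_index (i, k)) (mxtens_index (j, l)) =
  delta_mx i j *t delta_mx k l :> 'M[K]_(m * n).
Proof.
apply/matrixP => p q; case: (mxtens_indexP p) => i' k'.
case: (mxtens_indexP q) => j' l'; rewrite tensmxE !mxE.
rewrite !(can_eq (@mxtens_indexK _ _)) !xpair_eqE.
by do 4 case: eqP => _; rewrite /= ?mulr1 ?mulr0.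
Qed.

(** Matrix units of size [m * n] are Kronecker products of matrix units ([delta_mx_tens]), so pure
    tensors span. With its variants for two arguments and three factors, this reduces the identities
    between legs and contractions to computations on pure tensors. *)
Lemma tens_ext (m n : nat) (W : lmodType K) (f g : 'M[K]_(m * n) -> W) :
  linear f -> linear g -> (forall a b, f (a *t b) = g (a *t b)) ->
  forall t, f t = g t.
Proof.
move=> fl gl fg t; rewrite (linear_delta_sum t fl) (linear_delta_sum t gl).
apply: eq_bigr => p _; apply: eq_bigr => q _; congr (_ *: _).
case: (mxtens_indexP p) => i k; case: (mxtens_indexP q) => j l.
by rewrite delta_mx_tens.
Qed.

Lemma tens_ext2 (m n p q : nat) (W : lmodType K)
    (f g : 'M[K]_(m * n) -> 'M[K]_(p * q) -> W) :
  (forall s, linear (f^~ s)) -> (forall s, linear (g^~ s)) ->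
  (forall r, linear (f r)) -> (forall r, linear (g r)) ->
  (forall a b c d, f (a *t b) (c *t d) = g (a *t b) (c *t d)) ->
  forall r s, f r s = g r s.
Proof.
move=> f1 g1 f2 g2 fg r s; apply: (tens_ext (f1 s) (g1 s)) => a b.
exact: (tens_ext (f2 _) (g2 _)).
Qed.

Lemma tens3_ext (m n p : nat) (W : lmodType K) (f g : 'M[K]_(m * n * p) -> W) :
  linear f -> linear g -> (forall a b c, f (a *t b *t c) = g (a *t b *t c)) ->
  forall t, f t = g t.
Proof.
move=> fl gl fg; apply: tens_ext => // X c.
apply: (@tens_ext _ _ _ (fun X => f (X *t c)) (fun X => g (X *t c))) => //.
  by move=> d x y; rewrite tensmx_linearl fl.
by move=> d x y; rewrite tensmx_linearl gl.
Qed.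

Lemma tens3_ext2 (m n p m' n' p' : nat) (W : lmodType K)
    (f g : 'M[K]_(m * n * p) -> 'M[K]_(m' * n' * p') -> W) :
  (forall s, linear (f^~ s)) -> (forall s, linear (g^~ s)) ->
  (forall r, linear (f r)) -> (forall r, linear (g r)) ->
  (forall a b c a' b' c', f (a *t b *t c) (a' *t b' *t c') =
     g (a *t b *t c) (a' *t b' *t c')) ->
  forall r s, f r s = g r s.
Proof.
move=> f1 g1 f2 g2 fg r s; apply: (tens3_ext (f1 s) (g1 s)) => a b c.
exact: (tens3_ext (f2 _) (g2 _)).
Qed.

End TensorExtension.

Section TensorOperations.
Context {K : fieldType} {N : nat}.
Notation A := 'M[K]_N.
Notation AA := 'M[K]_(N * N).
Notation AAA := 'M[K]_(N * N * N).

Lemma tlift_linear (W : lmodType K) (B : A -> A -> W) : linear (tlift B).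
Proof.
move=> c x y; rewrite /tlift scaler_sumr -big_split; apply: eq_bigr => i _.
rewrite scaler_sumr -big_split; apply: eq_bigr => j _.
rewrite scaler_sumr -big_split; apply: eq_bigr => k _.
rewrite scaler_sumr -big_split; apply: eq_bigr => l _.
by rewrite !mxE scalerDl scalerA.
Qed.

Lemma tlift3_linear (W : lmodType K) (B : A -> A -> A -> W) : linear (tlift3 B).
Proof.
move=> c x y; rewrite /tlift3 scaler_sumr -big_split; apply: eq_bigr => i _.
rewrite scaler_sumr -big_split; apply: eq_bigr => j _.
rewrite scaler_sumr -big_split; apply: eq_bigr => k _.
rewrite scaler_sumr -big_split; apply: eq_bigr => l _.
rewrite scaler_sumr -big_split; apply: eq_bigr => p _.
rewrite scaler_sumr -big_split; apply: eq_bigr => q _.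
by rewrite !mxE scalerDl scalerA.
Qed.

Lemma tlift_linear_param (V W : lmodType K) (B : V -> A -> A -> W) (t : AA) :
  (forall a b, linear (fun v => B v a b)) -> linear (fun v => tlift (B v) t).
Proof.
move=> Bl c x y; rewrite /tlift scaler_sumr -big_split; apply: eq_bigr => i _.
rewrite scaler_sumr -big_split; apply: eq_bigr => j _.
rewrite scaler_sumr -big_split; apply: eq_bigr => k _.
rewrite scaler_sumr -big_split; apply: eq_bigr => l _.
by rewrite Bl scalerDr !scalerA mulrC.
Qed.

Definition leg12P := @tlift_linear AAA (fun a b => a *t b *t 1%:M) : linear leg12.
Definition leg13P := @tlift_linear AAA (fun a b => a *t 1%:M *t b) : linear leg13.
Definition leg23P := @tlift_linear AAA (fun a b => 1%:M *t a *t b) : linear leg23.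
Definition leg21P := @tlift_linear AA (fun a b => b *t a) : linear leg21.
Definition pr2P := @tlift_linear AA (fun a b => pr a *t pr b) : linear pr2.
Definition pr3P := @tlift3_linear AAA (fun a b c => pr a *t pr b *t pr c) : linear pr3.

Lemma mulmx_linearl (m n p : nat) (y : 'M[K]_(n, p)) : linear (fun x : 'M[K]_(m, n) => x *m y).
Proof. by move=> c x x'; rewrite mulmxDl scalemxAl. Qed.
Lemma mulmx_linearr (m n p : nat) (x : 'M[K]_(m, n)) : linear (fun y : 'M[K]_(n, p) => x *m y).
Proof. by move=> c y y'; rewrite mulmxDr scalemxAr. Qed.
Let mulP := (mulmx_linearl, mulmx_linearr).

(* A tensor as an operator on matrices, through the trace pairing. *)
Definition tract (r : AA) (y : A) : A := tlift (fun a b => \tr (b *m y) *: a) r.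

Let traceZ (a b : A) (y : A) : linear (fun b => \tr (b *m y) *: a).
Proof. by move=> c x z; rewrite mulmx_linearl linearP scalerDl scalerA. Qed.

Lemma tract_linearl y : linear (tract^~ y).
Proof. exact: tlift_linear. Qed.

Lemma tract_linearr r : linear (tract r).
Proof.
apply: tlift_linear_param => a b c x y.
by rewrite mulmx_linearr linearP scalerDl scalerA.
Qed.

Lemma tract_tens a b y : tract (a *t b) y = \tr (b *m y) *: a.
Proof.
apply: tlift_tens => [x|x] c u v; first by rewrite mulmx_linearl linearP scalerDl scalerA.
by rewrite scalerDr !scalerA mulrC.
Qed.

Lemma trace_pairing (x : A) : (forall y, \tr (x *m y) = 0) -> x = 0.
Proof.
move=> x0; apply/matrixP => i j; have := x0 (delta_mx j i).
rewrite mxE /mxtrace (bigD1 i) //= big1 ?addr0 => [|k ki].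
  rewrite mxE (bigD1 j) //= big1 ?addr0 => [|l lj].
    by rewrite !mxE !eqxx mulr1.
  by rewrite mxE (negPf lj) mulr0.
rewrite mxE big1 // => l _; rewrite mxE (negPf ki) andbF mulr0 //.
Qed.

(** The operator determines the tensor entry by entry: the coefficient of [t] at [(i, k)], [(j, l)]
    is the entry [(i, j)] of [tract t (delta_mx l k)]. *)
Lemma tract_inj r s : (forall y, tract r y = tract s y) -> r = s.
Proof.
move=> rs; apply/eqP; rewrite -subr_eq0; apply/eqP.
have {}rs y : tract (r - s) y = 0 by rewrite (linear_sub (tract_linearl y)) rs subrr.
move: (r - s) rs => t t0; apply/matrixP => p q.
case: (mxtens_indexP p) => i k; case: (mxtens_indexP q) => j l.
have /matrixP/(_ i j) := t0 (delta_mx l k); rewrite !mxE => <-.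
have coordP (u : 'I_(N * N)) v : linear (fun t : AA => t u v : K^o).
  by move=> c x y; rewrite !mxE.
apply: (@tens_ext _ _ _ K^o (fun t => t (mxtens_index (i, k)) (mxtens_index (j, l)))
   (fun t => tract t (delta_mx l k) i j)).
- exact: coordP.
- by move=> c x y; rewrite (tract_linearl (delta_mx l k)) !mxE.
move=> a b; rewrite tensmxE tract_tens mxE mulrC; congr (_ * _).
rewrite /mxtrace (bigD1 k) //= mxE (bigD1 l) //= mxE !eqxx mulr1.
rewrite big1 ?addr0 => [|l' l'l]; last by rewrite mxE (negPf l'l) mulr0.
rewrite big1 ?addr0 // => k' k'k; rewrite mxE big1 // => l' _.
by rewrite mxE (negPf k'k) andbF mulr0.
Qed.

Lemma leg21M (r s : AA) : leg21 (r *m s) = leg21 r *m leg21 s.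
Proof.
move: r s; apply: tens_ext2 => [s|s|r|r|a b c d]; try by move=> z x y; rewrite !(leg21P, mulP).
by rewrite tensmx_mul !leg21_tens tensmx_mul.
Qed.

Lemma leg12M (r s : AA) : leg12 (r *m s) = leg12 r *m leg12 s.
Proof.
move: r s; apply: tens_ext2 => [s|s|r|r|a b c d]; try by move=> z x y; rewrite !(leg12P, mulP).
by rewrite tensmx_mul !leg12_tens !tensmx_mul mulmx1.
Qed.

Lemma tens11 (m n : nat) : 1%:M *t 1%:M = 1%:M :> 'M[K]_(m * n).
Proof.
apply/matrixP => p q; case: (mxtens_indexP p) => i k.
case: (mxtens_indexP q) => j l; rewrite tensmxE !mxE.
rewrite !(can_eq (@mxtens_indexK _ _)) !xpair_eqE.
by do 2 case: eqP => _; rewrite /= ?mulr1 ?mulr0.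
Qed.

Let LP := (leg12P, leg13P, leg23P, leg21P, pr2P, pr3P, @mulmx_linearl, @mulmx_linearr,
  tract_linearl, tract_linearr, @tlift_linear, @tlift3_linear,
  @tensmx_linearl, @tensmx_linearr).

(** Pairing the last two factors with [y] and [z] turns each product in the AYBE into an expression
    in the operators [tract]; this is the source of the operator form of the equation. *)
Definition contract23 (y z : A) : AAA -> A :=
  tlift3 (fun a b c => (\tr (b *m y) * \tr (c *m z)) *: a).

Let contract23_tens y z a b c :
  contract23 y z (a *t b *t c) = (\tr (b *m y) * \tr (c *m z)) *: a.
Proof.
apply: tlift3_tens => u w d p q.
- by rewrite mulmx_linearl mxtraceD mxtraceZ mulrDr scalerDl scalerA mulrCA.
- by rewrite mulmx_linearl mxtraceD mxtraceZ mulrDl scalerDl scalerA mulrA.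
- by rewrite scalerDr !scalerA mulrC.
Qed.

Let contract23P y z : linear (contract23 y z).
Proof. exact: tlift3_linear. Qed.

Lemma contract_12_13 r s y z :
  contract23 y z (leg12 r *m leg13 s) = tract r y *m tract s z.
Proof.
move: r s; apply: tens_ext2 => [s|s|r|r|a b c d];
  try by move=> u v w; rewrite ?(contract23P, LP) // ?contract23P.
rewrite leg12_tens leg13_tens !tensmx_mul mulmx1 mul1mx contract23_tens.
by rewrite !tract_tens -scalemxAl -scalemxAr scalerA.
Qed.

Lemma contract_23_12 r s y z :
  contract23 y z (leg23 s *m leg12 r) = tract r (y *m tract s z).
Proof.
move: r s; apply: tens_ext2 => [s|s|r|r|a b c d];
  try by move=> u v w; rewrite ?(contract23P, LP) // ?contract23P.
rewrite leg12_tens leg23_tens !tensmx_mul mulmx1 mul1mx contract23_tens.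
rewrite !tract_tens -!scalemxAr linearZ /= mulmxA [\tr (d *m z) * _]mulrC.
by rewrite -[c *m b *m y]mulmxA mxtrace_mulC.
Qed.

(** The factor of [s] that is paired with [y] is its first one, whereas [tract] pairs the second;
    hence the [leg21]. *)
Lemma contract_13_23 r s y z :
  contract23 y z (leg13 r *m leg23 s) = tract r (tract (leg21 s) y *m z).
Proof.
move: r s; apply: tens_ext2 => [s|s|r|r|a b c d];
  try by move=> u v w; rewrite ?(contract23P, LP) // ?contract23P.
rewrite leg13_tens leg23_tens !tensmx_mul !mulmx1 mul1mx contract23_tens.
by rewrite leg21_tens !tract_tens -scalemxAl -scalemxAr linearZ /= mulmxA.
Qed.

Definition merge23 : AAA -> AA := tlift3 (fun a b c => a *t (b *m c)).

(** Multiplying the last two factors sends both [leg23 s *m leg12 r] and [leg13 r *m leg23 s] to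
    this same operation ([merge_23_12], [merge_13_23]), so that two of the three terms of the AYBE
    become comparable. *)
Definition sandwich (r s : AA) : AA :=
  tlift (fun a b => tlift (fun a' b' => a *t (a' *m b *m b')) s) r.

Let merge23_tens a b c : merge23 (a *t b *t c) = a *t (b *m c).
Proof.
by apply: tlift3_tens => u w d p q; rewrite ?LP.
Qed.

Let merge23P : linear merge23.
Proof. exact: tlift3_linear. Qed.

Lemma sandwich_linearl s : linear (sandwich^~ s).
Proof. exact: tlift_linear. Qed.

Lemma sandwich_linearr r : linear (sandwich r).
Proof. by apply: tlift_linear_param => a b c x y; rewrite LP. Qed.

Lemma sandwich_tens a b a' b' :
  sandwich (a *t b) (a' *t b') = a *t (a' *m b *m b').
Proof.
rewrite /sandwich tlift_tens.
- by apply: tlift_tens => u d p q; rewrite !LP.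
- by move=> x; apply: tlift_linear_param => u w d p q; rewrite !LP.
- by move=> x; apply: tlift_linear_param => u w d p q; rewrite !LP.
Qed.

Let SP := (sandwich_linearl, sandwich_linearr).

Lemma merge_12_13 r s : merge23 (leg12 r *m leg13 s) = r *m s.
Proof.
move: r s; apply: tens_ext2 => [s|s|r|r|a b c d];
  try by move=> u v w; rewrite ?(merge23P, LP) // ?merge23P.
by rewrite leg12_tens leg13_tens !tensmx_mul mulmx1 mul1mx merge23_tens.
Qed.

Lemma merge_23_12 r s : merge23 (leg23 s *m leg12 r) = sandwich r s.
Proof.
move: r s; apply: tens_ext2 => [s|s|r|r|a b c d];
  try by move=> u v w; rewrite ?(merge23P, LP) // ?merge23P ?SP.
by rewrite leg12_tens leg23_tens !tensmx_mul mulmx1 mul1mx merge23_tens sandwich_tens.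
Qed.

Lemma merge_13_23 r s : merge23 (leg13 r *m leg23 s) = sandwich r s.
Proof.
move: r s; apply: tens_ext2 => [s|s|r|r|a b c d];
  try by move=> u v w; rewrite ?(merge23P, LP) // ?merge23P ?SP.
by rewrite leg13_tens leg23_tens !tensmx_mul mulmx1 mul1mx merge23_tens sandwich_tens mulmxA.
Qed.

Definition mult_tensor : AA -> A := tlift (fun a b => a *m b).

Lemma sandwich1 s : sandwich 1%:M s = 1%:M *t mult_tensor s.
Proof.
move: s; apply: tens_ext => [|u v w|a b]; first exact: sandwich_linearr.
  by rewrite /mult_tensor !LP.
rewrite -tens11 sandwich_tens mulmx1 /mult_tensor tlift_tens // => x u v w; by rewrite LP.
Qed.

Definition flip_tensor : AA := \sum_i \sum_j delta_mx i j *t delta_mx j i.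

(** In the second factor this is the identity that the sum of [delta_mx i j *m b *m delta_mx j i]
    over [i] and [j] is [\tr b] times the unit matrix. *)
Lemma sandwich_flip r : sandwich r flip_tensor = tract r 1%:M *t 1%:M.
Proof.
move: r; apply: tens_ext => [|u v w|a b]; first exact: sandwich_linearl.
  by rewrite !LP.
pose L : {linear AA -> AA} :=
  HB.pack (sandwich (a *t b)) (GRing.isLinear.Build _ _ _ _ _ (sandwich_linearr (a *t b))).
rewrite -[sandwich _ _]/(L _) /flip_tensor linear_sum /=.
under eq_bigr => i _ do rewrite -[sandwich _ _]/(L _) linear_sum /=.
rewrite tract_tens mulmx1 (linear_scale (tensmx_linearl _)) -(linear_scale (tensmx_linearr _)).
pose Ta : {linear A -> AA} :=
  HB.pack (fun b => a *t b) (GRing.isLinear.Build _ _ _ _ _ (tensmx_linearr a)).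
under eq_bigr => i _ do under eq_bigr => j _ do rewrite sandwich_tens -[_ *t _]/(Ta _).
under eq_bigr => i _ do rewrite -linear_sum.
rewrite -linear_sum -[_ *t _]/(Ta _); congr (Ta _).
apply/matrixP => p q; rewrite summxE !mxE.
under eq_bigr => i _ do rewrite summxE.
have E i j : (delta_mx i j *m b *m delta_mx j i) p q =
    b j j * ((p == i) && (q == i))%:R.
  rewrite mxE (bigD1 j) //= big1 ?addr0 => [|l lj].
    rewrite mxE (bigD1 j) //= big1 ?addr0 => [|l lj].
      by rewrite !mxE !eqxx andbT; do 2 case: (_ == i); rewrite /= ?mulr1 ?mulr0 ?mul1r ?mul0r.
    by rewrite !mxE (negPf lj) andbF mul0r.
  by rewrite mxE [X in _ * X]mxE (negPf lj) mulr0.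
under eq_bigr => i _ do under eq_bigr => j _ do rewrite E.
rewrite exchange_big /= /mxtrace mulr_suml; apply: eq_bigr => j _.
rewrite -mulr_sumr; congr (_ * _); rewrite (bigD1 p) //= big1 ?addr0 => [|i ip].
  by rewrite eqxx /= eq_sym.
by rewrite eq_sym (negPf ip).
Qed.

Lemma tract_flip y : tract flip_tensor y = y.
Proof.
pose L : {linear AA -> A} :=
  HB.pack (tract^~ y) (GRing.isLinear.Build _ _ _ _ _ (tract_linearl y)).
rewrite -[tract _ _]/(L _) /flip_tensor linear_sum /=.
under eq_bigr => i _ do rewrite -[tract _ _]/(L _) linear_sum /=.
rewrite [RHS]matrix_sum_delta; apply: eq_bigr => i _; apply: eq_bigr => j _.
rewrite tract_tens; congr (_ *: _).
rewrite /mxtrace (bigD1 j) //= mxE (bigD1 i) //= mxE !eqxx mul1r.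
rewrite big1 ?addr0 => [|l li]; last by rewrite mxE (negPf li) andbF mul0r.
rewrite big1 ?addr0 // => l lj; rewrite mxE big1 // => k _.
by rewrite mxE (negPf lj) mul0r.
Qed.

End TensorOperations.

(** * Projection to traceless tensors and exchange of the outer factors *)

Section ProjectedTensors.
Context {K : fieldType} {N : nat}.
Hypothesis N0 : N%:R != 0 :> K.
Notation A := 'M[K]_N.
Notation AA := 'M[K]_(N * N).
Notation AAA := 'M[K]_(N * N * N).

Let LP := (@leg12P K N, @leg13P K N, @leg23P K N, @leg21P K N, @pr2P K N, @pr3P K N, @mulmx_linearl K, @mulmx_linearr K,
  @tract_linearl K N, @tract_linearr K N, @tlift_linear K N, @tlift3_linear K N,
  @tensmx_linearl K, @tensmx_linearr K, @pr_linear K N).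

Lemma trace_pr (a : A) : \tr (pr a) = 0.
Proof.
by rewrite /pr mxtraceD linearN /= mxtrace_scalar -[X in _ - X]mulr_natr divfK // subrr.
Qed.

Lemma pr_id (a : A) : \tr a = 0 -> pr a = a.
Proof. by move=> a0; rewrite /pr a0 mul0r raddf0 subr0. Qed.

Lemma pr_scalar (c : K) : pr (c%:M : A) = 0.
Proof. by rewrite /pr mxtrace_scalar -[X in X / _]mulr_natr mulfK // subrr. Qed.

Lemma pr_idem (a : A) : pr (pr a) = pr a.
Proof. by rewrite pr_id // trace_pr. Qed.

Lemma prE (a : A) : a = pr a + (\tr a / N%:R) *: 1%:M.
Proof. by rewrite /pr scalemx1 subrK. Qed.

Lemma pr_commutator (a b : A) : pr (commutator a b) = commutator a b.
Proof. by rewrite pr_id // /commutator mxtraceD linearN /= mxtrace_mulC subrr. Qed.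

Lemma commutator_pr (a b : A) : commutator (pr a) (pr b) = commutator a b.
Proof.
rewrite /commutator /pr !mulmxBl !mulmxBr.
rewrite !mul_scalar_mx !mul_mx_scalar !scale_scalar_mx.
rewrite [(\tr b / _) * _]mulrC; move: (a *m b) (b *m a) (_%:M) => x y z.
by apply/matrixP => i j; rewrite !mxE; ring.
Qed.

(** Exchanging the outer factors swaps legs 12 and 23 up to [leg21]. Combined with unitarity it maps
    the AYBE to an equation with all products in the opposite order. *)
Definition flip13 : AAA -> AAA := tlift3 (fun a b c => c *t b *t a).

Lemma flip13_tens a b c : flip13 (a *t b *t c) = c *t b *t a.
Proof. by apply: tlift3_tens => u w d p q; rewrite ?LP. Qed.

Lemma flip13P : linear flip13. Proof. exact: tlift3_linear. Qed.

Lemma flip13M X Y : flip13 (X *m Y) = flip13 X *m flip13 Y.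
Proof.
move: X Y; apply: tens3_ext2 => [s|s|r|r|a b c a' b' c'];
  try by move=> u v w; rewrite ?(flip13P, LP) // ?flip13P.
by rewrite !tensmx_mul !flip13_tens !tensmx_mul.
Qed.

Lemma flip13_leg12 (r : AA) : flip13 (leg12 r) = leg23 (leg21 r).
Proof.
move: r; apply: tens_ext => [u v w|u v w|a b]; rewrite ?LP ?flip13P //.
by rewrite leg21_tens leg12_tens leg23_tens flip13_tens.
Qed.

Lemma flip13_leg13 (r : AA) : flip13 (leg13 r) = leg13 (leg21 r).
Proof.
move: r; apply: tens_ext => [u v w|u v w|a b]; rewrite ?LP ?flip13P //.
by rewrite leg21_tens !leg13_tens flip13_tens.
Qed.

Lemma flip13_leg23 (r : AA) : flip13 (leg23 r) = leg12 (leg21 r).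
Proof.
move: r; apply: tens_ext => [u v w|u v w|a b]; rewrite ?LP ?flip13P //.
by rewrite leg21_tens leg12_tens leg23_tens flip13_tens.
Qed.

Lemma pr3_flip13 X : pr3 (flip13 X) = flip13 (pr3 X).
Proof.
move: X; apply: tens3_ext => [u v w|u v w|a b c]; rewrite ?(flip13P, LP) ?flip13P //.
by rewrite pr3_tens !flip13_tens pr3_tens.
Qed.

Let pr1 : pr (1%:M : A) = 0. Proof. exact: pr_scalar. Qed.

Let tens0l (m n p q : nat) (b : 'M[K]_(p, q)) : (0 : 'M[K]_(m, n)) *t b = 0.
Proof. exact: tens0mx. Qed.
Let tens0r (m n p q : nat) (a : 'M[K]_(p, q)) : a *t (0 : 'M[K]_(m, n)) = 0.
Proof. exact: tensmx0. Qed.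

Lemma pr3_leg12 (r : AA) : pr3 (leg12 r) = 0.
Proof.
move: r; apply: tens_ext => [u v w|u v w|a b]; rewrite ?LP ?scaler0 ?addr0 //.
by rewrite leg12_tens pr3_tens pr1 tens0r.
Qed.

Lemma pr3_leg13 (r : AA) : pr3 (leg13 r) = 0.
Proof.
move: r; apply: tens_ext => [u v w|u v w|a b]; rewrite ?LP ?scaler0 ?addr0 //.
by rewrite leg13_tens pr3_tens pr1 tens0r tens0l.
Qed.

Lemma pr3_leg23 (r : AA) : pr3 (leg23 r) = 0.
Proof.
move: r; apply: tens_ext => [u v w|u v w|a b]; rewrite ?LP ?scaler0 ?addr0 //.
by rewrite leg23_tens pr3_tens pr1 !tens0l.
Qed.

(** The shared factor carries a commutator of matrices, which is traceless and does not change when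
    scalar parts are removed from its arguments. So on commutators, unlike on products, [pr3] passes
    to the two arguments without correction terms. *)
Lemma pr3_commutator_12_13 (r s : AA) :
  pr3 (commutator (leg12 r) (leg13 s)) = commutator (leg12 (pr2 r)) (leg13 (pr2 s)).
Proof.
move: r s; apply: tens_ext2 => [s|s|r|r|a b c d];
  try by move=> u v w; rewrite /commutator !LP opprD addrACA -scalerN -scalerDr ?LP.
rewrite !pr2_tens !leg12_tens !leg13_tens /commutator !tensmx_mul !mulmx1 !mul1mx.
rewrite -!(linear_sub (tensmx_linearl _)) pr3_tens.
by rewrite -!/(commutator _ _) commutator_pr pr_commutator.
Qed.

Lemma pr3_commutator_23_12 (r s : AA) :
  pr3 (commutator (leg23 s) (leg12 r)) = commutator (leg23 (pr2 s)) (leg12 (pr2 r)).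
Proof.
move: r s; apply: tens_ext2 => [s|s|r|r|a b c d];
  try by move=> u v w; rewrite /commutator !LP opprD addrACA -scalerN -scalerDr ?LP.
rewrite !pr2_tens !leg12_tens !leg23_tens /commutator !tensmx_mul !mulmx1 !mul1mx.
rewrite -!(linear_sub (tensmx_linearl _)) -!(linear_sub (tensmx_linearr _)) pr3_tens.
by rewrite -!/(commutator _ _) commutator_pr pr_commutator.
Qed.

Lemma pr3_commutator_13_23 (r s : AA) :
  pr3 (commutator (leg13 r) (leg23 s)) = commutator (leg13 (pr2 r)) (leg23 (pr2 s)).
Proof.
move: r s; apply: tens_ext2 => [s|s|r|r|a b c d];
  try by move=> u v w; rewrite /commutator !LP opprD addrACA -scalerN -scalerDr ?LP.
rewrite !pr2_tens !leg13_tens !leg23_tens /commutator !tensmx_mul !mulmx1 !mul1mx.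
rewrite -!(linear_sub (tensmx_linearr _)) pr3_tens.
by rewrite -!/(commutator _ _) commutator_pr pr_commutator.
Qed.

Definition ins13 (s : AA) (b : A) : AAA := tlift (fun a' b' => a' *t b *t b') s.

Lemma ins13_linearl b : linear (ins13^~ b). Proof. exact: tlift_linear. Qed.

Lemma ins13_linearr s : linear (ins13 s).
Proof. by apply: tlift_linear_param => a b c x y; rewrite !LP. Qed.

Lemma ins13_tens a b c : ins13 (a *t c) b = a *t b *t c.
Proof. by apply: tlift_tens => x u v w; rewrite !LP. Qed.

Definition ins23 (s : AA) (a : A) : AAA := tlift (fun b c => a *t b *t c) s.

Lemma ins23_linearl b : linear (ins23^~ b). Proof. exact: tlift_linear. Qed.

Lemma ins23_linearr s : linear (ins23 s).
Proof. by apply: tlift_linear_param => a b c x y; rewrite !LP. Qed.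

Lemma ins23_tens a b c : ins23 (b *t c) a = a *t b *t c.
Proof. by apply: tlift_tens => x u v w; rewrite !LP. Qed.

Let IP := (ins13_linearl, ins13_linearr, ins23_linearl, ins23_linearr).

(** The factor [N%:R^-1] compensates for the trace of the identity: [left_part r *t 1%:M] is the
    component of [r] in sl (x) 1 when Mat(N) is split into traceless and scalar matrices. *)
Definition left_part (r : AA) : A := N%:R^-1 *: pr (tract r 1%:M).
Definition right_part (r : AA) : A := left_part (leg21 r).

Lemma left_partP : linear left_part.
Proof. by move=> c x y; rewrite /left_part !LP scalerDr !scalerA mulrC. Qed.

Lemma right_partP : linear right_part.
Proof. by move=> c x y; rewrite /right_part LP left_partP. Qed.

Lemma left_part_tens a b : left_part (a *t b) = (\tr b / N%:R) *: pr a.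
Proof.
by rewrite /left_part tract_tens mulmx1 (linear_scale (@pr_linear K N)) scalerA mulrC.
Qed.

Lemma right_part_tens a b : right_part (a *t b) = (\tr a / N%:R) *: pr b.
Proof. by rewrite /right_part leg21_tens left_part_tens. Qed.

Lemma tensor_decomposition r : exists c,
  r = pr2 r + left_part r *t 1%:M + 1%:M *t right_part r + c *: 1%:M.
Proof.
exists (\tr (tract r 1%:M) / N%:R / N%:R); move: r; apply: tens_ext => [//|u v w|a b].
  rewrite left_partP right_partP !LP mxtraceD mxtraceZ.
  by apply/matrixP => i j; rewrite !mxE; ring.
rewrite left_part_tens right_part_tens pr2_tens tract_tens mulmx1 mxtraceZ.
rewrite {1}[a]prE {1}[b]prE (linear_add (tensmx_linearl _)) !(linear_add (tensmx_linearr _)).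
rewrite !(linear_scale (tensmx_linearl _)) !(linear_scale (tensmx_linearr _)) tens11 scalerA.
apply/matrixP => i j; rewrite !mxE; ring.
Qed.

Let split_mul (a b : A) : pr (a *m b) =
  pr (pr a *m pr b) + (\tr b / N%:R) *: pr a + (\tr a / N%:R) *: pr b.
Proof.
rewrite {1}[a]prE {1}[b]prE; move: (pr_idem a) (pr_idem b).
move: (pr a) (pr b) (_ / _) (_ / _) => u v y x uu vv.
rewrite mulmxDl !mulmxDr -!scalemxAl -!scalemxAr !mul1mx !mulmx1.
rewrite !(linear_add (@pr_linear K N)) !(linear_scale (@pr_linear K N)) pr1 !scaler0 addr0.
by rewrite uu vv ?addrA // addrAC.
Qed.

Let linear_add3 (V : lmodType K) c (x1 x2 x3 y1 y2 y3 : V) :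
  c *: x1 + y1 + (c *: x2 + y2) + (c *: x3 + y3) = c *: (x1 + x2 + x3) + (y1 + y2 + y3).
Proof. by rewrite !scalerDr (addrACA (c *: x1)) (addrACA (c *: x1 + _)). Qed.

(** Only the shared factor is a product. There [split_mul] yields two correction terms, in which the
    scalar part of one tensor multiplies the traceless part of the other. They are where [M] enters
    the projected AYBE. *)
Lemma pr3_mul_12_13 (r s : AA) : pr3 (leg12 r *m leg13 s) =
  pr3 (leg12 (pr2 r) *m leg13 (pr2 s)) + pr2 r *t right_part s + ins13 (pr2 s) (right_part r).
Proof.
move: r s; apply: tens_ext2 => [s|s|r|r|a b c d];
  [by move=> u v w; rewrite !LP|by move=> u v w; rewrite !LP right_partP IP linear_add3|
   by move=> u v w; rewrite !LP|by move=> u v w; rewrite !LP right_partP !LP IP linear_add3|].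
rewrite !pr2_tens !leg12_tens !leg13_tens !tensmx_mul !mulmx1 !mul1mx !pr3_tens !pr_idem.
rewrite !right_part_tens !ins13_tens split_mul.
move: (pr (pr a *m pr c)) (pr a) (pr b) (pr c) (pr d) (_ / _) (_ / _) => *.
by apply/matrixP => i j; rewrite !mxE; ring.
Qed.

Lemma pr3_mul_23_12 (r s : AA) : pr3 (leg23 s *m leg12 r) =
  pr3 (leg23 (pr2 s) *m leg12 (pr2 r)) + pr2 r *t right_part s + ins23 (pr2 s) (left_part r).
Proof.
move: r s; apply: tens_ext2 => [s|s|r|r|a b c d];
  [by move=> u v w; rewrite !LP|by move=> u v w; rewrite !LP left_partP IP linear_add3|
   by move=> u v w; rewrite !LP|by move=> u v w; rewrite !LP right_partP !LP IP linear_add3|].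
rewrite !pr2_tens !leg12_tens !leg23_tens !tensmx_mul !mulmx1 !mul1mx !pr3_tens !pr_idem.
rewrite !right_part_tens !left_part_tens !ins23_tens split_mul.
move: (pr (pr c *m pr b)) (pr a) (pr b) (pr c) (pr d) (_ / _) (_ / _) => *.
by apply/matrixP => i j; rewrite !mxE; ring.
Qed.

Lemma pr3_mul_13_23 (r s : AA) : pr3 (leg13 r *m leg23 s) =
  pr3 (leg13 (pr2 r) *m leg23 (pr2 s)) + ins23 (pr2 s) (left_part r) + ins13 (pr2 r) (left_part s).
Proof.
move: r s; apply: tens_ext2 => [s|s|r|r|a b c d];
  [by move=> u v w; rewrite !LP|by move=> u v w; rewrite !LP left_partP !IP linear_add3|
   by move=> u v w; rewrite !LP|by move=> u v w; rewrite !LP left_partP !IP linear_add3|].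
rewrite !pr2_tens !leg13_tens !leg23_tens !tensmx_mul !mulmx1 !mul1mx !pr3_tens !pr_idem.
rewrite !left_part_tens !ins23_tens !ins13_tens split_mul.
move: (pr (pr b *m pr d)) (pr a) (pr b) (pr c) (pr d) (_ / _) (_ / _) => *.
by apply/matrixP => i j; rewrite !mxE; ring.
Qed.

Definition contract3 (m : A) : AAA -> AA := tlift3 (fun a b c => \tr (c *m m) *: (a *t b)).

Lemma contract3P m : linear (contract3 m). Proof. exact: tlift3_linear. Qed.

Lemma contract3_tens m a b c : contract3 m (a *t b *t c) = \tr (c *m m) *: (a *t b).
Proof.
apply: tlift3_tens => u w d p q.
- by rewrite mulmx_linearl mxtraceD mxtraceZ scalerDl scalerA.
- by rewrite tensmx_linearr scalerDr !scalerA mulrC.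
- by rewrite tensmx_linearl scalerDr !scalerA mulrC.
Qed.

Lemma contract3_ins12 m r c : contract3 m (r *t c) = \tr (c *m m) *: r.
Proof.
move: r; apply: tens_ext => [u v w|u v w|a b]; first by rewrite LP contract3P.
  by rewrite scalerDr !scalerA mulrC.
exact: contract3_tens.
Qed.

Lemma contract3_ins13 m s b : contract3 m (ins13 s b) = tract s m *t b.
Proof.
move: s; apply: tens_ext => [u v w|u v w|a c]; rewrite ?LP ?IP ?contract3P //.
by rewrite ins13_tens contract3_tens tract_tens (linear_scale (tensmx_linearl _)).
Qed.

Lemma contract3_ins23 m s a : contract3 m (ins23 s a) = a *t tract s m.
Proof.
move: s; apply: tens_ext => [u v w|u v w|b c]; rewrite ?LP ?IP ?contract3P //.
by rewrite ins23_tens contract3_tens tract_tens (linear_scale (tensmx_linearr _)).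
Qed.

End ProjectedTensors.

(** * Nondegeneracy, infinitesimal symmetries and derivations of the matrix algebra *)

Section TensorFacts.
Context {K : fieldType} {N : nat}.
Notation A := 'M[K]_N.
Notation AA := 'M[K]_(N * N).
Notation AAA := 'M[K]_(N * N * N).

Let LP := (@leg12P K N, @leg13P K N, @leg23P K N, @leg21P K N, @pr2P K N, @pr3P K N, @mulmx_linearl K, @mulmx_linearr K,
  @tract_linearl K N, @tract_linearr K N, @tlift_linear K N, @tlift3_linear K N,
  @tensmx_linearl K, @tensmx_linearr K, @pr_linear K N).

Lemma linear_formE (f : {linear A -> K^o}) : exists y : A, forall a, f a = \tr (a *m y).
Proof.
exists (\matrix_(i, j) f (delta_mx j i)) => a.
rewrite {1}[a]matrix_sum_delta linear_sum /mxtrace; apply: eq_bigr => i _.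
rewrite linear_sum mxE; apply: eq_bigr => j _.
by rewrite linearZ mxE.
Qed.

(** [nondegenerate_on] contracts the first factor and [tract] the second, whence the [leg21];
    unitarity removes it later. *)
Lemma tlift_form (f : {linear A -> K^o}) y : (forall a, f a = \tr (a *m y)) ->
  forall t, tlift (fun a b => f a *: b) t = tract (leg21 t) y.
Proof.
move=> fy; apply: tens_ext => [u v w|u v w|a b]; try by rewrite !LP.
rewrite leg21_tens tract_tens tlift_tens ?fy // => x c u v.
  by rewrite scalerDr !scalerA mulrC.
by rewrite linearP scalerDl scalerA.
Qed.

Lemma nondegenerate_tract (t : AA) : nondegenerate_on predT t ->
  forall y, tract (leg21 t) y = 0 -> y = 0.
Proof.
move=> nd y ty; pose f (a : A) : K^o := \tr (a *m y).
have fl : linear f by move=> c u v; rewrite /f mulmx_linearl mxtraceD mxtraceZ.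
pose F : {linear A -> K^o} := HB.pack f (GRing.isLinear.Build _ _ _ _ _ fl).
have := nd F; rewrite (tlift_form (y := y)) // => /(_ ty) F0.
by apply: trace_pairing => z; rewrite mxtrace_mulC; exact: F0.
Qed.

Lemma nondegenerate_slP (t : AA) : nondegenerate_on sl t <->
  forall y, tract (leg21 t) y = 0 -> forall a, \tr a = 0 -> \tr (a *m y) = 0.
Proof.
split=> [nd y ty a a0|nd f].
  pose f (a : A) : K^o := \tr (a *m y).
  have fl : linear f by move=> c u v; rewrite /f mulmx_linearl mxtraceD mxtraceZ.
  pose F : {linear A -> K^o} := HB.pack f (GRing.isLinear.Build _ _ _ _ _ fl).
  have := nd F; rewrite (tlift_form (y := y)) // => /(_ ty) F0.
  by apply: F0; rewrite inE a0.
have [y fy] := linear_formE f; rewrite (tlift_form fy) => /nd H a.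
by rewrite inE => /eqP a0; rewrite fy H.
Qed.

(** [pr] is its own transpose for the trace pairing [\tr (b *m y)]. *)
Lemma tract_pr2 (r : AA) y : tract (pr2 r) y = pr (tract r (pr y)).
Proof.
move: r; apply: tens_ext => [u v w|u v w|a b]; try by rewrite !LP.
rewrite pr2_tens !tract_tens (linear_scale (@pr_linear K N)); congr (_ *: _).
rewrite /pr mulmxBl mulmxBr mul_scalar_mx mul_mx_scalar !mxtraceD !linearN /= !mxtraceZ.
by rewrite mulrAC [\tr b * _]mulrC mulrAC.
Qed.

Lemma leg21_pr2 (r : AA) : leg21 (pr2 r) = pr2 (leg21 r).
Proof.
move: r; apply: tens_ext => [u v w|u v w|a b]; try by rewrite !LP.
by rewrite pr2_tens !leg21_tens pr2_tens.
Qed.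

Hypothesis N0 : N%:R != 0 :> K.

Lemma in_tensor_square_pr2 (t : AA) : in_tensor_square sl (pr2 t).
Proof.
(* [in_tensor_square] asks for a sum over some ['I_n], so the fourfold sum over matrix units is
   enumerated through the finite type of index quadruples. *)
pose I : finType := (('I_N * 'I_N) * ('I_N * 'I_N))%type.
pose al (p : I) := t (mxtens_index (p.1.1, p.2.1)) (mxtens_index (p.1.2, p.2.2)) *:
  pr (delta_mx p.1.1 p.1.2) : A.
pose be (p : I) := pr (delta_mx p.2.1 p.2.2) : A.
exists #|I|, (fun k => al (enum_val k)), (fun k => be (enum_val k)); split.
  by move=> k; rewrite !inE /al /be mxtraceZ !trace_pr // mulr0.
transitivity (\sum_p al p *t be p); last first.
  have [g gK Kg] := @enum_val_bij I.
  by rewrite (reindex (@enum_val I I)) //; exists g => x _; [exact: gK|exact: Kg].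
rewrite /pr2 /tlift.
rewrite pair_bigA /= [RHS](_ : _ = \sum_(p : 'I_N * 'I_N) \sum_(q : 'I_N * 'I_N) al (p, q) *t be (p, q)); last first.
  by rewrite pair_bigA; apply: eq_bigr => -[].
apply: eq_bigr => p _; rewrite pair_bigA; apply: eq_bigr => q _.
by rewrite /al /be (linear_scale (tensmx_linearl _)).
Qed.

Lemma leg13_inj (r : AA) : leg13 r = 0 -> r = 0.
Proof.
(* The partial trace over the middle factor; it sends [leg13 r] to [N%:R *: r]. *)
pose c2 : AAA -> AA := tlift3 (fun a b c => \tr b *: (a *t c)).
have c2P : linear c2 by exact: tlift3_linear.
have c2E a b c : c2 (a *t b *t c) = \tr b *: (a *t c).
  apply: tlift3_tens => u w d p q.
  - by rewrite LP scalerDr !scalerA mulrC.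
  - by rewrite mxtraceD mxtraceZ scalerDl scalerA.
  - by rewrite LP scalerDr !scalerA mulrC.
have H : forall r, c2 (leg13 r) = N%:R *: r.
  apply: tens_ext => [u v w|u v w|a b]; first by rewrite LP c2P.
    by rewrite scalerDr !scalerA mulrC.
  by rewrite leg13_tens c2E mxtrace1.
move=> r0; have := H r; rewrite r0 (linear_zero c2P) => /esym/eqP.
by rewrite scaler_eq0 (negPf N0) => /eqP.
Qed.

Definition coproduct (M : A) : AA := M *t 1%:M + 1%:M *t M.

(** In [leg12 (coproduct M)] the summand [1%:M *t M] sits in the middle factor, where [leg13 r] is
    the identity, so it commutes and drops out. *)
Lemma commutator_leg12_leg13 (M : A) (r : AA) :
  commutator (leg12 (coproduct M)) (leg13 r) = leg13 (commutator (M *t 1%:M) r).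
Proof.
move: r; apply: tens_ext => [u v w|u v w|a b].
- by rewrite /commutator !LP opprD addrACA -scalerN -scalerDr.
- by rewrite /commutator !LP opprD addrACA -scalerN -scalerDr LP.
rewrite /coproduct (linear_add leg12P) !leg12_tens leg13_tens /commutator.
rewrite (linear_sub leg13P) !tensmx_mul !mulmx1 !mul1mx !leg13_tens.
rewrite mulmxDl mulmxDr !tensmx_mul !mulmx1 !mul1mx opprD addrACA.
by rewrite subrr addr0.
Qed.

(** Bracketing with [M] kills scalars and produces traceless matrices, hence commutes with [pr] in
    each factor. *)
Lemma pr2_commutator_coproduct (M : A) (r : AA) :
  pr2 (commutator (coproduct M) r) = commutator (coproduct M) (pr2 r).
Proof.
have prC (a b : A) : pr (a *m b) - pr (b *m a) = a *m pr b - pr b *m a.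
  rewrite -(linear_sub (@pr_linear K N)) -/(commutator a b) pr_commutator // /commutator.
  rewrite /pr mulmxBr mulmxBl mul_scalar_mx mul_mx_scalar.
  by apply/matrixP => i j; rewrite !mxE; ring.
move: r; apply: tens_ext => [u v w|u v w|a b].
- by rewrite /commutator !LP opprD addrACA -scalerN -scalerDr LP.
- by rewrite /commutator !LP opprD addrACA -scalerN -scalerDr.
rewrite /coproduct /commutator mulmxDl mulmxDr !tensmx_mul !mulmx1 !mul1mx.
rewrite pr2_tens mulmxDl mulmxDr !tensmx_mul !mulmx1 !mul1mx.
rewrite (linear_sub pr2P (_ + _)) (linear_add pr2P (_ *t b)).
rewrite (linear_add pr2P ((a *m M) *t b)) !pr2_tens.
have prE' x : pr (M *m x) = M *m pr x - pr x *m M + pr (x *m M) by rewrite -prC subrK.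
rewrite !prE'; move: (M *m pr a) (pr a *m M) (M *m pr b) (pr b *m M) => x1 x2 x3 x4.
move: (pr (a *m M)) (pr (b *m M)) (pr a) (pr b) => x5 x6 x7 x8.
by apply/matrixP => i j; rewrite !mxE; ring.
Qed.

Lemma tract1 (y : A) : tract (1%:M : AA) y = \tr y *: 1%:M.
Proof. by rewrite -tens11 tract_tens mul1mx. Qed.

Lemma coproduct_scalar (M : A) (c : K) : \tr M = 0 -> coproduct M = c *: 1%:M -> M = 0.
Proof.
move=> M0 E; have := congr1 (tract^~ 1%:M) E.
rewrite /coproduct /= (linear_add (tract_linearl _)) !tract_tens !mulmx1 M0 scale0r addr0.
rewrite mxtrace1 (linear_scale (tract_linearl _)) tract1 mxtrace1 scalerA => NM.
have {}NM : M = c *: 1%:M.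
  by apply: (scalerI N0); rewrite NM scalerA mulrC.
move: M0; rewrite NM mxtraceZ mxtrace1 => /eqP; rewrite mulf_eq0 (negPf N0) orbF.
by move=> /eqP ->; rewrite scale0r.
Qed.

Lemma central_scalar (x : A) : (forall y, x *m y = y *m x) -> exists c, x = c%:M.
Proof.
case: N x => [|n] x xC; first by exists 0; apply/matrixP => -[].
exists (x 0 0); apply/matrixP => i j; rewrite mxE.
have /matrixP/(_ i 0) := xC (delta_mx j 0).
rewrite !mxE (bigD1 j) //= mxE !eqxx mulr1 big1 ?addr0 => [->|k kj]; last first.
  by rewrite mxE (negPf kj) mulr0.
have [->|ij] := eqVneq i j.
  rewrite (bigD1 0) //= mxE !eqxx mul1r big1 ?addr0 // => k k0.
  by rewrite mxE (negPf k0) andbF mul0r.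
by rewrite big1 // => k _; rewrite mxE (negPf ij) mul0r.
Qed.

Lemma derivation_inner (d : A -> A) : linear d ->
  (forall x y, d (x *m y) = d x *m y + x *m d y) -> exists x, forall y, d y = x *m y - y *m x.
Proof.
case: N d => [|n] d dl dM; first by exists 0 => y; apply/matrixP => -[].
pose D : {linear 'M[K]_n.+1 -> 'M[K]_n.+1} := HB.pack d (GRing.isLinear.Build _ _ _ _ _ dl).
(* The classical inner element. The sum of [d (y *m delta_mx i 0) *m delta_mx 0 i] is evaluated by
   the Leibniz rule in [S1] and by linearity of [d] in [S2]; comparing the two gives the claim. *)
exists (\sum_i d (delta_mx i 0) *m delta_mx 0 i) => y.
rewrite mulmx_suml mulmx_sumr -sumrB.
have E i : d (y *m delta_mx i 0) *m delta_mx 0 i =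
    d y *m delta_mx i i + y *m (d (delta_mx i 0) *m delta_mx 0 i).
  by rewrite dM mulmxDl -!mulmxA mul_delta_mx.
have S1 : \sum_i d (y *m delta_mx i 0) *m delta_mx 0 i =
    d y + \sum_i y *m (d (delta_mx i 0) *m delta_mx 0 i).
  rewrite (eq_bigr _ (fun i _ => E i)) big_split /= -mulmx_sumr -mx1_sum_delta mulmx1 //.
have S2 : \sum_i d (y *m delta_mx i 0) *m delta_mx 0 i =
    \sum_i d (delta_mx i 0) *m delta_mx 0 i *m y.
  have y0 i : y *m delta_mx i 0 = \sum_j y j i *: delta_mx j 0 :> 'M[K]_(n.+1).
    apply/matrixP => p q; rewrite summxE mxE (bigD1 i) //= big1 ?addr0 => [|k ki]; last first.
      by rewrite mxE (negPf ki) mulr0.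
    rewrite (bigD1 p) //= big1 ?addr0 => [|k kp]; first by rewrite !mxE !eqxx.
    by rewrite !mxE eq_sym (negPf kp) mulr0.
  have y1 j : delta_mx 0 j *m y = \sum_i y j i *: delta_mx 0 i :> 'M[K]_(n.+1).
    apply/matrixP => p q; rewrite summxE mxE (bigD1 j) //= big1 ?addr0 => [|k kj]; last first.
      by rewrite mxE (negPf kj) andbF mul0r.
    rewrite (bigD1 q) //= big1 ?addr0 => [|k kq]; first by rewrite !mxE !eqxx mulrC.
    by rewrite !mxE [q == k]eq_sym (negPf kq) andbF mulr0.
  under eq_bigr => i _ do rewrite y0 -[d _]/(D _) linear_sum mulmx_suml.
  under [RHS]eq_bigr => i _ do rewrite -mulmxA y1 mulmx_sumr.
  rewrite exchange_big; apply: eq_bigr => i _; apply: eq_bigr => j _.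
  by rewrite linearZ -scalemxAl -scalemxAr.
by rewrite sumrB -S2 S1 addrK.
Qed.

(** The span of [delta_mx 0 0], [delta_mx 0 1] and [delta_mx 1 0] contains no scalar matrix but 0,
    and two linear conditions on it leave a nonzero solution. *)
Lemma pairing_kernel (X M : A) : (1 < N)%N ->
  exists y : A, [/\ \tr (X *m y) = 0, \tr (M *m y) = 0 & forall c, y <> c%:M].
Proof.
case: N X M => [|[|n]] // X M _.
pose e (i : 'I_3) : 'M[K]_n.+2 :=
  nth 0 [:: delta_mx 0 0; delta_mx 0 1; delta_mx 1 0] i.
pose B : 'M[K]_(3, 2) := \matrix_(i, j) if j == 0 then \tr (X *m e i) else \tr (M *m e i).
have kB : kermx B != 0.
  rewrite -mxrank_eq0 mxrank_ker subn_eq0 -ltnNge.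
  exact: leq_ltn_trans (rank_leq_col B) _.
have [i ki] : exists i, row i (kermx B) != 0.
  apply/existsP; apply: contraNT kB; rewrite negb_exists => /forallP H.
  by apply/eqP/row_matrixP => i; rewrite row0; apply/eqP/negPn/H.
have : row i (kermx B) *m B = 0 by apply/sub_kermxP; exact: row_sub.
move: (row i (kermx B)) ki => u ki uB.
pose y := \sum_k u 0 k *: e k.
have trE (Z : 'M[K]_n.+2) : \tr (Z *m y) = \sum_k u 0 k * \tr (Z *m e k).
  rewrite mulmx_sumr linear_sum /=; apply: eq_bigr => k _.
  by rewrite -scalemxAr mxtraceZ.
exists y; split.
- have /matrixP/(_ 0 0) := uB; rewrite [LHS]mxE [RHS]mxE trE => H; rewrite -[RHS]H.
  by apply: eq_bigr => k _; rewrite [B _ _]mxE eqxx.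
- have /matrixP/(_ 0 1) := uB; rewrite [LHS]mxE [RHS]mxE trE => H; rewrite -[RHS]H.
  by apply: eq_bigr => k _; rewrite [B _ _]mxE.
move=> c yc; case/eqP: ki; apply/rowP => k; rewrite mxE.
have yE p q : y p q = u 0 0 * (delta_mx 0 0 : 'M[K]_n.+2) p q +
    u 0 1 * (delta_mx 0 1 : 'M[K]_n.+2) p q + u 0 2%:R * (delta_mx 1 0 : 'M[K]_n.+2) p q.
  rewrite /y !big_ord_recl big_ord0 addr0 !mxE addrA /e /=.
  congr (_ + _ * _ + _ * _); first by congr (u _ _); apply/val_inj.
  by congr (u _ _); apply/val_inj.
have h2 : u 0 2%:R = 0.
  by have /matrixP/(_ 1 0) := yc; rewrite yE !mxE /= !mulr0 !add0r mulr1.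
have h1 : u 0 1 = 0.
  by have /matrixP/(_ 0 1) := yc; rewrite yE !mxE /= !mulr0 addr0 add0r mulr1.
have h0 : u 0 0 = 0.
  have /matrixP/(_ 1 1) := yc; rewrite yE !mxE /= !mulr0 !addr0 => /esym c0.
  by have /matrixP/(_ 0 0) := yc; rewrite yE !mxE /= !mulr0 !addr0 mulr1 c0.
case: k => -[|[|[|//]]] k3.
- by rewrite -[RHS]h0; congr (u _ _); apply/val_inj.
- by rewrite -[RHS]h1; congr (u _ _); apply/val_inj.
- by rewrite -[RHS]h2; congr (u _ _); apply/val_inj.
Qed.

End TensorFacts.

(** * Line integrals and Cauchy expansions *)

Section UnitIntegral.
Context {R : realType}.
Implicit Types f F : R -> R.

(** Integrals are taken in the sense of Newton, as increments of a primitive; measure theory enters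
    only in [continuous_integrable01]. The derivatives are two-sided even at 0 and 1. *)
Definition primitive01 f F :=
  forall t : R, 0 <= t <= 1 -> is_derive t (1 : R) F (f t).

Lemma primitive01_MVT f F : primitive01 f F ->
  exists2 t : R, 0 <= t <= 1 & F 1 - F 0 = f t.
Proof.
move=> fF; have [||t] := @MVT_segment R F f 0 1 ler01.
- by move=> t; rewrite in_itv /= => /andP[t0 t1]; apply: fF; rewrite !ltW.
- apply: derivable_within_continuous => t; rewrite in_itv /= => /fF dF.
  exact: ex_derive.
by rewrite in_itv /= => t01; rewrite subr0 mulr1; exists t.
Qed.

(* Junk value 0 for functions without a primitive. *)
Definition integral01 f : R :=
  xget 0 [set I | exists2 F, primitive01 f F & I = F 1 - F 0].

Lemma integral01E f F : primitive01 f F -> integral01 f = F 1 - F 0.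
Proof.
move=> fF; apply: xget_unique; first by exists F.
move=> _ [G fG ->].
have dGF : primitive01 (fun=> 0) (fun t => G t - F t).
  move=> t t01; have := fF t t01; have := fG t t01 => dG dF.
  by apply: is_derive_eq; rewrite subrr.
by have [t _ /= E] := primitive01_MVT dGF; lra.
Qed.

Definition integrable01 f := exists F, primitive01 f F.

Lemma continuous_integrable01 f :
  (forall t : R, 0 <= t <= 1 -> {for t, continuous f}) -> integrable01 f.
Proof.
(* Composing with the clamp [cl] continues [f] by constants to the line. The primitive starts at
   [-1], so that 0 and 1 are interior points and the derivatives there are two-sided. *)
move=> cf; pose cl (t : R) := Num.max 0 (Num.min 1 t).
have ccl : continuous cl.
  move=> t; apply: (@continuous_max R R (cst 0) (fun t => Num.min 1 t)).
    exact: cvg_cst.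
  by apply: (@continuous_min R R (cst 1) id); [exact: cvg_cst|exact: cvg_id].
have cl01 t : 0 <= cl t <= 1.
  by rewrite /cl le_max lexx /= ge_max ler01 ge_min lexx.
have clE t : 0 <= t <= 1 -> cl t = t.
  by move=> /andP[t0 t1]; rewrite /cl (min_idPr t1) (max_idPr t0).
have cg : continuous (f \o cl).
  move=> t; apply: continuous_comp; first exact: ccl.
  by apply: cf; exact: cl01.
exists (fun x => (\int[lebesgue_measure]_(t in [set` `[(-1), x]]) (f \o cl) t)%R).
move=> t t01; have [t0 t1] := andP t01.
have [||||dF F'] := @continuous_FTC1_closed R (f \o cl) (-1) t 2.
- lra.
- apply: continuous_compact_integrable; first exact: segment_compact.
  exact: continuous_subspaceT.
- lra.
- exact: cg.
split; first exact: dF.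
by rewrite -derive1E F' /= clE.
Qed.

Lemma eq_integral01 f g : (forall t : R, 0 <= t <= 1 -> f t = g t) ->
  integrable01 f -> integral01 f = integral01 g.
Proof.
move=> fg [F fF]; rewrite (integral01E fF) (@integral01E g F) //.
by move=> t t01; rewrite -fg //; exact: fF.
Qed.

Lemma primitive01_lin c f g F G : primitive01 f F -> primitive01 g G ->
  primitive01 (fun t => c * f t + g t) (fun t => c * F t + G t).
Proof.
move=> fF gG t t01; have dF := fF t t01; have dG := gG t t01.
have -> : (fun t => c * F t + G t) = (cst c * F + G)%R by [].
by apply: is_derive_eq; rewrite /GRing.scale /= mulr0 addr0.
Qed.

Lemma integrable01_lin c f g : integrable01 f -> integrable01 g ->
  integrable01 (fun t => c * f t + g t).
Proof. by move=> [F fF] [G gG]; eexists; exact: primitive01_lin fF gG. Qed.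

Lemma integral01_lin c f g : integrable01 f -> integrable01 g ->
  integral01 (fun t => c * f t + g t) = c * integral01 f + integral01 g.
Proof.
move=> [F fF] [G gG]; rewrite (integral01E fF) (integral01E gG).
rewrite (integral01E (primitive01_lin c fF gG)); ring.
Qed.

Lemma integral01_mean f : integrable01 f ->
  exists2 t : R, 0 <= t <= 1 & integral01 f = f t.
Proof. by move=> [F fF]; rewrite (integral01E fF); exact: primitive01_MVT. Qed.

Lemma is_derive_affine (a b t : R) : is_derive t (1 : R) (fun t => a + b * t) b.
Proof.
have -> : (fun t => a + b * t) = (cst a + b \*: id)%R.
  by apply/funext => x; rewrite /= fctE.
by apply: is_derive_eq; rewrite add0r /GRing.scale /= mulr1.
Qed.

Lemma primitive01_affine f F a b : primitive01 f F -> b != 0 ->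
  (forall t : R, 0 <= t <= 1 -> 0 <= a + b * t <= 1) ->
  primitive01 (fun t => f (a + b * t)) (fun t => b^-1 * F (a + b * t)).
Proof.
move=> fF b0 ab t t01; have dF := fF _ (ab _ t01).
have da := is_derive_affine a b t.
have dc := @is_derive1_comp _ F (fun t => a + b * t) t _ _ dF da.
have -> : (fun t => b^-1 * F (a + b * t)) =
   (cst b^-1 * (F \o (fun t => a + b * t)))%R by [].
by apply: is_derive_eq; rewrite /GRing.scale /= mulr0 addr0 mulrCA mulVf ?mulr1.
Qed.

Lemma integral01_rev f : integrable01 f ->
  integral01 (fun t => f (1 - t)) = integral01 f.
Proof.
move=> [F fF]; rewrite (integral01E fF).
have := @primitive01_affine f F 1 (-1) fF.
rewrite oppr_eq0 oner_eq0 => /(_ isT) pF.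
have {}pF := pF (ltac:(move=> t; lra)).
rewrite (_ : (fun t => f (1 - t)) = (fun t => f (1 + -1 * t))); last first.
  by apply/funext => t; rewrite mulN1r.
by rewrite (integral01E pF) mulr0 addr0 mulr1 subrr invrN1; ring.
Qed.

Lemma integral01_split f : integrable01 f ->
  integral01 f = 2^-1 * integral01 (fun t => f (2^-1 * t)) +
                 2^-1 * integral01 (fun t => f (2^-1 + 2^-1 * t)).
Proof.
move=> [F fF]; rewrite (integral01E fF).
have h0 : (2^-1 : R) != 0 by rewrite invr_eq0 pnatr_eq0.
have p1 := @primitive01_affine f F 0 2^-1 fF h0 (ltac:(move=> t; lra)).
have p2 := @primitive01_affine f F 2^-1 2^-1 fF h0 (ltac:(move=> t; lra)).
rewrite (_ : (fun t => f (2^-1 * t)) = (fun t => f (0 + 2^-1 * t))); last first.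
  by apply/funext => t; rewrite add0r.
rewrite (integral01E p1) (integral01E p2) !mulr0 !addr0 !mulr1 add0r.
have -> : 2^-1 + 2^-1 = 1 :> R by lra.
by field.
Qed.

End UnitIntegral.

(** * The real-valued modulus and epsilon-delta forms of complex limits *)

Section ComplexModulus.
Context {R : realType}.
Implicit Types x y z : R[i].
Notation nc := (@Normc.normc R).
Notation Re := (@complex.Re R).
Notation Im := (@complex.Im R).

Lemma normrcE z : `|z| = (nc z)%:C.
Proof. by case: z => a b; rewrite normc_def. Qed.

Lemma normc_ge0 z : 0 <= nc z.
Proof. by case: z => a b; rewrite /= sqrtr_ge0. Qed.

Lemma ler_normcD x y : nc (x + y) <= nc x + nc y.
Proof. by rewrite -lecR rmorphD /= -!normrcE ler_normD. Qed.

Lemma normcN z : nc (- z) = nc z.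
Proof. by case: z => a b /=; rewrite !sqrrN. Qed.

Lemma normcB x y : nc (x - y) = nc (y - x).
Proof. by rewrite -normcN opprB. Qed.

Lemma normcX z n : nc (z ^+ n) = nc z ^+ n.
Proof.
elim: n => [|n IH]; first by rewrite !expr0 Normc.normc1.
by rewrite !exprS Normc.normcM IH.
Qed.

Lemma normc_real (a : R) : nc a%:C = `|a|.
Proof. by rewrite /= expr0n addr0 sqrtr_sqr. Qed.

Lemma normc_gt0 z : (0 < nc z) = (z != 0).
Proof.
rewrite lt_def normc_ge0 andbT; apply/idP/idP; apply: contra => /eqP.
  by move=> ->; rewrite Normc.normc0.
by move=> /Normc.eq0_normc ->.
Qed.

Lemma ler_Re_normc z : `|Re z| <= nc z.
Proof. by rewrite -lecR -normrcE normc_ge_Re. Qed.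

Lemma ler_Im_normc z : `|Im z| <= nc z.
Proof.
case: z => a b /=; rewrite -sqrtr_sqr ler_wsqrtr //.
by rewrite lerDr sqr_ge0.
Qed.

Lemma ler_normc_ReIm z : nc z <= `|Re z| + `|Im z|.
Proof.
have i1 : nc 'i%C = 1 by rewrite /= expr0n expr1n add0r sqrtr1.
rewrite {1}[z]complexE (le_trans (ler_normcD _ _)) // Normc.normcM !normc_real.
by rewrite i1 mul1r.
Qed.

Lemma gt0_realC (e : R[i]) : 0 < e -> exists2 d : R, 0 < d & e = d%:C.
Proof.
case: e => a b; rewrite ltcE /= => /andP[/eqP -> a0]; exists a => //.
Qed.

Lemma near_normcP (p : R[i]) (P : R[i] -> Prop) :
  (\forall z \near p, P z) <->
  exists2 d : R, 0 < d & forall z, nc (z - p) < d -> P z.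
Proof.
split.
  move=> /nbhs_normP[e /= /gt0_realC[d d0 ->]] H; exists d => // z zp.
  by apply: H; rewrite /= /ball_ /= distrC normrcE ltcR.
move=> [d d0 H]; apply/nbhs_normP; exists d%:C; first by rewrite /= ltcR.
by move=> z /=; rewrite distrC normrcE ltcR => /H.
Qed.

Lemma continuous_normcP (f : R[i] -> R[i]) p : {for p, continuous f} <->
  forall e : R, 0 < e -> exists2 d, 0 < d &
    forall z, nc (z - p) < d -> nc (f z - f p) < e.
Proof.
split.
  move=> /cvgrPdist_lt H e e0.
  have /near_normcP[d d0 {}H] := H e%:C (ltac:(by rewrite ltcR)).
  by exists d => // z /H; rewrite normrcE ltcR normcB.
move=> H; apply/(@cvgrPdist_lt _ _ _ (nbhs p)) => _ /gt0_realC[e e0 ->].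
have [d d0 {}H] := H e e0; apply/near_normcP; exists d => // z /H.
by rewrite normrcE ltcR normcB.
Qed.

(** The difference quotient is cleared of its denominator, so that the estimate includes [z = p] and
    can be used on whole triangles. *)
Lemma derivable_normcP (f : R[i] -> R[i]) p : derivable f p 1 ->
  exists D : R[i], forall e : R, 0 < e -> exists2 d, 0 < d &
    forall z, nc (z - p) < d ->
      nc (f z - (f p + D * (z - p))) <= e * nc (z - p).
Proof.
move=> /cvg_ex[D /cvgrPdist_le HD]; exists D => e e0.
have := HD e%:C (ltac:(by rewrite ltcR)).
rewrite near_withinE => /near_normcP[d d0 {}HD]; exists d => // z zp.
have [->|zNp] := eqVneq z p.
  by rewrite subrr mulr0 addr0 subrr Normc.normc0 mulr0.
have := HD (z - p); rewrite subr0 subr_eq0 => /(_ zp zNp).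
rewrite /= normrcE lecR /GRing.scale /= mulr1 subrK => {}HD.
rewrite (_ : f z - _ = - (D - (z - p)^-1 * (f z - f p)) * (z - p)); last first.
  by field; rewrite subr_eq0.
by rewrite Normc.normcM normcN ler_wpM2r // normc_ge0.
Qed.

Lemma continuous_Re : continuous Re.
Proof.
move=> z; apply/(@cvgrPdist_lt _ _ _ (nbhs z)) => e e0; apply/near_normcP; exists e => // w.
by apply: le_lt_trans; rewrite distrC -raddfB ler_Re_normc.
Qed.

Lemma continuous_Im : continuous Im.
Proof.
move=> z; apply/(@cvgrPdist_lt _ _ _ (nbhs z)) => e e0; apply/near_normcP; exists e => // w.
by apply: le_lt_trans; rewrite distrC -raddfB ler_Im_normc.
Qed.

Lemma continuous_realC : continuous (fun t : R => t%:C : R[i]).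
Proof.
move=> t; apply/(@cvgrPdist_lt _ _ _ (nbhs t)) => _ /gt0_realC[e e0 ->].
near=> s; rewrite -rmorphB /= normrcE normc_real ltcR.
by near: s; apply/nbhs_normP; exists e.
Unshelve. all: by end_near. Qed.

Lemma continuous_mulC (T : topologicalType) (f g : T -> R[i]) t :
  {for t, continuous f} -> {for t, continuous g} ->
  {for t, continuous (fun x : T => f x * g x)}.
Proof. by move=> cf cg; exact: (cvgM cf cg). Qed.

Lemma continuous_addC (T : topologicalType) (f g : T -> R[i]) t :
  {for t, continuous f} -> {for t, continuous g} ->
  {for t, continuous (fun x : T => f x + g x)}.
Proof. by move=> cf cg; exact: (cvgD cf cg). Qed.

Lemma continuous_cstC (T : topologicalType) (c : R[i]) (t : T) :
  {for t, continuous (fun _ : T => c)}.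
Proof. exact: cvg_cst. Qed.

Lemma derivable_mulC (f g : R[i] -> R[i]) p : derivable f p 1 ->
  derivable g p 1 -> derivable (fun z => f z * g z) p 1.
Proof. by move=> df dg; exact: (derivableM df dg). Qed.

Lemma derivable_addC (f g : R[i] -> R[i]) p : derivable f p 1 ->
  derivable g p 1 -> derivable (fun z => f z + g z) p 1.
Proof. by move=> df dg; exact: (derivableD df dg). Qed.

Lemma derivable_invC (f : R[i] -> R[i]) p : f p != 0 -> derivable f p 1 ->
  derivable (fun z => (f z)^-1) p 1.
Proof. by move=> f0 df; exact: (derivableV f0 df). Qed.

Lemma derivable_cstC (c p : R[i]) : derivable (fun _ : R[i] => c) p 1.
Proof. exact: derivable_cst. Qed.

Lemma derivable_idC (p : R[i]) : derivable (fun z : R[i] => z) p 1.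
Proof. exact: derivable_id. Qed.

Lemma derivable_continuousC (f : R[i] -> R[i]) p : derivable f p 1 ->
  {for p, continuous f}.
Proof.
move=> /derivable_normcP[D /(_ 1 ltr01)[d d0 H]]; apply/continuous_normcP => e e0.
pose B := 2 + nc D; have B0 : 0 < B by rewrite ltr_wpDr ?normc_ge0.
exists (Num.min d (e / B)); first by rewrite lt_min d0 divr_gt0.
move=> z; rewrite lt_min => /andP[/H {}H].
rewrite ltr_pdivlMr // => zB.
have -> : f z - f p = (f z - (f p + D * (z - p))) + D * (z - p) by ring.
apply: le_lt_trans (ler_normcD _ _) _; rewrite Normc.normcM.
apply: le_lt_trans zB; have x0 := normc_ge0 (z - p).
rewrite /B [leRHS]mulrDr [nc D * _]mulrC; move: H x0.
by set u := nc _; set w := _ * nc D; set x := nc _; lra.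
Qed.

End ComplexModulus.

Section SegmentIntegral.
Context {R : realType}.
Notation C := R[i].
Notation nc := (@Normc.normc R).
Notation Re := (@complex.Re R).
Notation Im := (@complex.Im R).
Implicit Types (f g : C -> C) (a b c : C).

Definition segment_path a b (t : R) : C := a + t%:C * (b - a).

Definition segment_integral f a b : C :=
  (b - a) * (integral01 (fun t => Re (f (segment_path a b t)))
             +i* integral01 (fun t => Im (f (segment_path a b t)))).

Definition continuous_segment f a b := forall t : R, 0 <= t <= 1 ->
  {for segment_path a b t, continuous f}.

Lemma segment_path_continuous a b : continuous (segment_path a b).
Proof.
move=> t; apply: (@continuous_addC _ _ (fun=> a) (fun t : R => t%:C * (b - a))).
  exact: continuous_cstC.
apply: (@continuous_mulC _ _ (fun t : R => t%:C) (fun=> b - a)).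
  exact: continuous_realC.
exact: continuous_cstC.
Qed.

Lemma integrable_segment f a b : continuous_segment f a b ->
  integrable01 (fun t => Re (f (segment_path a b t))) /\
  integrable01 (fun t => Im (f (segment_path a b t))).
Proof.
move=> cf; split; apply: continuous_integrable01 => t t01.
  apply: (@continuous_comp _ _ _ (f \o segment_path a b) Re).
    by apply: continuous_comp; [exact: segment_path_continuous|exact: cf].
  exact: continuous_Re.
apply: (@continuous_comp _ _ _ (f \o segment_path a b) Im).
  by apply: continuous_comp; [exact: segment_path_continuous|exact: cf].
exact: continuous_Im.
Qed.

Lemma eq_segment_integral f g a b : continuous_segment f a b ->
  (forall t : R, 0 <= t <= 1 -> f (segment_path a b t) = g (segment_path a b t)) ->
  segment_integral f a b = segment_integral g a b.
Proof.
move=> /integrable_segment[i1 i2] fg; rewrite /segment_integral; congr (_ * (_ +i* _)).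
  by apply: eq_integral01 => // t /fg ->.
by apply: eq_integral01 => // t /fg ->.
Qed.

Lemma segment_integral_lin f g a b c :
  continuous_segment f a b -> continuous_segment g a b ->
  segment_integral (fun z => c * f z + g z) a b =
  c * segment_integral f a b + segment_integral g a b.
Proof.
move=> /integrable_segment[f1 f2] /integrable_segment[g1 g2].
rewrite /segment_integral [c * (_ * _)]mulrCA -mulrDr; congr (_ * _).
case: c => c d.
transitivity
  (integral01 (fun t => c * Re (f (segment_path a b t)) +
     (- d * Im (f (segment_path a b t)) + Re (g (segment_path a b t)))) +i*
   integral01 (fun t => c * Im (f (segment_path a b t)) +
     (d * Re (f (segment_path a b t)) + Im (g (segment_path a b t))))).
  congr (integral01 _ +i* integral01 _); apply/funext => t.
    by case: (f _) => x y; case: (g _) => u v /=; ring.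
  by case: (f _) => x y; case: (g _) => u v /=; ring.
rewrite !integral01_lin //; try exact: integrable01_lin.
by apply/eqP; rewrite eq_complex /=; apply/andP; split; apply/eqP; ring.
Qed.

Lemma segment_integral_rev f a b : continuous_segment f a b ->
  segment_integral f b a = - segment_integral f a b.
Proof.
move=> /integrable_segment[f1 f2]; rewrite /segment_integral.
rewrite -mulNr opprB; congr (_ * _).
have E t : segment_path b a t = segment_path a b (1 - t).
  by rewrite /segment_path rmorphB /=; ring.
by rewrite -(integral01_rev f1) -(integral01_rev f2);
  congr (integral01 _ +i* integral01 _); apply/funext => t; rewrite E.
Qed.

Definition midpoint a b : C := 2^-1 * (a + b).

Lemma segment_path_midl a b (t : R) :
  segment_path a (midpoint a b) t = segment_path a b (2^-1 * t).
Proof. by rewrite /segment_path /midpoint rmorphM fmorphV /= rmorph_nat; field. Qed.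

Lemma segment_path_midr a b (t : R) :
  segment_path (midpoint a b) b t = segment_path a b (2^-1 + 2^-1 * t).
Proof.
by rewrite /segment_path /midpoint rmorphD rmorphM fmorphV /= rmorph_nat; field.
Qed.

Lemma segment_integral_split f a b : continuous_segment f a b ->
  segment_integral f a b =
  segment_integral f a (midpoint a b) + segment_integral f (midpoint a b) b.
Proof.
move=> /integrable_segment[f1 f2]; rewrite /segment_integral.
rewrite (funext (segment_path_midl a b)) (funext (segment_path_midr a b)).
rewrite (integral01_split f1) (integral01_split f2).
have -> : midpoint a b - a = 2^-1 * (b - a) by rewrite /midpoint; field.
have -> : b - midpoint a b = 2^-1 * (b - a) by rewrite /midpoint; field.
set x := integral01 _; set y := integral01 _.
set u := integral01 _; set v := integral01 _.
rewrite ![2^-1 * (b - a)]mulrC -!mulrA -!mulrDr; congr (_ * _).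
have -> : (2^-1 : C) = (2^-1 : R)%:C by rewrite fmorphV /= rmorph_nat.
by apply/eqP; rewrite eq_complex /=; apply/andP; split; apply/eqP; ring.
Qed.

(** The factor 2 arises because the real and imaginary parts are estimated separately, each through
    a mean value of its own. *)
Lemma segment_integral_bound f a b B : continuous_segment f a b ->
  (forall t : R, 0 <= t <= 1 -> nc (f (segment_path a b t)) <= B) ->
  nc (segment_integral f a b) <= 2 * B * nc (b - a).
Proof.
move=> /integrable_segment[f1 f2] fB; rewrite Normc.normcM mulrC ler_wpM2r ?normc_ge0 //.
rewrite (le_trans (ler_normc_ReIm _)) //=.
have [t t01 ->] := integral01_mean f1; have [s s01 ->] := integral01_mean f2.
rewrite mulr_natl mulr2n lerD //.
  exact: le_trans (ler_Re_normc _) (fB _ t01).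
exact: le_trans (ler_Im_normc _) (fB _ s01).
Qed.

Lemma segment_integral_cst c a b : segment_integral (cst c) a b = (b - a) * c.
Proof.
rewrite /segment_integral; congr (_ * _).
have H (x : R) : integral01 (fun=> x) = x.
  rewrite (@integral01E R _ (fun t => 0 + x * t)); first by ring.
  by move=> t _; exact: is_derive_affine.
by rewrite !H; case: c.
Qed.

Lemma segment_integral_id a b :
  segment_integral id a b = 2^-1 * (b ^+ 2 - a ^+ 2).
Proof.
have H (x y : R) : integral01 (fun t => x + t * y) = x + 2^-1 * y.
  have -> : (fun t => x + t * y) = (fun t => y * t + x).
    by apply/funext => t; ring.
  have i1 : integrable01 (@id R).
    by apply: continuous_integrable01 => t _; exact: cvg_id.
  have i2 : integrable01 (fun=> x).
    by apply: continuous_integrable01 => t _; exact: cvg_cst.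
  rewrite integral01_lin //.
  have -> : integral01 (fun=> x) = x.
    rewrite (@integral01E R _ (fun t => 0 + x * t)); first by ring.
    by move=> t _; exact: is_derive_affine.
  (* Halving the interval gives the equation [I = I / 2 + 1 / 4] for this integral [I]. *)
  have : integral01 (@id R) = 2^-1.
    have := integral01_split i1.
    have -> : (fun t => 2^-1 + 2^-1 * t) = (fun t => 2^-1 * t + 2^-1) :> (R -> R).
      by apply/funext => t; ring.
    have -> : (fun t => 2^-1 * t) = (fun t => 2^-1 * t + 0) :> (R -> R).
      by apply/funext => t; ring.
    have i3 (z : R) : integrable01 (fun=> z).
      by apply: continuous_integrable01 => t _; exact: cvg_cst.
    have E (z : R) : integral01 (fun=> z) = z.
      rewrite (@integral01E R _ (fun t => 0 + z * t)); first by ring.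
      by move=> t _; exact: is_derive_affine.
    by rewrite !integral01_lin // !E; lra.
  by move=> ->; ring.
rewrite /segment_integral /segment_path.
have E t : a + t%:C * (b - a) = (Re a + t * Re (b - a)) +i* (Im a + t * Im (b - a)).
  by case: a => ? ?; case: b => ? ?; apply/eqP; rewrite eq_complex /=; apply/andP; split; apply/eqP; ring.
rewrite (_ : (fun t => Re _) = (fun t => Re a + t * Re (b - a))); last first.
  by apply/funext => t; rewrite E.
rewrite (_ : (fun t => Im _) = (fun t => Im a + t * Im (b - a))); last first.
  by apply/funext => t; rewrite E.
rewrite !H.
have -> : (Re a + 2^-1 * Re (b - a)) +i* (Im a + 2^-1 * Im (b - a)) =
   a + (2^-1 : R)%:C * (b - a).
  by rewrite E.
by rewrite fmorphV /= rmorph_nat; field.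
Qed.

End SegmentIntegral.

(** * Goursat's lemma for triangles *)

Section Goursat.
Context {R : realType}.
Notation C := R[i].
Notation nc := (@Normc.normc R).
Implicit Types (f g : C -> C) (a b c : C) (U : set C).

Definition segment_closed U := forall a b (t : R), U a -> U b -> 0 <= t <= 1 ->
  U (segment_path a b t).

Definition triangle_integral f a b c :=
  segment_integral f a b + segment_integral f b c + segment_integral f c a.

Lemma segment_closed_midpoint U a b : segment_closed U -> U a -> U b ->
  U (midpoint a b).
Proof.
move=> Ucvx Ua Ub; have := Ucvx a b 2^-1 Ua Ub; rewrite /segment_path /midpoint.
rewrite fmorphV /= rmorph_nat => /(_ (ltac:(lra))).
by rewrite (_ : a + _ = 2^-1 * (a + b)) //; field.
Qed.

Lemma segment_closed_disc (p : C) (r : R) : segment_closed [set z | nc (z - p) <= r].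
Proof.
move=> a b t /= ap bp /andP[t0 t1].
have -> : segment_path a b t - p = (1 - t)%:C * (a - p) + t%:C * (b - p).
  by rewrite /segment_path rmorphB /=; ring.
rewrite (le_trans (ler_normcD _ _)) // !Normc.normcM !normc_real.
rewrite !ger0_norm ?subr_ge0 //.
have := ler_wpM2l t0 bp; have : (1 - t) * nc (a - p) <= (1 - t) * r.
  by rewrite ler_wpM2l ?subr_ge0.
lra.
Qed.

Section Convex.
Variables (U : set C) (f : C -> C).
Hypotheses (Ucvx : segment_closed U) (cf : forall z, U z -> {for z, continuous f}).

Lemma continuous_segment_convex a b : U a -> U b -> continuous_segment f a b.
Proof. by move=> Ua Ub t t01; apply: cf; exact: Ucvx. Qed.

(** The midpoints cut out four half-size triangles. The last one runs along the three inner segments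
    in the sense opposite to the others, so these segments cancel. *)
Lemma triangle_integral_split a b c : U a -> U b -> U c ->
  triangle_integral f a b c =
    triangle_integral f a (midpoint a b) (midpoint a c) +
    triangle_integral f (midpoint a b) b (midpoint b c) +
    triangle_integral f (midpoint a c) (midpoint b c) c +
    triangle_integral f (midpoint b c) (midpoint a c) (midpoint a b).
Proof.
move=> Ua Ub Uc; have cs := continuous_segment_convex.
have Uab := segment_closed_midpoint Ucvx Ua Ub.
have Ubc := segment_closed_midpoint Ucvx Ub Uc.
have Uac := segment_closed_midpoint Ucvx Ua Uc.
have mC (x y : C) : midpoint x y = midpoint y x by rewrite /midpoint addrC.
rewrite /triangle_integral (segment_integral_split (cs _ _ Ua Ub)).
rewrite (segment_integral_split (cs _ _ Ub Uc)) (segment_integral_split (cs _ _ Uc Ua)).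
rewrite (mC c a) (segment_integral_rev (cs _ _ Uab Uac)).
rewrite (segment_integral_rev (cs _ _ Ubc Uab)).
rewrite (segment_integral_rev (cs _ _ Uac Ubc)).
ring.
Qed.

Lemma triangle_integral_bound B l a b c : U a -> U b -> U c ->
  (forall z, U z -> nc (f z) <= B) ->
  nc (b - a) <= l -> nc (c - b) <= l -> nc (a - c) <= l ->
  nc (triangle_integral f a b c) <= 6 * (B * l).
Proof.
move=> Ua Ub Uc fB ab bc ca.
have B0 : 0 <= B by exact: le_trans (normc_ge0 _) (fB _ Ua).
have H x y : U x -> U y -> nc (y - x) <= l ->
    nc (segment_integral f x y) <= 2 * (B * l).
  move=> Ux Uy xy.
  have := segment_integral_bound (continuous_segment_convex Ux Uy)
    (fun t t01 => fB _ (Ucvx Ux Uy t01)).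
  move=> /le_trans; apply; rewrite -mulrA ler_pM2l //.
  exact: ler_wpM2l.
have h1 := H _ _ Ua Ub ab; have h2 := H _ _ Ub Uc bc; have h3 := H _ _ Uc Ua ca.
rewrite /triangle_integral (le_trans (ler_normcD _ _)) //.
have := ler_normcD (segment_integral f a b) (segment_integral f b c).
lra.
Qed.

End Convex.

Lemma triangle_integral_affine (d e : C) a b c :
  triangle_integral (fun z => d * z + e) a b c = 0.
Proof.
have cE x y : segment_integral (fun z => d * z + e) x y =
    d * (2^-1 * (y ^+ 2 - x ^+ 2)) + (y - x) * e.
  have := @segment_integral_lin R id (cst e) x y d.
  rewrite segment_integral_id segment_integral_cst; apply=> t _.
    exact: cvg_id.
  exact: continuous_cstC.
by rewrite /triangle_integral !cE; ring.
Qed.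

Lemma expr2V_lt (e : R) : 0 < e -> exists n : nat, 2^-1 ^+ n < e.
Proof.
move=> e0; have := @cvg_expr R 2^-1 (ltac:(rewrite ger0_norm; lra)).
move=> /cvgrPdist_lt /(_ e e0) [n _ /(_ n (leqnn n))] /=.
by rewrite sub0r normrN ger0_norm ?exprn_ge0 ?invr_ge0 // => ?; exists n.
Qed.

(** The intervals of radius [2^-1 ^+ n] about [u n] are nested, since the radius shrinks by as much
    as the centre may move; the limit is the supremum of their left ends. The bisection needs the
    explicit rate. *)
Lemma dyadic_limit (u : nat -> R) :
  (forall n, `|u n.+1 - u n| <= 2^-1 * 2^-1 ^+ n) ->
  exists l, forall n, `|l - u n| <= 2^-1 ^+ n.
Proof.
move=> H; pose lo n := u n - 2^-1 ^+ n; pose hi n := u n + 2^-1 ^+ n.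
have step n : lo n <= lo n.+1 /\ hi n.+1 <= hi n.
  by have := H n; rewrite ler_distl /lo /hi exprS; lra.
have pos n : 0 <= (2^-1 : R) ^+ n by rewrite exprn_ge0 // invr_ge0.
have los m n : (m <= n)%N -> lo m <= lo n.
  move=> /subnK <-; elim: (n - m)%N => [|k IH]; rewrite ?add0n // addSn.
  exact: le_trans IH (step _).1.
have his m n : (m <= n)%N -> hi n <= hi m.
  move=> /subnK <-; elim: (n - m)%N => [|k IH]; rewrite ?add0n // addSn.
  exact: le_trans (step _).2 IH.
have lohi m n : lo m <= hi n.
  have [mn|nm] := leqP m n.
    by apply: le_trans (los _ _ mn) _; rewrite /lo /hi; have := pos n; lra.
  by apply: le_trans (his _ _ (ltnW nm)); rewrite /lo /hi; have := pos m; lra.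
have hs : has_sup (range lo).
  by split; [exists (lo 0%N), 0%N|exists (hi 0%N) => _ [m _ <-]].
exists (sup (range lo)) => n.
have h1 : lo n <= sup (range lo) by apply: ub_le_sup; [exact: hs.2|exists n].
have h2 : sup (range lo) <= hi n.
  by apply: ge_sup; [exact: hs.1|move=> _ [m _ <-]].
by rewrite ler_distl; move: h1 h2; rewrite /lo /hi; lra.
Qed.

End Goursat.

Section GoursatTheorem.
Context {R : realType}.
Notation C := R[i].
Notation nc := (@Normc.normc R).
Variables (U : set C) (f : C -> C).
Hypotheses (Ucvx : segment_closed U) (df : forall z, U z -> derivable f z 1).

Let cf z : U z -> {for z, continuous f}.
Proof. by move=> /df; exact: derivable_continuousC. Qed.

Section Triangle.
Variables (a p q : C).
Hypotheses (Ua : U a) (Up : U (a + p)) (Uq : U (a + q)).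

(** Affine coordinates in which every triangle of the bisection is given by a corner [(x, y)] and a
    signed size [s]; the middle quarter is the one of negative relative size. *)
Let pt (x y : R) : C := a + x%:C * p + y%:C * q.
Let K (x y : R) := [&& 0 <= x, 0 <= y & x + y <= 1].

Let ptU x y : K x y -> U (pt x y).
Proof.
move=> /and3P[x0 y0 xy1]; have [xy0|xy0] := eqVneq (x + y) 0.
  have [-> ->] : x = 0 /\ y = 0 by split; lra.
  by rewrite /pt !mul0r !addr0.
have xyp : 0 < x + y by rewrite lt_def xy0 addr_ge0.
pose w := segment_path (a + p) (a + q) (y / (x + y)).
have Uw : U w.
  apply: Ucvx => //; rewrite divr_ge0 ?(ltW xyp) //= ler_pdivrMr //.
  by rewrite mul1r lerDr.
have -> : pt x y = segment_path a w (x + y).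
  rewrite /pt /segment_path /w /segment_path.
  have -> : (y / (x + y))%:C = y%:C / (x%:C + y%:C) by rewrite fmorph_div rmorphD.
  rewrite rmorphD /=.
  have xyc : x%:C + y%:C != 0 :> C by rewrite -rmorphD /= fmorph_eq0.
  by field.
by apply: Ucvx => //; rewrite ltW.
Qed.

Let T (x y s : R) := triangle_integral f (pt x y) (pt (x + s) y) (pt x (y + s)).
Let ok (x y s : R) := [/\ K x y, K (x + s) y & K x (y + s)].

Let T_split x y h : ok x y (2 * h) ->
  T x y (2 * h) =
  T x y h + T (x + h) y h + T x (y + h) h + T (x + h) (y + h) (- h).
Proof.
move=> [k1 k2 k3].
have m1 u u' v v' : midpoint (pt u v) (pt u' v') =
    pt (2^-1 * (u + u')) (2^-1 * (v + v')).
  by rewrite /midpoint /pt !rmorphM !rmorphD fmorphV /= rmorph_nat; field.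
rewrite /T (triangle_integral_split Ucvx cf (ptU k1) (ptU k2) (ptU k3)) !m1.
rewrite (_ : 2^-1 * (x + (x + 2 * h)) = x + h); last lra.
rewrite (_ : 2^-1 * (y + (y + 2 * h)) = y + h); last lra.
rewrite (_ : 2^-1 * (y + y) = y); last lra.
rewrite (_ : 2^-1 * (x + x) = x); last lra.
rewrite (_ : 2^-1 * (x + 2 * h + x) = x + h); last lra.
by rewrite -!addrA !subrr !addr0 -!mulr2n !mulr_natl.
Qed.

Let ok_split x y h : ok x y (2 * h) ->
  [/\ ok x y h, ok (x + h) y h, ok x (y + h) h & ok (x + h) (y + h) (- h)].
Proof.
rewrite /ok /K => -[/and3P[a1 a2 a3] /and3P[b1 b2 b3] /and3P[c1 c2 c3]].
by split; split; apply/and3P; split; lra.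
Qed.

(** At least a quarter of the modulus survives in one of the four pieces. Admissibility of [w] is a
    premise inside the existential, so that [choice] provides a total function to iterate. *)
Let T_step (w : R * R * R) : exists w' : R * R * R,
  ok w.1.1 w.1.2 w.2 ->
  [/\ ok w'.1.1 w'.1.2 w'.2, nc (T w.1.1 w.1.2 w.2) <= 4 * nc (T w'.1.1 w'.1.2 w'.2),
      `|w'.2| = 2^-1 * `|w.2|,
      `|w'.1.1 - w.1.1| <= 2^-1 * `|w.2| & `|w'.1.2 - w.1.2| <= 2^-1 * `|w.2|].
Proof.
case: w => -[x y] s /=; have [okw|] := pselect (ok x y s); last by exists (x, y, s).
pose h := 2^-1 * s; have sE : s = 2 * h by rewrite /h; lra.
have T4 : nc (T x y s) <= nc (T x y h) + nc (T (x + h) y h) + nc (T x (y + h) h) +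
    nc (T (x + h) (y + h) (- h)).
  rewrite {1}sE T_split -?sE //.
  by do 3 (apply: le_trans (ler_normcD _ _) _; rewrite lerD2r).
have hE : `|h| = 2^-1 * `|s| by rewrite normrM ger0_norm.
have h0 : 0 <= 2^-1 * `|s| by rewrite -hE.
have uh (u : R) : u + h - u = h by ring.
have [ok1 ok2 ok3 ok4] : [/\ ok x y h, ok (x + h) y h, ok x (y + h) h & ok (x + h) (y + h) (- h)].
  by apply: ok_split; rewrite -sE.
have [H1|H1] := lerP (nc (T x y s)) (4 * nc (T x y h)).
  exists (x, y, h) => _; rewrite /= hE !subrr normr0; split => //.
have [H2|H2] := lerP (nc (T x y s)) (4 * nc (T (x + h) y h)).
  exists (x + h, y, h) => _; rewrite /= uh subrr normr0 hE; split => //.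
have [H3|H3] := lerP (nc (T x y s)) (4 * nc (T x (y + h) h)).
  exists (x, y + h, h) => _; rewrite /= uh subrr normr0 hE; split => //.
have [H4|H4] := lerP (nc (T x y s)) (4 * nc (T (x + h) (y + h) (- h))).
  exists (x + h, y + h, - h) => _.
  rewrite /= normrN !uh hE; split => //.
exfalso; move: T4 H1 H2 H3 H4.
move: (nc (T x y s)) (nc (T x y h)) (nc (T (x + h) y h)) (nc (T x (y + h) h)).
by move: (nc (T (x + h) (y + h) (- h))) => *; lra.
Qed.

Lemma goursat_vertices : triangle_integral f a (a + p) (a + q) = 0.
Proof.
have [F HF] := choice T_step.
pose w n := iter n F (0, 0, 1).
have okw n : ok (w n).1.1 (w n).1.2 (w n).2.
  elim: n => [|n IH]; last by have [] := HF _ IH.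
  by split; apply/and3P; split; rewrite /= ?addr0; lra.
have sw n : `|(w n).2| = 2^-1 ^+ n.
  elim: n => [|n IH]; first by rewrite /= normr1.
  by have [_ _ + _ _] := HF _ (okw n); rewrite exprS -IH.
have Tw n : nc (T 0 0 1) <= 4 ^+ n * nc (T (w n).1.1 (w n).1.2 (w n).2).
  elim: n => [|n IH]; first by rewrite expr0 mul1r.
  apply: le_trans IH _; rewrite exprSr -mulrA ler_pM2l ?exprn_gt0 //.
  by have [] := HF _ (okw n).
have [x Hx] := @dyadic_limit R (fun n => (w n).1.1) (ltac:(by move=> n;
  rewrite -sw; have [] := HF _ (okw n))).
have [y Hy] := @dyadic_limit R (fun n => (w n).1.2) (ltac:(by move=> n;
  rewrite -sw; have [] := HF _ (okw n))).
have Kxy : K x y.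
  have lim (u v : R) : (forall n, u <= v + 2 * 2^-1 ^+ n) -> u <= v.
    move=> H; rewrite leNgt; apply/negP => vu.
    have [n] := @expr2V_lt R (2^-1 * (u - v)) (ltac:(by rewrite mulr_gt0 ?subr_gt0)).
    by have := H n; lra.
  have H n : [&& 0 <= (w n).1.1, 0 <= (w n).1.2 & (w n).1.1 + (w n).1.2 <= 1].
    by have [] := okw n.
  apply/and3P; split; apply: lim => n; have /and3P[] := H n;
    have := Hx n; have := Hy n; rewrite !ler_distl; lra.
have [D HD] := derivable_normcP (df (ptU Kxy)).
pose L := nc p + nc q; have L0 : 0 <= L by rewrite addr_ge0 ?normc_ge0.
have near n u v : `|u - x| <= 2 * 2^-1 ^+ n -> `|v - y| <= 2 * 2^-1 ^+ n ->
    nc (pt u v - pt x y) <= 2 * 2^-1 ^+ n * L.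
  move=> ux vy; rewrite (_ : pt u v - pt x y = (u - x)%:C * p + (v - y)%:C * q); last first.
    by rewrite /pt !rmorphB /=; ring.
  rewrite (le_trans (ler_normcD _ _)) // !Normc.normcM !normc_real /L mulrDr.
  by rewrite lerD // ler_wpM2r ?normc_ge0.
have main (e : R) : 0 < e -> nc (T 0 0 1) <= e * (48 * L ^+ 2).
  move=> e0; have [d d0 {}HD] := HD e e0.
  have [n Hn] := @expr2V_lt R (d / (2 * (L + 1))) (ltac:(by rewrite divr_gt0 // mulr_gt0 // ltr_wpDl)).
  have s0 : 0 < (2^-1 : R) ^+ n by rewrite exprn_gt0 // invr_gt0.
  have Ld : 2 * 2^-1 ^+ n * L < d.
    move: Hn; rewrite ltr_pdivlMr ?mulr_gt0 ?ltr_wpDl //.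
    by apply: le_lt_trans; nra.
  have [k1 k2 k3] := okw n; have swn := sw n; have := Hx n; have := Hy n.
  have := Tw n; move: k1 k2 k3 swn.
  move: (w n) => -[[u v] s] /= k1 k2 k3 swn Tn yv xu.
  pose V := U `&` [set z | nc (z - pt x y) <= 2 * 2^-1 ^+ n * L].
  have Vcvx : segment_closed V.
    move=> z1 z2 t [? ?] [? ?] t01; split; first exact: Ucvx.
    exact: segment_closed_disc.
  have sn : `|s| <= 2^-1 ^+ n by rewrite swn.
  have [V1 V2 V3] : [/\ V (pt u v), V (pt (u + s) v) & V (pt u (v + s))].
    move: sn xu yv; rewrite ler_norml !ler_distl => sn xu yv.
    by split; (split; first exact: ptU); apply: near; rewrite ler_distl; lra.
  (* Removing the affine part of [f] at the limit point changes no triangle integral and leaves a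
     function bounded by [e] times the distance to that point. *)
  pose g z := f z - (f (pt x y) + D * (z - pt x y)).
  have cg z : V z -> {for z, continuous g}.
    move=> [Uz _]; apply: derivable_continuousC; apply: derivable_addC.
      exact: df.
    rewrite (_ : (fun z => - _) = (fun z => (- D) * z + (D * pt x y - f (pt x y)))); last first.
      by apply/funext => t; ring.
    apply: derivable_addC; last exact: derivable_cstC.
    by apply: derivable_mulC; [exact: derivable_cstC|exact: derivable_idC].
  have gB z : V z -> nc (g z) <= e * (2 * 2^-1 ^+ n * L).
    move=> [Uz Bz]; apply: le_trans (HD _ _) _; first exact: le_lt_trans Bz Ld.
    by rewrite ler_pM2l.
  have Tg : T u v s = triangle_integral g (pt u v) (pt (u + s) v) (pt u (v + s)).
    have cV := continuous_segment_convex Vcvx cg.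
    have := triangle_integral_affine D (f (pt x y) - D * pt x y) (pt u v) (pt (u + s) v) (pt u (v + s)).
    rewrite /T /triangle_integral => A0.
    have E z1 z2 : V z1 -> V z2 -> segment_integral f z1 z2 =
        segment_integral (fun z => D * z + (f (pt x y) - D * pt x y)) z1 z2 +
        segment_integral g z1 z2.
      move=> Vz1 Vz2; have fE : f = (fun z => 1 * (D * z + (f (pt x y) - D * pt x y)) + g z).
        by apply/funext => z; rewrite /g; ring.
      rewrite [in LHS]fE segment_integral_lin ?mul1r //; last exact: cV.
      move=> t _; apply: derivable_continuousC.
      apply: derivable_addC; last exact: derivable_cstC.
      by apply: derivable_mulC; [exact: derivable_cstC|exact: derivable_idC].
    by rewrite !E //; apply/eqP; rewrite -subr_eq0; apply/eqP; rewrite -[RHS]A0; ring.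
  have dV z1 z2 : V z1 -> V z2 -> nc (z1 - z2) <= 4 * 2^-1 ^+ n * L.
    move=> [_ /= h1] [_ /= h2].
    rewrite (_ : z1 - z2 = (z1 - pt x y) + - (z2 - pt x y)); last by ring.
    by rewrite (le_trans (ler_normcD _ _)) // normcN; lra.
  have := triangle_integral_bound Vcvx cg V1 V2 V3 gB (dV _ _ V2 V1)
    (dV _ _ V3 V2) (dV _ _ V1 V3); rewrite -Tg => TB.
  apply: le_trans Tn _.
  have p4 : 4 ^+ n * (2^-1 ^+ n * 2^-1 ^+ n) = 1 :> R.
    by rewrite -!exprMn (_ : 4 * _ = 1) ?expr1n //; lra.
  have -> : e * (48 * L ^+ 2) = 4 ^+ n * (6 * (e * (2 * 2^-1 ^+ n * L) * (4 * 2^-1 ^+ n * L))).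
    by rewrite -[LHS]mul1r -[X in X * _ = _]p4; ring.
  by rewrite ler_pM2l // exprn_gt0.
have T0 : nc (T 0 0 1) <= 0.
  rewrite leNgt; apply/negP => T0.
  have B0 : 0 < 1 + 48 * L ^+ 2 by rewrite ltr_wpDr // mulr_ge0 // exprn_ge0.
  have := main _ (divr_gt0 T0 B0); rewrite -mulrA ler_pMr // ler_pdivlMl //.
  by lra.
have /eqP : T 0 0 1 = 0.
  by apply: Normc.eq0_normc; apply/eqP; rewrite eq_le T0 normc_ge0.
by rewrite /T /pt !add0r !mul0r !mul1r !addr0 => /eqP.
Qed.

End Triangle.
Lemma goursat_triangle a b c : U a -> U b -> U c -> triangle_integral f a b c = 0.
Proof.
have subKC (x y : C) : x + (y - x) = y by ring.
move=> Ua Ub Uc; have := @goursat_vertices a (b - a) (c - a).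
by rewrite !subKC; apply.
Qed.

End GoursatTheorem.

Section ExceptionalVertex.
Context {R : realType}.
Notation C := R[i].
Notation nc := (@Normc.normc R).
Notation Re := (@complex.Re R).
Variables (U : set C) (g : C -> C) (z w : C).
Hypotheses (Ucvx : segment_closed U) (Uz : U z).
Hypothesis cg : forall x, U x -> {for x, continuous g}.
Hypothesis dg : forall x, U x -> x != z -> derivable g x 1.

(** The part of [U] in an open half-plane whose boundary passes through [z]. It omits [z], so
    Goursat's lemma holds on it. *)
Let H := U `&` [set x | 0 < Re ((x - z) * w)].

Let Hcvx : segment_closed H.
Proof.
move=> a b t [Ua /= ha] [Ub /= hb] t01; split; first exact: Ucvx.
rewrite /= (_ : (segment_path a b t - z) * w =
  (1 - t)%:C * ((a - z) * w) + t%:C * ((b - z) * w)); last first.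
  by rewrite /segment_path rmorphB /=; ring.
move: ha hb; move: ((a - z) * w) ((b - z) * w) => [x ?] [y ?] /= ha hb.
rewrite !mul0r !subr0; have /andP[t0 t1] := t01.
have [->|tN0] := eqVneq t 0; first by rewrite mul0r addr0 subr0 mul1r.
have tp : 0 < t by rewrite lt_def tN0.
by rewrite ltr_wpDl ?mulr_gt0 // mulr_ge0 ?subr_ge0 // ltW.
Qed.

Let dgH x : H x -> derivable g x 1.
Proof.
move=> [Ux /= hx]; apply: dg => //; apply: contraTneq hx => ->.
by rewrite subrr mul0r /= ltxx.
Qed.

(** Of the four quarters of the triangle only one touches [z]; the other three lie in [H] and
    contribute 0. *)
Let step b c : H b -> H c -> [/\ H (midpoint z b), H (midpoint z c) &
  triangle_integral g z b c = triangle_integral g z (midpoint z b) (midpoint z c)].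
Proof.
move=> Hb Hc.
have Hm x : H x -> H (midpoint z x).
  move=> [Ux /= hx]; split; first exact: segment_closed_midpoint.
  rewrite /= (_ : midpoint z x - z = (2^-1 : R)%:C * (x - z)); last first.
    by rewrite /midpoint fmorphV /= rmorph_nat; field.
  move: hx; rewrite -mulrA; case: (_ * w) => x1 x2 /= x10.
  by rewrite mul0r subr0 mulr_gt0 // invr_gt0.
have Hbc := segment_closed_midpoint Hcvx Hb Hc.
split; try exact: Hm.
rewrite (triangle_integral_split Ucvx cg Uz Hb.1 Hc.1).
have h1 := Hm _ Hb; have h2 := Hm _ Hc.
have G := goursat_triangle Hcvx dgH.
by rewrite (G _ _ _ h1 Hb Hbc) (G _ _ _ h2 Hbc Hc) (G _ _ _ Hbc h2 h1) !addr0.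
Qed.

(* Bisecting towards the vertex [z] does not change the integral; [g] is bounded there. *)
Lemma goursat_exceptional_vertex b c : U b -> U c ->
  0 < Re ((b - z) * w) -> 0 < Re ((c - z) * w) -> triangle_integral g z b c = 0.
Proof.
move=> Ub Uc hb hc; have Hb : H b by []. have Hc : H c by [].
pose F n x := iter n (midpoint z) x.
have HF n : [/\ H (F n b), H (F n c) &
    triangle_integral g z b c = triangle_integral g z (F n b) (F n c)].
  elim: n => [|n [h1 h2 h3]]; first by split.
  by have [? ? E] := step h1 h2; split => //; rewrite h3 E.
have FE n x : F n x - z = (2^-1 ^+ n)%:C * (x - z).
  elim: n => [|n IH]; first by rewrite expr0 mul1r.
  rewrite -[F n.+1 x]/(midpoint z (F n x)) exprS rmorphM /= -mulrA -IH.
  by rewrite /midpoint fmorphV /= rmorph_nat; field.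
have [d d0 Hd] := (continuous_normcP g z).1 (cg Uz) 1 ltr01.
pose B := nc (g z) + 1; pose L := nc (b - z) + nc (c - z) + 1.
have L0 : 0 < L by rewrite ltr_wpDl // addr_ge0 ?normc_ge0.
have B0 : 0 < B by rewrite ltr_wpDl ?normc_ge0.
have main n : 2^-1 ^+ n * L < d -> nc (triangle_integral g z b c) <= 2^-1 ^+ n * (6 * (B * (2 * L))).
  move=> nd; have [h1 h2 ->] := HF n.
  pose V := U `&` [set x | nc (x - z) <= 2^-1 ^+ n * L].
  have Vcvx : segment_closed V.
    move=> x y t [? ?] [? ?] t01; split; first exact: Ucvx.
    exact: segment_closed_disc.
  have p0 : 0 < (2^-1 : R) ^+ n by rewrite exprn_gt0 // invr_gt0.
  have nF x : nc (x - z) <= L -> nc (F n x - z) <= 2^-1 ^+ n * L.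
    by move=> xL; rewrite FE Normc.normcM normc_real gtr0_norm // ler_pM2l.
  have bL : nc (b - z) <= L by rewrite /L -addrA lerDl addr_ge0 ?normc_ge0.
  have cL : nc (c - z) <= L by rewrite /L addrAC lerDr addr_ge0 ?normc_ge0.
  have Vz : V z by split => //=; rewrite subrr Normc.normc0 mulr_ge0 ?ltW.
  have Vb : V (F n b) by split; [exact: h1.1|exact: nF].
  have Vc : V (F n c) by split; [exact: h2.1|exact: nF].
  have gB x : V x -> nc (g x) <= B.
    move=> [Ux /= xz]; have := Hd x (le_lt_trans xz nd) => gx.
    rewrite -(subrK (g z) (g x)) (le_trans (ler_normcD _ _)) // addrC lerD2l.
    exact: ltW.
  have dV x y : V x -> V y -> nc (x - y) <= 2 * (2^-1 ^+ n * L).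
    move=> [_ /= k1] [_ /= k2]; rewrite (_ : x - y = (x - z) + - (y - z)); last by ring.
    by rewrite (le_trans (ler_normcD _ _)) // normcN; lra.
  have := triangle_integral_bound Vcvx (fun x Vx => cg Vx.1) Vz Vb Vc gB
    (dV _ _ Vb Vz) (dV _ _ Vc Vb) (dV _ _ Vz Vc).
  by move=> /le_trans; apply; lra.
apply: Normc.eq0_normc; apply/eqP; rewrite eq_le normc_ge0 andbT leNgt.
apply/negP; set T := nc _ => T0.
pose M := 6 * (B * (2 * L)); have M0 : 0 < M by rewrite !mulr_gt0.
have [n] := @expr2V_lt R (Num.min (d / L) (T / (2 * M)))
  (ltac:(by rewrite lt_min !divr_gt0 // mulr_gt0)).
rewrite lt_min !ltr_pdivlMr ?mulr_gt0 // => /andP[/main + h]; rewrite -/T -/M.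
lra.
Qed.

End ExceptionalVertex.

(** * Cauchy's formula on the boundary of a square *)

Section CauchySquare.
Context {R : realType}.
Notation C := R[i].
Notation nc := (@Normc.normc R).
Notation Re := (@complex.Re R).
Notation Im := (@complex.Im R).
Variable (r : R).
Hypothesis r0 : 0 < r.

(** Corners of the square with centre 0 and half-side [r], in positive order from [r - i r].
    Multiplication by [i] carries each side to the next one, and the fourth corner is the initial
    one again. *)
Let v k : C := 'i%C ^+ k * (r -i* r).
Definition square_integral (F : C -> C) :=
  \sum_(k < 4) segment_integral F (v k) (v k.+1).

(** An annulus that contains the contour and on which the kernels [x^-1] and [(x - z)^-1], for
    [nc z < r], have no pole. *)
Let ann (x : C) := r <= nc x <= 2 * r.

Let nci k : nc ('i%C ^+ k) = 1.
Proof. by rewrite normcX /= expr0n expr1n add0r sqrtr1 expr1n. Qed.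

Let side_path k t : segment_path (v k) (v k.+1) t = 'i%C ^+ k * (r +i* (r * (2 * t - 1))).
Proof.
rewrite /segment_path /v exprSr -!mulrA -mulrBr mulrCA -mulrDr; congr (_ * _).
by apply/eqP; rewrite eq_complex /=; apply/andP; split; apply/eqP; ring.
Qed.

Let side_ann k (t : R) : 0 <= t <= 1 -> ann (segment_path (v k) (v k.+1) t).
Proof.
move=> /andP[t0 t1]; rewrite /ann side_path Normc.normcM nci mul1r.
apply/andP; split.
  by apply: le_trans (ler_Re_normc _); rewrite /= ger0_norm // ltW.
apply: le_trans (ler_normc_ReIm _) _ => /=.
have : `|r * (2 * t - 1)| <= r by rewrite normrM gtr0_norm // ler_piMr ?(ltW r0) // ler_norml; lra.
by rewrite (ger0_norm (ltW r0)); lra.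
Qed.

Let side_length k : nc (v k.+1 - v k) = 2 * r.
Proof.
rewrite (_ : _ - _ = 'i%C ^+ k * ((2 * r)%:C * 'i%C)).
  have i1 := nci 1; rewrite expr1 in i1.
  by rewrite !Normc.normcM nci i1 normc_real mul1r mulr1 gtr0_norm ?mulr_gt0.
rewrite /v exprSr -!mulrA -mulrBr; congr (_ * _).
by apply/eqP; rewrite eq_complex /=; apply/andP; split; apply/eqP; ring.
Qed.

Let side_continuous (F : C -> C) : (forall x, ann x -> {for x, continuous F}) ->
  forall k, continuous_segment F (v k) (v k.+1).
Proof. by move=> cF k t t01; apply: cF; exact: side_ann. Qed.

Lemma square_integral_lin (c : C) (F G : C -> C) :
  (forall x, ann x -> {for x, continuous F}) ->
  (forall x, ann x -> {for x, continuous G}) ->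
  square_integral (fun x => c * F x + G x) = c * square_integral F + square_integral G.
Proof.
move=> cF cG; rewrite /square_integral mulr_sumr -big_split.
by apply: eq_bigr => k _; rewrite segment_integral_lin //; exact: side_continuous.
Qed.

Lemma eq_square_integral (F G : C -> C) : (forall x, ann x -> {for x, continuous F}) ->
  (forall x, ann x -> F x = G x) -> square_integral F = square_integral G.
Proof.
move=> cF FG; apply: eq_bigr => k _; apply: eq_segment_integral.
  exact: side_continuous.
by move=> t t01; apply: FG; exact: side_ann.
Qed.

(** 16 is the product of 4 sides, the length [2 * r] of a side, and the factor 2 of
    [segment_integral_bound]. *)
Lemma square_integral_bound B (F : C -> C) : (forall x, ann x -> {for x, continuous F}) ->
  (forall x, ann x -> nc (F x) <= B) -> nc (square_integral F) <= 16 * (B * r).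
Proof.
move=> cF FB; have H k : nc (segment_integral F (v k) (v k.+1)) <= 4 * (B * r).
  have := segment_integral_bound (@side_continuous _ cF k)
    (fun t t01 => FB _ (@side_ann k t t01)).
  by rewrite side_length; lra.
rewrite /square_integral !big_ord_recr /= big_ord0 add0r.
move: (H 0%N) (H 1%N) (H 2%N) (H 3%N).
move: (segment_integral F (v 0) (v 1)) (segment_integral F (v 1) (v 2)).
move: (segment_integral F (v 2) (v 3)) (segment_integral F (v 3) (v 4)).
move=> c d a b; have := ler_normcD (a + b + c) d; have := ler_normcD (a + b) c.
by have := ler_normcD a b; lra.
Qed.

(** The value [2 pi i] is not computed. By rotation the four sides contribute equally, and on the
    side [Re x = r] the imaginary part of the integral is [2 r] times a value of [Re (1 / x)], which
    is positive there. *)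
Lemma square_integral_inv : square_integral (fun x => x^-1) != 0.
Proof.
have x0 x : ann x -> x != 0.
  by move=> /andP[rx _]; rewrite -normc_gt0; exact: lt_le_trans rx.
have cV x : ann x -> {for x, continuous (fun x : C => x^-1)}.
  by move=> /x0 ?; apply: derivable_continuousC; apply: derivable_invC => //; exact: derivable_idC.
have rot k : segment_integral (fun x => x^-1) (v k) (v k.+1) = segment_integral (fun x => x^-1) (v 0) (v 1).
  elim: k => [//|k <-].
  transitivity ('i%C * segment_integral (fun x => - 'i%C * x^-1 + (fun=> 0) x) (v k) (v k.+1)).
    rewrite /segment_integral mulrA; congr (_ * (integral01 _ +i* integral01 _)).
    - by rewrite /v !exprS; ring.
    - apply/funext => t; congr Re; rewrite !side_path exprS -mulrA invfM addr0.
      by congr (_ * _); apply: (@mulfI _ 'i%C); rewrite ?mulrN ?mulfV ?neq0Ci //; rewrite -expr2 sqr_i opprK.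
    - apply/funext => t; congr Im; rewrite !side_path exprS -mulrA invfM addr0.
      by congr (_ * _); apply: (@mulfI _ 'i%C); rewrite ?mulrN ?mulfV ?neq0Ci //; rewrite -expr2 sqr_i opprK.
  rewrite segment_integral_lin; [|exact: side_continuous|by move=> t _; exact: continuous_cstC].
  rewrite (segment_integral_cst 0) mulr0 addr0 mulrA mulrN -expr2 sqr_i opprK mul1r.
  by [].
have -> : square_integral (fun x => x^-1) = 4%:R * segment_integral (fun x => x^-1) (v 0) (v 1).
  rewrite /square_integral (eq_bigr (fun=> segment_integral (fun x => x^-1) (v 0) (v 1))).
    by rewrite sumr_const card_ord mulr_natl.
  by move=> k _; exact: rot.
rewrite mulf_neq0 ?pnatr_eq0 //; apply/eqP => I0.
have : Im (segment_integral (fun x => x^-1) (v 0) (v 1)) = 0 by rewrite I0.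
rewrite /segment_integral.
have -> : v 1 - v 0 = 0 +i* (2 * r).
  by rewrite /v; apply/eqP; rewrite eq_complex /=; apply/andP; split; apply/eqP; ring.
have [i1 _] := integrable_segment (@side_continuous _ cV 0).
have [t t01 ->] := integral01_mean i1.
rewrite side_path expr0 mul1r /= mul0r add0r => /eqP; apply/negP.
rewrite mulf_neq0 //; first by rewrite mulf_neq0 // gt_eqF.
by rewrite mulf_neq0 ?gt_eqF // invr_gt0 ltr_pwDl ?exprn_gt0 // sqr_ge0.
Qed.

End CauchySquare.

Section CauchyFormula.
Context {R : realType}.
Notation C := R[i].
Notation nc := (@Normc.normc R).
Notation Re := (@complex.Re R).
Variables (r : R) (f : C -> C).
Hypotheses (r0 : 0 < r).
Hypothesis df : forall x, nc x <= 2 * r -> derivable f x 1.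

Let ann (x : C) := r <= nc x <= 2 * r.

(** The square is cut into four triangles with common vertex [z], at which the difference quotient
    [g] is continuous, with value [D]. The winding integral stays unevaluated on the right-hand
    side. *)
Lemma cauchy_square z : nc z < r ->
  square_integral r (fun x => f x * (x - z)^-1) =
  f z * square_integral r (fun x => (x - z)^-1).
Proof.
move=> zr; pose U := [set x : C | nc (x - 0) <= 2 * r].
have Ucvx : segment_closed U by exact: segment_closed_disc.
have UE x : U x = (nc x <= 2 * r) by rewrite -[in RHS](subr0 x).
have z2r : nc z <= 2 * r by move: zr r0 => ? ?; lra.
have Uz : U z by rewrite UE.
have [D HD] := derivable_normcP (df z2r).
pose g x := if x == z then D else (f x - f z) * (x - z)^-1.
have dg x : U x -> x != z -> derivable g x 1.
  rewrite UE => Ux xz.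
  have : derivable (fun x => (f x - f z) * (x - z)^-1) x 1.
    apply: derivable_mulC.
      by apply: derivable_addC; [exact: df|exact: derivable_cstC].
    apply: derivable_invC; first by rewrite subr_eq0.
    by apply: derivable_addC; [exact: derivable_idC|exact: derivable_cstC].
  apply: near_eq_derivable.
  apply/near_normcP; exists (nc (x - z)); first by rewrite normc_gt0 subr_eq0.
  move=> y yx; rewrite /g; case: eqP yx => // ->.
  by rewrite normcB ltxx.
have cg x : U x -> {for x, continuous g}.
  move=> Ux; have [->|xz] := eqVneq x z; last by apply: derivable_continuousC; exact: dg.
  apply/continuous_normcP => e e0; have [d d0 {}HD] := HD (e / 2) (ltac:(by rewrite divr_gt0)).
  exists d => // y yz; rewrite /g eqxx; case: eqP => [_|/eqP yNz].
    by rewrite subrr Normc.normc0.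
  have yz0 : y - z != 0 by rewrite subr_eq0.
  have -> : (f y - f z) * (y - z)^-1 - D = (f y - (f z + D * (y - z))) * (y - z)^-1.
    by field.
  rewrite Normc.normcM Normc.normcV ltr_pdivrMr ?normc_gt0 //.
  apply: le_lt_trans (HD _ yz) _.
  by rewrite ltr_pM2r ?normc_gt0 // ltr_pdivrMr // ltr_pMr // ltr1n.
pose v k : C := 'i%C ^+ k * (r -i* r).
have i1 : nc 'i%C = 1 by rewrite /= expr0n expr1n add0r sqrtr1.
have vU k : U (v k).
  rewrite UE Normc.normcM normcX i1 expr1n mul1r.
  rewrite (le_trans (ler_normc_ReIm _)) //= normrN gtr0_norm //; lra.
have iN0 : 'i%C != 0 :> C by rewrite -normc_gt0 i1.
have tri0 k : triangle_integral g z (v k) (v k.+1) = 0.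
  (* The direction [i^-k] rotates side [k] onto the line [Re x = r]; the half-plane condition
     becomes [Re (z i^-k) < r], which follows from [nc z < r]. *)
  apply: (@goursat_exceptional_vertex _ U g z ('i%C ^- k)) => //.
    rewrite (_ : _ * _ = (r -i* r) - z * 'i%C ^- k); last first.
      by rewrite /v mulrBl mulrAC mulfV ?expf_neq0 // mul1r.
    rewrite raddfB /= subr_gt0; apply: le_lt_trans (ler_norm _) _.
    apply: le_lt_trans (ler_Re_normc _) _.
    by rewrite Normc.normcM Normc.normcV normcX i1 expr1n invr1 mulr1.
  rewrite (_ : _ * _ = (r +i* r) - z * 'i%C ^- k); last first.
    rewrite /v mulrBl exprSr -!mulrA mulrC mulrA -(mulrA ('i%C * _)) mulVf ?expf_neq0 //.
    by rewrite mulr1; congr (_ - _); apply/eqP; rewrite eq_complex /=; apply/andP; split; apply/eqP; ring.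
  rewrite raddfB /= subr_gt0; apply: le_lt_trans (ler_norm _) _.
  apply: le_lt_trans (ler_Re_normc _) _.
  by rewrite Normc.normcM Normc.normcV normcX i1 expr1n invr1 mulr1.
have cs k : continuous_segment g z (v k).
  exact: (continuous_segment_convex Ucvx cg).
have g0 : square_integral r g = 0.
  (* Each side is a difference of two spokes from [z], so the sum over the four sides telescopes. *)
  have E k : segment_integral g (v k) (v k.+1) =
      segment_integral g z (v k.+1) - segment_integral g z (v k).
    have := tri0 k; rewrite /triangle_integral (segment_integral_rev (cs k.+1)) => T0.
    by apply/eqP; rewrite -subr_eq0; apply/eqP; rewrite -T0; ring.
  rewrite /square_integral (eq_bigr (fun k : 'I_4 => segment_integral g z (v k.+1) - segment_integral g z (v k))); last first.
    by move=> k _; exact: E.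
  rewrite -(big_mkord xpredT (fun k => segment_integral g z (v k.+1) - segment_integral g z (v k))).
  rewrite telescope_sumr // /v (_ : 'i%C ^+ 4 = 1); last first.
    by rewrite (exprM _ 2 2) sqr_i sqrrN expr1n.
  by rewrite expr0 subrr.
have xz0 x : ann x -> x - z != 0.
  move=> /andP[rx _]; rewrite subr_eq0; apply: contraTneq rx => ->.
  by rewrite -ltNge.
have dk x : ann x -> derivable (fun x : C => (x - z)^-1) x 1.
  move=> ax; apply: derivable_invC; first exact: xz0.
  by apply: derivable_addC; [exact: derivable_idC|exact: derivable_cstC].
have dfk x : ann x -> derivable (fun x : C => f x * (x - z)^-1) x 1.
  move=> ax; apply: derivable_mulC; last exact: dk.
  by apply: df; have /andP[] := ax.
have E : square_integral r (fun x => - f z * (x - z)^-1 + f x * (x - z)^-1) = 0.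
  rewrite -[RHS]g0; apply/esym; apply: (eq_square_integral r0) => x ax.
    by apply: cg; rewrite UE; have /andP[] := ax.
  by rewrite /g -subr_eq0 (negPf (xz0 _ ax)); ring.
move: E; rewrite (square_integral_lin r0 (- f z)); last first.
- by move=> x /dfk /derivable_continuousC.
- by move=> x /dk /derivable_continuousC.
by move=> E; apply/eqP; rewrite -subr_eq0 -mulNr addrC E.
Qed.

(** Finite geometric expansion of [(x - z)^-1], with remainder [z ^+ n] times the integral of
    [f x * x^-1 ^+ n * (x - z)^-1]. The constant 32 is the 16 of [square_integral_bound] doubled,
    because [nc (x - z)] is at least [r / 2] on the contour. *)
Lemma cauchy_expansion B z n : (forall x, nc x <= 2 * r -> nc (f x) <= B) ->
  nc z <= r / 2 ->
  nc (square_integral r (fun x => f x * (x - z)^-1) -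
      \sum_(j < n) square_integral r (fun x => f x * x^-1 ^+ j.+1) * z ^+ j)
  <= 32 * B * (nc z / r) ^+ n.
Proof.
move=> fB zr.
have zr' : nc z < r by have := r0; lra.
have x0 x : ann x -> x != 0.
  by move=> /andP[rx _]; rewrite -normc_gt0; exact: lt_le_trans rx.
have xz0 x : ann x -> x - z != 0.
  move=> /andP[rx _]; rewrite subr_eq0; apply: contraTneq rx => ->.
  by rewrite -ltNge.
have dk x : ann x -> derivable (fun x : C => (x - z)^-1) x 1.
  move=> ax; apply: derivable_invC; first exact: xz0.
  by apply: derivable_addC; [exact: derivable_idC|exact: derivable_cstC].
have dV k x : ann x -> derivable (fun x : C => x^-1 ^+ k) x 1.
  move=> ax; elim: k => [|k IH].
    by rewrite (_ : (fun _ => _) = fun=> 1) ?funeqE//; exact: derivable_cstC.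
  rewrite (_ : (fun _ => _) = fun x : C => x^-1 * x^-1 ^+ k); last first.
    by apply/funext => y; rewrite exprS.
  apply: derivable_mulC; last exact: IH.
  by apply: derivable_invC; [exact: x0|exact: derivable_idC].
have dfV k x : ann x -> derivable (fun x : C => f x * x^-1 ^+ k) x 1.
  move=> ax; apply: derivable_mulC; last exact: dV.
  by apply: df; have /andP[] := ax.
have dfVk k x : ann x -> derivable (fun x : C => f x * x^-1 ^+ k * (x - z)^-1) x 1.
  by move=> ax; apply: derivable_mulC; [exact: dfV|exact: dk].
have E : square_integral r (fun x => f x * (x - z)^-1) =
    \sum_(j < n) square_integral r (fun x => f x * x^-1 ^+ j.+1) * z ^+ j +
    z ^+ n * square_integral r (fun x => f x * x^-1 ^+ n * (x - z)^-1).
  elim: n => [|n IH].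
    rewrite big_ord0 add0r expr0 mul1r; congr square_integral.
    by apply/funext => x; rewrite expr0 mulr1.
  rewrite big_ord_recr /= IH -addrA; congr (_ + _).
  rewrite exprSr -mulrA [X in _ = X + _]mulrC -mulrDr; congr (_ * _).
  rewrite addrC -(square_integral_lin r0); first last.
  - by move=> x /(dfV n.+1) /derivable_continuousC.
  - by move=> x /(dfVk n.+1) /derivable_continuousC.
  apply: (eq_square_integral r0) => x ax; first by have /derivable_continuousC := dfVk n _ ax.
  have := x0 _ ax; have := xz0 _ ax; rewrite exprS => ? ?; by field; apply/andP.
rewrite E addrAC subrr add0r Normc.normcM normcX.
have r0n : r != 0 by rewrite gt_eqF.
have B0 : 0 <= B by apply: le_trans (fB 0 _); rewrite ?normc_ge0 // Normc.normc0 mulr_ge0 // ltW.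
have := @square_integral_bound _ r r0 (B * r^-1 ^+ n * (2 / r)) _
  (fun x ax => derivable_continuousC (dfVk n _ ax)).
move=> /(_ _)/(ler_wpM2l (exprn_ge0 n (normc_ge0 z))) H.
apply: le_trans (H _) _ => {H}.
  move=> x ax; have /andP[rx xr] := ax; have nx0 : 0 < nc x by exact: lt_le_trans rx.
  rewrite !Normc.normcM normcX !Normc.normcV; apply: ler_pM => //.
  - by rewrite mulr_ge0 ?normc_ge0 // exprn_ge0 // invr_ge0 normc_ge0.
  - by rewrite invr_ge0 normc_ge0.
  - apply: ler_pM; rewrite ?normc_ge0 //; first by rewrite exprn_ge0 // invr_ge0 normc_ge0.
      exact: fB.
    by rewrite lerXn2r ?nnegrE ?invr_ge0 ?normc_ge0 ?(ltW r0) // lef_pV2.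
  - have h : r / 2 <= nc (x - z).
      by have := ler_normcD (x - z) z; rewrite subrK; move: rx zr; lra.
    rewrite -[2 / r]invf_div lef_pV2 ?posrE ?divr_gt0 //.
    by apply: lt_le_trans h; rewrite divr_gt0.
rewrite le_eqVlt; apply/orP; left; apply/eqP.
rewrite exprMn exprVn; have : r ^+ n != 0 by rewrite expf_neq0.
by move=> ?; field; apply/andP.
Qed.

End CauchyFormula.

(** * Order of vanishing of a holomorphic function at a point *)

Section Order.
Context {R : realType}.
Notation C := R[i].
Notation nc := (@Normc.normc R).

Lemma near_dnbhs_normcP (p : C) (P : C -> Prop) : (\forall z \near p^', P z) <->
  exists2 d : R, 0 < d & forall z, z != p -> nc (z - p) < d -> P z.
Proof.
rewrite near_withinE; split.
  by move=> /near_normcP[d d0 H]; exists d => // z zp /H; apply.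
by move=> [d d0 H]; apply/near_normcP; exists d => // z zd zp; exact: H.
Qed.

Lemma cvg_dnbhs0_lipschitz (F : C -> C) (l : C) (K d : R) : 0 < d ->
  (forall z, z != 0 -> nc z < d -> nc (F z - l) <= K * nc z) ->
  F z @[z --> 0^'] --> l.
Proof.
move=> d0 H; apply/(@cvgrPdist_lt _ _ _ (0^')) => _ /gt0_realC[e e0 ->].
have K0 : 0 < `|K| + 1 by rewrite ltr_wpDl.
apply/near_dnbhs_normcP; exists (Num.min d (e / (`|K| + 1))).
  by rewrite lt_min d0 divr_gt0.
move=> z z0; rewrite subr0 lt_min ltr_pdivlMr // => /andP[/(H _ z0) h1 h2].
rewrite normrcE ltcR normcB; apply: le_lt_trans h1 _; apply: le_lt_trans h2.
rewrite mulrC ler_wpM2l ?normc_ge0 // (le_trans (ler_norm _)) // lerDl //.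
Qed.

Lemma cvg_dnbhsM (F G : C -> C) (p k l : C) : F z @[z --> p^'] --> k ->
  G z @[z --> p^'] --> l -> F z * G z @[z --> p^'] --> k * l.
Proof. by move=> Fk Gl; exact: (cvgM Fk Gl). Qed.

Lemma cvg_dnbhsV (F : C -> C) (p k : C) : k != 0 -> F z @[z --> p^'] --> k ->
  (F z)^-1 @[z --> p^'] --> k^-1.
Proof. by move=> k0 Fk; exact: (cvgV k0 Fk). Qed.

(** The expansion is that of [f W], where the winding integral [W] is only known to be continuous
    and nonzero at 0. If all coefficients vanish, the geometric remainder kills [f W]; otherwise the
    first nonzero coefficient gives the order. *)
Theorem holomorphic_order0 (f : C -> C) : (\forall z \near (0 : C), derivable f z 1) ->
  (\forall z \near (0 : C), f z = 0) \/
  exists (n : nat) (l : C), l != 0 /\ f z / z ^+ n @[z --> 0^'] --> l.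
Proof.
move=> /near_normcP[d d0 df].
have [d' d'0 fB] := (continuous_normcP f 0).1
  (derivable_continuousC (df 0 (ltac:(by rewrite subrr Normc.normc0)))) 1 ltr01.
pose r := Num.min d d' / 3; have m0 : 0 < Num.min d d' by rewrite lt_min d0.
have r0 : 0 < r by rewrite divr_gt0.
have rd x : nc x <= 2 * r -> nc (x - 0) < Num.min d d'.
  by rewrite subr0 => /le_lt_trans; apply; rewrite /r; lra.
pose B := nc (f 0) + 1.
have dfr x : nc x <= 2 * r -> derivable f x 1.
  by move=> /rd; rewrite lt_min => /andP[/df].
have fBr x : nc x <= 2 * r -> nc (f x) <= B.
  move=> /rd; rewrite lt_min => /andP[_ /fB h].
  rewrite -(subrK (f 0) (f x)) (le_trans (ler_normcD _ _)) // /B addrC lerD2l.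
  exact: ltW.
pose W z := square_integral r (fun x => (x - z)^-1).
pose A j := square_integral r (fun x => f x * x^-1 ^+ j.+1).
have W0 : W 0 != 0.
  by rewrite /W; under [X in square_integral r X]eq_fun do rewrite subr0;
    exact: square_integral_inv.
have WE z : nc z <= r / 2 -> nc (W z - W 0) <= 32 / r * nc z.
  move=> zr; have := @cauchy_expansion _ r (fun=> 1) r0
    (fun x _ => @derivable_cstC R 1 x) 1 z 1 _ zr.
  rewrite Normc.normc1 => /(_ (fun _ _ => lexx _)).
  rewrite big_ord1 expr0 mulr1 mulr1 expr1.
  under [X in square_integral r X - _]eq_fun do rewrite mul1r.
  under [X in _ - square_integral r X]eq_fun do rewrite mul1r expr1.
  rewrite /W; under [X in _ -> nc (_ - square_integral r X) <= _]eq_fun do rewrite subr0.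
  by move=> /le_trans; apply; rewrite mulrA mulrAC.
have fE z n : nc z <= r / 2 ->
    nc (f z * W z - \sum_(j < n) A j * z ^+ j) <= 32 * B * (nc z / r) ^+ n.
  move=> zr; rewrite /W -cauchy_square //; first exact: cauchy_expansion.
  by have := r0; lra.
(* Any constant above 32 would serve in place of 33: it makes the bound [32 / r * nc z] of [WE]
   smaller than [nc (W 0)], so that [W] has no zero in this disc. *)
pose d1 := Num.min (r / 2) (r * nc (W 0) / 33).
have nW0 : 0 < nc (W 0) by rewrite normc_gt0.
have d10 : 0 < d1 by rewrite lt_min !divr_gt0 // mulr_gt0.
have WN0 z : nc z < d1 -> W z != 0.
  rewrite lt_min => /andP[/ltW zr zW]; apply/eqP => Wz.
  have := WE z zr; rewrite Wz sub0r normcN leNgt => /negP; apply.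
  by rewrite mulrAC ltr_pdivrMr //; move: zW; have := normc_ge0 z; lra.
have [A0|/existsNP[j0 /eqP Aj0]] := pselect (forall j, A j = 0).
  left; apply/near_normcP; exists d1 => // z; rewrite subr0 => zd1.
  have zr : nc z <= r / 2 by move: zd1; rewrite lt_min => /andP[/ltW].
  suff /eqP : f z * W z = 0 by rewrite mulf_eq0 (negPf (WN0 _ zd1)) orbF => /eqP.
  apply: Normc.eq0_normc; apply/eqP; rewrite eq_le normc_ge0 andbT leNgt.
  apply/negP; set T := nc _ => T0.
  have BB : 0 < 32 * B + 1 by rewrite ltr_wpDl // mulr_ge0 // addr_ge0 ?normc_ge0.
  have [n] := @expr2V_lt R (T / (32 * B + 1)) (ltac:(by rewrite divr_gt0)).
  rewrite ltr_pdivlMr // => nT.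
  have := fE z n zr; rewrite big1 ?subr0 => [|j _]; last by rewrite A0 mul0r.
  rewrite -/T => TB.
  have zr2 : nc z / r <= 2^-1 by rewrite ler_pdivrMr // mulrC.
  have z0 : 0 <= nc z / r by rewrite divr_ge0 ?normc_ge0 ?ltW.
  have : (nc z / r) ^+ n <= 2^-1 ^+ n by rewrite lerXn2r ?nnegrE ?invr_ge0.
  have p0 : 0 < (2^-1 : R) ^+ n by rewrite exprn_gt0 // invr_gt0.
  have B0 : 0 <= 32 * B by rewrite mulr_ge0 // addr_ge0 ?normc_ge0.
  by move=> /(ler_wpM2l B0); lra.
right; have exA : exists j, A j != 0 by exists j0.
case: (ex_minnP exA) => n An nmin; exists n, (A n * (W 0)^-1).
split; first by rewrite mulf_neq0 ?invr_eq0.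
have PA : (f z * W z) / z ^+ n @[z --> 0^'] --> A n.
  apply: (@cvg_dnbhs0_lipschitz _ _ (32 * B / r ^+ n.+1) d1) => // z z0.
  rewrite lt_min => /andP[/ltW zr _].
  have := fE z n.+1 zr; rewrite big_ord_recr big1 /= ?add0r; last first.
    move=> j _; apply/eqP; rewrite mulf_eq0; apply/orP; left.
    by apply/negPn/negP => /nmin; rewrite leqNgt ltn_ord.
  move=> H; have zn0 : z ^+ n != 0 by rewrite expf_neq0.
  have -> : f z * W z / z ^+ n - A n = (f z * W z - A n * z ^+ n) / z ^+ n.
    by field.
  rewrite Normc.normcM Normc.normcV normcX ler_pdivrMr ?exprn_gt0 ?normc_gt0 //.
  apply: le_trans H _; rewrite exprMn exprVn [X in X * r ^- _]exprSr.
  by rewrite le_eqVlt; apply/orP; left; apply/eqP; ring.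
have WC : W z @[z --> 0^'] --> W 0.
  apply: (@cvg_dnbhs0_lipschitz _ _ (32 / r) (r / 2)); first by rewrite divr_gt0.
  by move=> z _ /ltW; exact: WE.
have := cvg_dnbhsM PA (cvg_dnbhsV W0 WC).
apply: cvg_trans; apply: near_eq_cvg; apply/near_dnbhs_normcP; exists d1 => //.
by move=> z z0; rewrite subr0 => /WN0 Wz; field; rewrite Wz expf_neq0.
Qed.

End Order.

(** * Generic identities of holomorphic functions *)

Section IdentityTheorem.
Context {R : realType}.
Notation C := R[i].
Notation nc := (@Normc.normc R).

Lemma derivable_shiftC (f : C -> C) (p z : C) : derivable f (p + z) 1 ->
  derivable (fun w => f (p + w)) z 1.
Proof.
move=> df; rewrite /derivable (_ : (fun h => _) =
  (fun h : C => h^-1 *: ((f \o shift (p + z)) (h *: 1) - f (p + z)))) //.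
by apply/funext => h /=; rewrite addrCA.
Qed.

Lemma holomorphic_isolated (f : C -> C) (p : C) :
  (\forall z \near p, derivable f z 1) ->
  (\forall z \near p, f z = 0) \/ (\forall z \near p^', f z != 0).
Proof.
move=> /near_normcP[d d0 df].
have dfp : \forall z \near (0 : C), derivable (fun w => f (p + w)) z 1.
  apply/near_normcP; exists d => // z; rewrite subr0 => zd.
  by apply: derivable_shiftC; apply: df; rewrite addrAC subrr add0r.
have [/near_normcP[e e0 f0]|[n [l [l0 /cvgrPdist_lt fl]]]] := holomorphic_order0 dfp.
  left; apply/near_normcP; exists e => // z zp.
  by have := f0 (z - p); rewrite subr0 addrCA subrr addr0; apply.
right; have /near_dnbhs_normcP[e e0 fe] := fl `|l| (ltac:(by rewrite normr_gt0)).
apply/near_dnbhs_normcP; exists e => // z zp ze.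
have := fe (z - p); rewrite subr_eq0 subr0 addrCA subrr addr0 => /(_ zp ze).
by apply: contraTneq => ->; rewrite mul0r subr0 ltxx.
Qed.

(** Let [T] be the supremum of the times up to which [f] vanishes locally. An isolated zero at [T]
    is excluded by the zeros shortly before [T], so [f] vanishes near [T], and [T < 1] could be
    increased. *)
Lemma identity_unit_segment (f : C -> C) :
  (forall t : R, 0 <= t <= 1 -> \forall z \near (t%:C : C), derivable f z 1) ->
  (\forall z \near (0 : C), f z = 0) -> \forall z \near (1 : C), f z = 0.
Proof.
move=> df f0; pose N (t : R) := \forall z \near (t%:C : C), f z = 0.
pose E := [set t : R | 0 <= t <= 1 /\ forall s, 0 <= s <= t -> N s].
have E0 : E 0.
  by split=> [|s s0]; [rewrite lexx ler01|have -> : s = 0 by lra].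
have hE : has_sup E by split; [exists 0|exists 1 => t [/andP[]]].
pose T := sup E.
have T0 : 0 <= T by apply: ub_le_sup => //; exact: hE.2.
have T1 : T <= 1 by apply: ge_sup; [exact: hE.1|move=> t [/andP[]]].
have ltT s : 0 <= s -> s < T -> N s.
  move=> s0 sT; have sT' : 0 < T - s by rewrite subr_gt0.
  have [t Et st] := sup_adherent sT' hE.
  by apply: Et.2; rewrite s0; move: st; rewrite opprB addrC subrK => /ltW.
have NT : N T.
  have [//|] := holomorphic_isolated (df T (ltac:(by rewrite T0 T1))).
  move=> /near_dnbhs_normcP[d d0 fN0].
  have [T00|TN0] := eqVneq T 0; first by rewrite /N T00.
  have Tp : 0 < T by rewrite lt_def TN0.
  pose s := Num.max 0 (T - d / 2).
  have s0 : 0 <= s by rewrite le_max lexx.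
  have sT : s < T by rewrite gt_max Tp ltrBlDr ltrDl divr_gt0.
  have /near_normcP[e e0 fs] := ltT s s0 sT.
  have nsT : s%:C != T%:C :> C by rewrite (inj_eq (@complexI _)) lt_eqF.
  have sTd : nc (s%:C - T%:C) < d.
    rewrite -rmorphB normc_real ltr0_norm ?subr_lt0 // opprB ltrBlDr -ltrBlDl.
    by rewrite lt_max; apply/orP; right; lra.
  have fs0 : f s%:C = 0 by apply: fs; rewrite subrr Normc.normc0.
  by exfalso; move/eqP: (fN0 _ nsT sTd); apply.
have [d d0 fd] := (near_normcP _ _).1 NT.
have near_s s : `|s - T| < d -> N s.
  move=> sT; apply/near_normcP; exists (d - `|s - T|); first by rewrite subr_gt0.
  move=> z zs; apply: fd; rewrite -(subrK s%:C z) -addrA -rmorphB.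
  by apply: le_lt_trans (ler_normcD _ _) _; rewrite normc_real; lra.
suff TE : T = 1 by move: NT; rewrite /N TE.
apply/eqP; rewrite eq_le T1 /= leNgt; apply/negP => T1'.
pose s := Num.min 1 (T + d / 2).
have Ts : T < s by rewrite lt_min T1' ltrDl divr_gt0.
have : E s.
  split; first by rewrite ge_min lexx andbT le_min ler01 addr_ge0 // divr_ge0 // ltW.
  move=> u /andP[u0 us]; have [uT|Tu] := ltrP u T; first exact: ltT.
  apply: near_s; rewrite ger0_norm ?subr_ge0 // ltrBlDl.
  by apply: le_lt_trans us _; rewrite gt_min; apply/orP; right; lra.
by move=> /(ub_le_sup hE.2); rewrite leNgt Ts.
Qed.

Section NormedModule.
Context {V : normedModType C}.

Lemma ball_segment (x a b : V) (e : C) (t : R) : 0 <= t <= 1 ->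
  ball x e a -> ball x e b -> ball x e (a + (t%:C : C) *: (b - a)).
Proof.
rewrite -ball_normE /= => /andP[t0 t1] xa xb.
have -> : x - (a + (t%:C : C) *: (b - a)) =
   ((1 - t)%:C : C) *: (x - a) + (t%:C : C) *: (x - b).
  rewrite rmorphB /= scalerBl scale1r -addrA [X in _ = _ + X]addrC.
  by rewrite -scalerBr opprB [_ + (a - x)]addrC addrA subrK -[a - b]opprB scalerN opprD addrA.
apply: le_lt_trans (ler_normD _ _) _; rewrite !normrZ !normrcE !normc_real.
rewrite !ger0_norm ?subr_ge0 //.
have [->|tN0] := eqVneq t 0; first by rewrite subr0 mul1r mul0r addr0.
have -> : e = (1 - t)%:C * e + t%:C * e by rewrite -mulrDl -rmorphD subrK mul1r.
apply: ler_ltD; first by apply: ler_wpM2l; [rewrite ler0c subr_ge0|exact: ltW].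
by rewrite ltr_pM2l // ltcR lt_def tN0.
Qed.

(** Several variables are reduced to one by restricting [h] to the complex line through [y1] and
    [y]; the segment between these points stays in the ball. *)
Lemma identity_ball (h : V -> C^o) (x y1 y : V) (e : C) :
  (forall z, ball x e z -> differentiable h z) ->
  ball x e y1 -> ball x e y -> (\forall z \near y1, h z = 0) -> h y = 0.
Proof.
move=> dh xy1 xy h0; pose l (z : C) := y1 + z *: (y - y1).
have dl z : differentiable l z.
  apply: differentiableD; first exact: differentiable_cst.
  exact: differentiableZl.
have cl z : {for z, continuous l} by exact: differentiable_continuous.
have openb := @ball_open C V x e.
have := @identity_unit_segment (h \o l).
have -> : h y = (h \o l) 1 by rewrite /l /= scale1r subrKC.
move=> H; apply: (nbhs_singleton (H _ _)).
  move=> t t01; have tb : ball x e (l t%:C) by exact: ball_segment.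
  have : \forall z \near (t%:C : C), ball x e (l z).
    by apply: (cl t%:C); apply: open_nbhs_nbhs; split.
  apply: filterS => z zb; apply: diff_derivable.
  by apply: differentiable_comp; [exact: dl|exact: dh].
have : nbhs (l 0) [set z | h z = 0] by rewrite /l scale0r addr0.
by move=> /(cl 0).
Qed.

End NormedModule.
End IdentityTheorem.

(** * Calculus of generic properties *)

Section Generically.
Context {R : realType}.
Notation C := R[i].
Notation nc := (@Normc.normc R).
Implicit Types V W : normedModType C.

Lemma differentiable_idV V (x : V) : differentiable (@id V) x.
Proof. by have [] := is_diff_id x. Qed.

Lemma holomorphic_nearP V (h : V -> C^o) x (P : V -> Prop) :
  holomorphic_near h x -> (\forall y \near x, P y) ->
  exists2 e : C, 0 < e & forall y, ball x e y -> differentiable h y /\ P y.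
Proof.
move=> hh hP; have : \forall y \near x, differentiable h y /\ P y.
  by apply: filterS2 hh hP.
by move=> /nbhs_ballP[e /= e0 he]; exists e => // y /he.
Qed.

Lemma nonzero_holomorphic_ball V (h : V -> C^o) (x y : V) (e : C) :
  (forall z, ball x e z -> differentiable h z) -> 0 < e ->
  ball x e y -> h y != 0 -> nonzero_holomorphic_near h x.
Proof.
move=> dh e0 xy hy; split; first by apply/nbhs_ballP; exists e.
move=> h0; have := identity_ball dh (ballxx x e0) xy h0.
by move=> hy0; rewrite hy0 eqxx in hy.
Qed.

(** If the exceptional function vanished on some open subset of the ball, it would vanish on the
    whole ball. Density is what extends generic identities by continuity. *)
Lemma generically_dense V (x : V) (P : V -> Prop) : generically x P ->
  \forall y \near x, forall O, nbhs y O -> exists2 z, O z & P z.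
Proof.
move=> [h [hh hN0] hP]; have [e e0 He] := holomorphic_nearP hh hP.
apply/nbhs_ballP; exists e => // y xy O yO.
have Oball : nbhs y (O `&` ball x e).
  by apply: filterI => //; apply: open_nbhs_nbhs; split => //; exact: ball_open.
have [[z [[Oz xz] hz]]|H] := pselect (exists z, (O `&` ball x e) z /\ h z != 0).
  by exists z => //; exact: (He _ xz).2.
exfalso; apply: hN0; apply/nbhs_ballP; exists e => // z xz.
apply: (@identity_ball R V h x y z e (fun z xz => (He z xz).1) xy xz).
apply: filterS Oball => w Ow; apply/eqP/negPn/negP => hw.
by apply: H; exists w.
Qed.

Lemma generically_near V (x : V) (P : V -> Prop) :
  (\forall y \near x, P y) -> generically x P.
Proof.
move=> hP; exists (cst 1); last by apply: filterS hP.
split; first by apply: nearW => y; exact: differentiable_cst.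
by move=> /nbhs_singleton /eqP; rewrite oner_eq0.
Qed.

(** The product of the two exceptional functions is not identically 0: where the first is nonzero it
    is nonzero nearby, so the second would vanish on an open set and hence near [x]. *)
Lemma generically2 V (x : V) (P Q S : V -> Prop) :
  (forall y, P y -> Q y -> S y) ->
  generically x P -> generically x Q -> generically x S.
Proof.
move=> PQS [h [hh hN0] hP] [k [kk kN0] kQ].
have [e e0 He] := holomorphic_nearP hh hP.
have [d d0 Hd] := holomorphic_nearP kk kQ.
exists (fun y => h y * k y : C^o); last first.
  apply: filterS2 hP kQ => y Py Qy; rewrite mulf_eq0 negb_or => /andP[? ?].
  by apply: PQS; [exact: Py|exact: Qy].
split; first by apply: filterS2 hh kk => y dh dk; exact: differentiableM.
move=> hk0; have : \forall y \near x, h y * k y = 0 /\ (ball x e y /\ ball x d y).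
  apply: filterI => //; apply: filterI; exact: nbhsx_ballx.
move=> /nbhs_ballP[a /= a0 Ha].
have [y [xy hy]] : exists y, ball x a y /\ h y != 0.
  apply/not_existsP => H; apply: hN0; apply/nbhs_ballP; exists a => // y xy.
  by apply/eqP/negPn/negP => hy; apply: (H y).
have xay : nbhs y (ball x a) by apply: open_nbhs_nbhs; split => //; exact: ball_open.
apply: kN0; apply: filterS (nbhsx_ballx x _ d0) => z xz.
apply: (@identity_ball R V k x y z d (fun z xz => (Hd z xz).1) _ xz).
  by have [_ []] := Ha _ xy.
have hyC : {for y, continuous h}.
  by apply: differentiable_continuous; apply: (He _ _).1; have [_ []] := Ha _ xy.
have : \forall w \near y, h w != 0.
  have := hyC; move=> /cvgrPdist_lt /(_ `|h y| (ltac:(by rewrite normr_gt0))).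
  by apply: filterS => w; apply: contraTneq => ->; rewrite subr0 ltxx.
apply: filterS2 xay => w xw hw; have [/eqP + _] := Ha _ xw.
by rewrite mulf_eq0 (negPf hw) => /eqP.
Qed.

Lemma genericallyS V (x : V) (P Q : V -> Prop) : (forall y, P y -> Q y) ->
  generically x P -> generically x Q.
Proof.
by move=> PQ [h hh hP]; exists h => //; apply: filterS hP => y Py /Py /PQ.
Qed.

Lemma genericallyI V (x : V) (P Q : V -> Prop) :
  generically x P -> generically x Q -> generically x (fun y => P y /\ Q y).
Proof. exact: generically2. Qed.

Lemma generically_ex V (x : V) (P : V -> Prop) : generically x P -> exists y, P y.
Proof.
move=> /generically_dense/nbhs_singleton /(_ setT filterT) [y _ Py].
by exists y.
Qed.

(** The continuous right inverse [s] ensures that [h] composed with [l] vanishes near [x] only if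
    [h] vanishes near [l x]. *)
Lemma generically_comp V W (l : V -> W) (s : W -> V) (x : V) (P : W -> Prop) :
  (\forall y \near x, differentiable l y) -> {for l x, continuous s} ->
  s (l x) = x -> cancel s l ->
  generically (l x) P -> generically x (fun y => P (l y)).
Proof.
move=> dl cs slx sl [h [hh hN0] hP].
have cl : {for x, continuous l}.
  by apply: differentiable_continuous; exact: nbhs_singleton dl.
exists (fun y => h (l y) : C^o); last exact: (cl _ hP).
split; first by apply: filterS2 dl (cl _ hh) => y dly dhly; exact: differentiable_comp.
move=> hl0; apply: hN0; have {}hl0 : nbhs (s (l x)) [set y | h (l y) = 0] by rewrite slx.
have H : \forall w \near l x, h (l (s w)) = 0 := cs _ hl0.
by apply: filterS H => w; rewrite sl.
Qed.

(** At a point [(x0, y0)] where the exceptional function [h] is nonzero, [h (_, y0)] serves for the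
    outer variable; wherever it is nonzero, [h (v, _)] serves for the inner one. *)
Lemma generically_fubini V W (x : V) (y : W) (P : V -> W -> Prop) :
  generically (x, y) (fun p => P p.1 p.2) ->
  generically x (fun v => generically y (fun w => P v w)).
Proof.
move=> [h [hh hN0] hP]; have [e e0 He] := holomorphic_nearP hh hP.
have [[x0 y0] [[xx0 yy0] h0]] : exists p, ball (x, y) e p /\ h p != 0.
  apply/not_existsP => H; apply: hN0; apply/nbhs_ballP; exists e => // p xp.
  by apply/eqP/negPn/negP => hp; apply: (H p).
exists (fun v => h (v, y0)).
  apply: (@nonzero_holomorphic_ball _ _ x x0 e) => // z xz.
  apply: (@differentiable_comp _ _ _ _ (fun v => (v, y0)) h).
    apply: differentiable_pair; first exact: differentiable_idV.
    exact: differentiable_cst.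
  by apply: (He _ _).1.
apply: filterS (nbhsx_ballx x _ e0) => v xv hv; exists (fun w => h (v, w)).
  apply: (@nonzero_holomorphic_ball _ _ y y0 e) => // z yz.
  apply: (@differentiable_comp _ _ _ _ (fun w => (v, w)) h).
    apply: differentiable_pair; first exact: differentiable_cst.
    exact: differentiable_idV.
  by apply: (He _ _).1.
apply: filterS (nbhsx_ballx y _ e0) => w yw hvw.
by apply: (He (v, w) _).2.
Qed.

(** Zeros in one variable are isolated; conversely [z - p] is holomorphic and vanishes only at
    [p]. *)
Lemma generically1P (p : C) (P : C -> Prop) :
  generically p P <-> \forall z \near p^', P z.
Proof.
split.
  move=> [h [hh hN0] hP].
  have dh : \forall z \near p, derivable h z 1.
    by apply: filterS hh => z dz; exact: diff_derivable.
  have [//|hz] := holomorphic_isolated dh.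
  rewrite !near_withinE in hz *.
  by apply: filterS2 hz hP => z hz hPz zp; apply: hPz; exact: hz.
move=> hP; exists (fun z => z - p : C^o); last first.
  rewrite near_withinE in hP; apply: filterS hP => z Pz zp.
  by apply: Pz; rewrite -subr_eq0.
split.
  apply/near_normcP; exists 1 => //.
move=> /near_normcP[d d0 H].
have /H : nc (p + (d / 2)%:C - p) < d.
  rewrite addrAC subrr add0r normc_real gtr0_norm ?divr_gt0 //; lra.
rewrite addrAC subrr add0r => /eqP; rewrite fmorph_eq0 mulf_eq0 invr_eq0.
by rewrite pnatr_eq0 (gt_eqF d0).
Qed.

End Generically.

(** * Limits of matrices and orders of poles *)

Section FiniteDimensionalLimits.
Context {R : realType}.
Notation C := R[i].

Section Filter.
Context {T : Type} {F : set_system T} {FF : Filter F}.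

Lemma cvg_sumr (I : Type) (s : seq I) (W : normedModType C) (f : I -> T -> W) l :
  (forall i, f i x @[x --> F] --> l i) ->
  \sum_(i <- s) f i x @[x --> F] --> \sum_(i <- s) l i.
Proof.
move=> fl; elim: s => [|i s IH].
  by rewrite big_nil; under eq_cvg => x do rewrite big_nil; exact: cvg_cst.
rewrite big_cons; under eq_cvg => x do rewrite big_cons.
exact: (cvgD (fl i) IH).
Qed.

Lemma cvg_mx_coord (m n : nat) (f : T -> 'M[C]_(m, n)) (l : 'M[C]_(m, n)) i j :
  f x @[x --> F] --> l -> f x i j @[x --> F] --> l i j.
Proof.
move=> fl; have cl : {for l, continuous (fun M : 'M[C]_(m, n) => M i j)}.
  exact: coord_continuous.
exact: (cvg_comp f (fun M : 'M[C]_(m, n) => M i j) fl cl).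
Qed.

Lemma linear_cvg (m n : nat) (W : normedModType C) (L : 'M[C]_(m, n) -> W)
    (f : T -> 'M[C]_(m, n)) (l : 'M[C]_(m, n)) : linear L ->
  f x @[x --> F] --> l -> L (f x) @[x --> F] --> L l.
Proof.
move=> Ll fl; rewrite (linear_delta_sum l Ll).
under eq_cvg => x do rewrite (linear_delta_sum (f x) Ll).
apply: cvg_sumr => i; apply: cvg_sumr => j.
by apply: cvgZr_tmp; exact: cvg_mx_coord.
Qed.

Lemma bilinear_cvg (m n p q : nat) (W : normedModType C)
    (B : 'M[C]_(m, n) -> 'M[C]_(p, q) -> W) (f : T -> 'M[C]_(m, n)) (f0 : 'M[C]_(m, n))
    (g : T -> 'M[C]_(p, q)) (g0 : 'M[C]_(p, q)) :
  (forall y, linear (B^~ y)) -> (forall x, linear (B x)) ->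
  f x @[x --> F] --> f0 -> g x @[x --> F] --> g0 ->
  B (f x) (g x) @[x --> F] --> B f0 g0.
Proof.
move=> Bl Br ff gg; rewrite (linear_delta_sum f0 (Bl g0)).
under eq_cvg => x do rewrite (linear_delta_sum (f x) (Bl (g x))).
apply: cvg_sumr => i; apply: cvg_sumr => j.
have Bij : B (delta_mx i j) (g x) @[x --> F] --> B (delta_mx i j) g0.
  exact: linear_cvg.
by apply: cvgZ; [exact: cvg_mx_coord|exact: Bij].
Qed.

Lemma cvg_mulmx (m n p : nat) (f : T -> 'M[C]_(m, n)) (f0 : 'M[C]_(m, n))
    (g : T -> 'M[C]_(n, p)) (g0 : 'M[C]_(n, p)) :
  f x @[x --> F] --> f0 -> g x @[x --> F] --> g0 ->
  f x *m g x @[x --> F] --> f0 *m g0.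
Proof.
apply: (@bilinear_cvg m n n p _ (@mulmx C m n p)) => y a u v.
  by rewrite mulmxDl scalemxAl.
by rewrite mulmxDr scalemxAr.
Qed.

Lemma cvg_mx (m n : nat) (f : T -> 'M[C]_(m, n)) (l : 'M[C]_(m, n)) :
  (forall i j, f x i j @[x --> F] --> l i j) -> f x @[x --> F] --> l.
Proof.
move=> fl; rewrite (matrix_sum_delta l).
under eq_cvg => x do rewrite (matrix_sum_delta (f x)).
apply: cvg_sumr => i; apply: cvg_sumr => j.
exact: cvgZr_tmp.
Qed.

End Filter.

Lemma cvg_dnbhs_expr (n : nat) : (0 < n)%N -> (z ^+ n : C) @[z --> (0 : C)^'] --> (0 : C).
Proof.
case: n => // n _; elim: n => [|n IH].
  apply: (@cvg_dnbhs0_lipschitz _ _ _ 1 1) => // z _ _.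
  by rewrite expr1 subr0 mul1r.
have id0 : (z : C) @[z --> (0 : C)^'] --> (0 : C).
  by apply: (@cvg_dnbhs0_lipschitz _ _ _ 1 1) => // z _ _; rewrite subr0 mul1r.
have := cvg_dnbhsM id0 IH; rewrite mul0r.
by under eq_cvg => z do rewrite -exprS.
Qed.

Lemma cvg_dnbhs_eq (T : topologicalType) (p : C) (f g : C -> T) (l : T) :
  (\forall z \near p^', f z = g z) -> f z @[z --> p^'] --> l ->
  g z @[z --> p^'] --> l.
Proof. by move=> fg; apply: cvg_trans; apply: near_eq_cvg. Qed.

(** [k] is the order of the pole, cut off at 0: for [k = 0] there is merely a limit, possibly 0. *)
Lemma meromorphic_order1 (f : C -> C) (g h : C -> C) :
  (\forall z \near (0 : C), derivable g z 1) ->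
  (\forall z \near (0 : C), derivable h z 1) ->
  ~ (\forall z \near (0 : C), h z = 0) ->
  (\forall z \near (0 : C)^', f z = (h z)^-1 * g z) ->
  exists (k : nat) (l : C), (z ^+ k * f z) @[z --> 0^'] --> l /\ ((0 < k)%N -> l != 0).
Proof.
move=> dg dh hN0 fgh.
have [//|[m [b [b0 hb]]]] := holomorphic_order0 dh.
have z0 : \forall z \near (0 : C)^', z != 0 by exact: nbhs_dnbhs_neq.
have [g0|[n [a [a0 ga]]]] := holomorphic_order0 dg.
  exists 0%N, 0; split; last by [].
  apply: (@cvg_dnbhs_eq C 0 (fun=> 0)); last exact: cvg_cst.
  have g0' : \forall z \near (0 : C)^', g z = 0 by exact: nbhs_dnbhs.
  by apply: filterS2 fgh g0' => z -> ->; rewrite !mulr0.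
have quo : (h z / z ^+ m)^-1 * (g z / z ^+ n) @[z --> 0^'] --> b^-1 * a.
  by apply: cvg_dnbhsM ga; exact: cvg_dnbhsV.
have [nm|mn] := leqP n m.
  exists (m - n)%N, (b^-1 * a); split; last by move=> _; rewrite mulf_neq0 ?invr_eq0.
  apply: cvg_dnbhs_eq quo; apply: filterS2 z0 fgh => z zN0 ->.
  rewrite -{1}(subnK nm) exprD; have := expf_neq0 n zN0.
  move=> zn; rewrite !invfM invrK [in RHS]mulrA; move: (h z)^-1 (g z) => u w.
  by field.
exists 0%N, 0; split; last by [].
have := cvg_dnbhsM (@cvg_dnbhs_expr (n - m) (ltac:(by rewrite subn_gt0))) quo.
rewrite mul0r; apply: cvg_dnbhs_eq; apply: filterS2 z0 fgh => z zN0 ->.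
rewrite -{2}(subnK (ltnW mn)) exprD expr0 mul1r.
have := expf_neq0 m zN0; have := expf_neq0 (n - m) zN0.
move=> zm zn; rewrite !invfM invrK; move: (h z)^-1 (g z) => u w.
by field; apply/andP.
Qed.

Lemma meromorphic_order (m n : nat) (f : C -> 'M[C]_(m, n)) (g : C -> 'M[C]_(m, n))
    (h : C -> C) :
  (forall i j, \forall z \near (0 : C), derivable (fun z => g z i j) z 1) ->
  (\forall z \near (0 : C), derivable h z 1) ->
  ~ (\forall z \near (0 : C), h z = 0) ->
  (\forall z \near (0 : C)^', f z = (h z)^-1 *: g z) ->
  exists (k : nat) (l : 'M[C]_(m, n)),
    (z ^+ k *: f z) @[z --> 0^'] --> l /\ ((0 < k)%N -> l != 0).
Proof.
move=> dg dh hN0 fgh.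
have H (p : 'I_m * 'I_n) : exists kl : nat * C,
    (z ^+ kl.1 * f z p.1 p.2) @[z --> 0^'] --> kl.2 /\ ((0 < kl.1)%N -> kl.2 != 0).
  have [|k [l kl]] := meromorphic_order1 (f := fun z => f z p.1 p.2) (dg p.1 p.2) dh hN0.
    by apply: filterS fgh => z ->; rewrite mxE.
  by exists (k, l).
have [F HF] := choice H.
(* The pole order of a matrix is the largest order of its entries. After multiplication by [z ^+ K]
   the entries of smaller order tend to 0, and for positive [K] some entry has a nonzero limit. *)
pose K := \max_(p : 'I_m * 'I_n) (F p).1.
exists K, (\matrix_(i, j) if (F (i, j)).1 == K then (F (i, j)).2 else 0); split.
  apply: cvg_mx => i j; rewrite mxE; have [Fc _] := HF (i, j).
  under eq_cvg => z do rewrite mxE.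
  have [<-//|FK] := eqVneq.
  have FK' : ((F (i, j)).1 < K)%N.
    by rewrite ltn_neqAle FK; exact: (@leq_bigmax _ (fun p => (F p).1)).
  have := cvg_dnbhsM (@cvg_dnbhs_expr (K - (F (i, j)).1) (ltac:(by rewrite subn_gt0))) Fc.
  rewrite mul0r; under eq_cvg => z do rewrite /= mulrA -exprD subnK ?(ltnW FK') //.
  exact.
move=> K0; have [p Hp] : exists p, (F p).1 = K.
  apply/not_existsP => HK; suff : (K <= K.-1)%N by rewrite leqNgt prednK // leqnn.
  apply/bigmax_leqP => p _; rewrite -ltnS prednK // ltn_neqAle leq_bigmax andbT.
  by apply/eqP; exact: HK.
apply/eqP => /matrixP /(_ p.1 p.2); rewrite !mxE -surjective_pairing Hp eqxx => /eqP.
by apply/negP; apply: (HF p).2; rewrite Hp.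
Qed.

End FiniteDimensionalLimits.

(** * The regular locus of a solution *)

Section RegularLocus.
Context {R : realType} {N : nat}.
Notation C := R[i].
Notation nc := (@Normc.normc R).
Notation A := 'M[R[i]]_N.
Notation AA := 'M[R[i]]_(N * N).
Implicit Types (r : C -> C -> AA) (G : C -> C -> Prop).

Definition punctured_disc (s : R) (z : C) := z != 0 /\ nc z < s.

(* [G] stands for the nonvanishing locus of the product of all the holomorphic functions
   that occur in the hypotheses; on it the generic identities hold pointwise. *)
Record regular_locus r (c0 : C -> AA) G (s : R) : Prop := RegularLocus {
  locus_gt0 : 0 < s;
  locus_open : forall u v, G u v -> \forall x \near ((u, v) : C * C), G x.1 x.2;
  locus_continuous : forall u v, G u v -> r x.1 x.2 @[x --> ((u, v) : C * C)] --> r u v;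
  locus_opp : forall u v, G u v -> G (- u) (- v);
  locus_unitary : forall u v, G u v -> leg21 (r (- u) (- v)) = - r u v;
  locus_inj : forall u v, G u v -> forall y, tract (r u v) y = 0 -> y = 0;
  locus_AYBE : forall a b v w, G a v -> G b w -> G (a + b) v -> G b (w - v) ->
    G (a + b) w -> G (- a) (w - v) ->
    leg12 (r a v) *m leg13 (r b w) - leg23 (r b (w - v)) *m leg12 (r (a + b) v)
    + leg13 (r (a + b) w) *m leg23 (r (- a) (w - v)) = 0;
  locus_generic : generically (0 : C * C) (fun x => G x.1 x.2);
  locus_slice_v : forall t, punctured_disc s t -> \forall e \near (0 : C)^', G t e;
  locus_slice_u : forall v, punctured_disc s v -> \forall u \near (0 : C)^', G u v;
  locus_residue : forall v, punctured_disc s v ->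
    (r u v - u^-1 *: 1%:M) @[u --> (0 : C)^'] --> c0 v;
  locus_derivable : forall v, punctured_disc s v -> derivable c0 v 1;
  locus_order : forall t, punctured_disc s t -> exists (k : nat) (l : AA),
    (e ^+ k *: r t e) @[e --> (0 : C)^'] --> l /\ ((0 < k)%N -> l != 0)
}.

Lemma near_punctured_disc (P : C -> Prop) :
  (\forall z \near (0 : C)^', P z) <->
  exists2 s : R, 0 < s & forall z, punctured_disc s z -> P z.
Proof.
rewrite near_dnbhs_normcP; split=> -[s s0 H]; exists s => // z.
  by move=> [z0 zs]; apply: H => //; rewrite subr0.
by move=> z0; rewrite subr0 => zs; apply: H.
Qed.

Lemma derivable_mx (m n : nat) (f : C -> 'M[C]_(m, n)) (v : C) :
  (forall i j, derivable (fun z => f z i j) v 1) -> derivable f v 1.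
Proof.
move=> H; have [L HL] := choice (fun p : 'I_m * 'I_n => (cvg_ex _).1 (H p.1 p.2)).
apply/cvg_ex; exists (\matrix_(i, j) L (i, j)); apply: cvg_mx => i j.
rewrite mxE; under eq_cvg => z do rewrite !mxE.
exact: (HL (i, j)).
Qed.

(** Convergence at the single point [u0] bounds all its terms by some [B]. For [nc u] at most half
    of [nc u0] the series is dominated by a geometric one of ratio at most 1/2, and [f u] differs
    from [a 0%N] by at most [4 * B / s * nc u]. *)
Lemma power_series_cvg0 (V : normedModType C) (a : nat -> V) (f : C -> V) :
  (\forall u \near (0 : C)^', series (fun k => u ^+ k *: a k) @ \oo --> f u) ->
  f u @[u --> (0 : C)^'] --> a 0%N.
Proof.
(* The norm takes values in [R[i]]; its real part allows estimates in [R]. *)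
pose n (x : V) : R := complex.Re `|x|.
have nE (x : V) : `|x| = (n x)%:C by rewrite RRe_real // ger0_real.
have n_ge0 x : 0 <= n x by rewrite -ler0c -nE.
have nD x y : n (x + y) <= n x + n y by rewrite -lecR rmorphD /= -!nE ler_normD.
have nZ (z : C) x : n (z *: x) = nc z * n x.
  by apply: complexI; rewrite rmorphM /= -!nE normrZ normrcE.
have nN x : n (- x) = n x by apply: complexI; rewrite -!nE normrN.
have nB x y : n (x - y) = n (y - x) by apply: complexI; rewrite -!nE distrC.
move=> /near_dnbhs_normcP[s s0 H].
pose u0 : C := (s / 2)%:C.
have u0s : nc u0 = s / 2 by rewrite normc_real gtr0_norm // divr_gt0.
have u00 : u0 != 0 by rewrite -normc_gt0 u0s divr_gt0.
have S0 : series (fun k => u0 ^+ k *: a k) @ \oo --> f u0.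
  by apply: H => //; rewrite subr0 u0s; lra.
have [B B0 tB] : exists2 B : R, 0 <= B & forall k, n (u0 ^+ k *: a k) <= B.
  have /cvgrPdist_lt /(_ 1 ltr01) [M _ HM] := S0.
  pose P := \sum_(k < M) n (u0 ^+ k *: a k).
  have P0 : 0 <= P by apply: sumr_ge0.
  exists (2 + P); first by rewrite addr_ge0.
  move=> k; have [Mk|kM] := leqP M k; last first.
    have : n (u0 ^+ k *: a k) <= P.
      rewrite /P (bigD1 (Ordinal kM)) //= lerDl; exact: sumr_ge0.
    by lra.
  have h (m : nat) : (M <= m)%N -> n (f u0 - series (fun k => u0 ^+ k *: a k) m) < 1.
    by move=> /HM /=; rewrite nE (_ : 1 = 1%:C) // ltcR.
  have : n (u0 ^+ k *: a k) <= 2.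
    rewrite (_ : u0 ^+ k *: a k = (f u0 - series (fun k => u0 ^+ k *: a k) k) +
      - (f u0 - series (fun k => u0 ^+ k *: a k) k.+1)).
      apply: le_trans (nD _ _) _; rewrite nN.
      by have := h k Mk; have := h k.+1 (leqW Mk); lra.
    by rewrite opprB [RHS]addrC addrA subrK /series /= big_nat_recr //= [X in X - _]addrC addrK.
  by lra.
have main u : u != 0 -> nc u <= s / 4 -> n (f u - a 0%N) <= 4 * B / s * nc u.
  move=> uN0 us; have Su : series (fun k => u ^+ k *: a k) @ \oo --> f u.
    by apply: H => //; rewrite subr0; lra.
  pose q := nc u / nc u0.
  have q0 : 0 <= q by rewrite divr_ge0 ?normc_ge0.
  have q2 : q <= 2^-1 by rewrite /q u0s ler_pdivrMr ?divr_gt0 //; lra.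
  have tq k : n (u ^+ k *: a k) <= B * q ^+ k.
    have -> : u ^+ k *: a k = (u / u0) ^+ k *: (u0 ^+ k *: a k).
      by rewrite scalerA exprMn exprVn mulfVK // expf_neq0.
    rewrite nZ normcX Normc.normcM Normc.normcV mulrC; apply: ler_wpM2r => //.
    exact: exprn_ge0.
  have Sn m : n (series (fun k => u ^+ k *: a k) m.+1 - a 0%N) <= B * (2 * q * (1 - 2^-1 ^+ m)).
    elim: m => [|m IH].
      rewrite /series /= big_nat1 expr0 scale1r subrr expr0 subrr !mulr0.
      by rewrite /n normr0.
    rewrite /series /= big_nat_recr //= addrAC; apply: le_trans (nD _ _) _.
    apply: le_trans (lerD IH (tq _)) _; rewrite -mulrDr; apply: ler_wpM2l => //.
    have : q ^+ m <= 2^-1 ^+ m by rewrite lerXn2r ?nnegrE // invr_ge0.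
    by rewrite !exprS => h; have := ler_wpM2l q0 h; lra.
  have -> : 4 * B / s * nc u = B * (2 * q).
    by rewrite /q u0s; field; rewrite gt_eqF.
  apply/ler_addgt0Pr => e e0.
  have /cvgrPdist_lt /(_ e%:C) := Su; rewrite ltcR => /(_ e0) [M _ HM].
  have := HM M.+1 (leqnSn M); rewrite /= nE ltcR => h.
  rewrite -(subrK (series (fun k => u ^+ k *: a k) M.+1) (f u)) -addrA.
  have h2 : B * (2 * q * (1 - 2^-1 ^+ M)) <= B * (2 * q).
    apply: ler_wpM2l => //; apply: ler_piMr; first by rewrite mulr_ge0.
    by rewrite lerBlDr lerDl exprn_ge0 // invr_ge0.
  apply: le_trans (nD _ _) _; have := le_trans (Sn M) h2; move: h.
  by move: (n _) (n _) => x y; lra.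
apply/(@cvgrPdist_lt _ _ _ (0^')) => _ /gt0_realC[e e0 ->].
apply/near_dnbhs_normcP; exists (Num.min (s / 4) (e / (4 * B / s + 1))).
  by rewrite lt_min !divr_gt0 // ltr_wpDl // divr_ge0 ?mulr_ge0 // ltW.
move=> u uN0; rewrite subr0 lt_min => /andP[/ltW us].
have k0 : 0 <= 4 * B / s by rewrite divr_ge0 ?mulr_ge0 // ltW.
rewrite ltr_pdivlMr ?ltr_wpDl // nE ltcR nB => ue.
apply: le_lt_trans (main _ uN0 us) _; apply: le_lt_trans ue.
by rewrite mulrC ler_wpM2l ?normc_ge0 // lerDl.
Qed.

Lemma generically_nonzero (V : normedModType C) (x : V) (h : V -> C^o) :
  nonzero_holomorphic_near h x -> generically x (fun y => h y != 0).
Proof. by move=> hx; exists h => //; apply: nearW. Qed.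

Lemma differentiable_slice (g : C * C -> C) (t e : C) :
  differentiable (g : C * C -> C^o) (t, e) -> derivable (fun e => g (t, e)) e 1.
Proof.
move=> dg; apply: diff_derivable.
apply: (@differentiable_comp _ _ _ _ (fun w : C => (t, w)) (g : C * C -> C^o)) => //.
Qed.

Lemma generically_opp (V : normedModType C) (P : V -> Prop) :
  generically 0 P -> generically 0 (fun x => P (- x)).
Proof.
move=> gP; apply: (@generically_comp R V V (fun x => - x) (fun x => - x) 0) => //.
- apply: nearW => x; apply: differentiableN; exact: differentiable_idV.
- by apply: cvgN; exact: cvg_id.
- by rewrite !oppr0.
- exact: opprK.
- by rewrite oppr0.
Qed.

Lemma differentiable_near_nonzero (V : normedModType C) (k : V -> C^o) x :
  differentiable k x -> k x != 0 -> \forall y \near x, k y != 0.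
Proof.
move=> /differentiable_continuous /cvgrPdist_lt /(_ `|k x|) + kx.
rewrite normr_gt0 => /(_ kx); apply: filterS => y.
by apply: contraTneq => ->; rewrite subr0 ltxx.
Qed.

Lemma cvg_addC (T : Type) (F : set_system T) {FF : Filter F} (f g : T -> C) (k l m : C) :
  f x @[x --> F] --> k -> g x @[x --> F] --> l -> k + l = m ->
  f x + g x @[x --> F] --> m.
Proof. by move=> fk gl <-; exact: (cvgD fk gl). Qed.

Lemma cvg_oppC (T : Type) (F : set_system T) {FF : Filter F} (f : T -> C) (k l : C) :
  f x @[x --> F] --> k -> - k = l -> - f x @[x --> F] --> l.
Proof. by move=> fk <-; exact: (cvgN fk). Qed.

Lemma cvg_curry (T : Type) (F : set_system T) {FF : Filter F} (V : topologicalType)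
    (r : C -> C -> V) (f k : T -> C) (p q : C) (l : V) :
  r x.1 x.2 @[x --> ((p, q) : C * C)] --> l ->
  f x @[x --> F] --> p -> k x @[x --> F] --> q -> r (f x) (k x) @[x --> F] --> l.
Proof.
move=> rl fp kq.
have fk : (f x, k x) @[x --> F] --> ((p, q) : C * C) by exact: (cvg_pair fp kq).
exact: (cvg_comp (fun x => (f x, k x)) (fun y : C * C => r y.1 y.2) fk rl).
Qed.

Lemma cvg_sub_add (T : Type) (F : set_system T) {FF : Filter F} (W : normedModType C)
    (f1 f2 f3 : T -> W) (l1 l2 l3 : W) :
  f1 x @[x --> F] --> l1 -> f2 x @[x --> F] --> l2 -> f3 x @[x --> F] --> l3 ->
  f1 x - f2 x + f3 x @[x --> F] --> l1 - l2 + l3.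
Proof. by move=> h1 h2 h3; exact: (cvgD (cvgB h1 h2) h3). Qed.

Lemma cvg_AYBE (T : Type) (F : set_system T) {FF : Filter F}
    (f1 f2 f3 f4 f5 f6 : T -> AA) (l1 l2 l3 l4 l5 l6 : AA) :
  f1 x @[x --> F] --> l1 -> f2 x @[x --> F] --> l2 -> f3 x @[x --> F] --> l3 ->
  f4 x @[x --> F] --> l4 -> f5 x @[x --> F] --> l5 -> f6 x @[x --> F] --> l6 ->
  leg12 (f1 x) *m leg13 (f2 x) - leg23 (f3 x) *m leg12 (f4 x) + leg13 (f5 x) *m leg23 (f6 x)
    @[x --> F] -->
  leg12 l1 *m leg13 l2 - leg23 l3 *m leg12 l4 + leg13 l5 *m leg23 l6.
Proof.
move=> h1 h2 h3 h4 h5 h6.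
have g1 : leg12 (f1 x) *m leg13 (f2 x) @[x --> F] --> leg12 l1 *m leg13 l2.
  exact: (cvg_mulmx (linear_cvg (@leg12P C N) h1) (linear_cvg (@leg13P C N) h2)).
have g2 : leg23 (f3 x) *m leg12 (f4 x) @[x --> F] --> leg23 l3 *m leg12 l4.
  exact: (cvg_mulmx (linear_cvg (@leg23P C N) h3) (linear_cvg (@leg12P C N) h4)).
have g3 : leg13 (f5 x) *m leg23 (f6 x) @[x --> F] --> leg13 l5 *m leg23 l6.
  exact: (cvg_mulmx (linear_cvg (@leg13P C N) h5) (linear_cvg (@leg23P C N) h6)).
exact: (cvg_sub_add g1 g2 g3).
Qed.

Lemma differentiable_fst_mod (V W : normedModType C) (x : V * W) :
  differentiable (fst : V * W -> V) x.
Proof.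
have l : linear (fst : V * W -> V) by [].
pose L : {linear (V * W)%type -> V} :=
  HB.pack (fst : V * W -> V) (GRing.isLinear.Build _ _ _ _ (fst : V * W -> V) l).
have cL : continuous L by move=> -[a b]; exact: cvg_fst.
exact: (linear_differentiable x cL).
Qed.

Lemma differentiable_snd_mod (V W : normedModType C) (x : V * W) :
  differentiable (snd : V * W -> W) x.
Proof.
have l : linear (snd : V * W -> W) by [].
pose L : {linear (V * W)%type -> W} :=
  HB.pack (snd : V * W -> W) (GRing.isLinear.Build _ _ _ _ (snd : V * W -> W) l).
have cL : continuous L by move=> -[a b]; exact: cvg_snd.
exact: (linear_differentiable x cL).
Qed.

Lemma generically_swap (V W : normedModType C) (x : V) (y : W) (P : V -> W -> Prop) :
  generically (x, y) (fun p => P p.1 p.2) -> generically (y, x) (fun p => P p.2 p.1).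
Proof.
move=> gP; pose sw (V W : normedModType C) (p : V * W) := (p.2, p.1).
have dsw (V' W' : normedModType C) (p : V' * W') : differentiable (sw V' W') p.
  apply: differentiable_pair; first exact: differentiable_snd_mod.
  exact: differentiable_fst_mod.
have near_all (U : normedModType C) (q : U) (Q : U -> Prop) :
    (forall p, Q p) -> \forall p \near q, Q p by move=> ?; exact: nearW.
apply: (@generically_comp R _ _ (sw W V) (sw V W) (y, x) (fun p => P p.1 p.2)) => //.
- exact: (near_all (W * V)%type (y, x) _ (dsw W V)).
- by apply: differentiable_continuous; exact: dsw.
- by case.
Qed.

Lemma regular_locus_exists r (c : nat -> C -> AA) :
  is_AYBE_solution r -> is_AYBE_unitary r -> is_AYBE_nondegenerate r ->
  laurent_at_u0 r c -> exists G s, regular_locus r (c 0%N) G s.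
Proof.
move=> [[g [h [hg hh rgh]]] aybe] [hu hhu unit] [hn hhn nd] [cm lau].
have [e1 e10 He1] := holomorphic_nearP hh.1 rgh.
have [e2 e20 He2] := holomorphic_nearP hhu.1 unit.
have [e3 e30 He3] := holomorphic_nearP hhn.1 nd.
have [e4 /= e40 He4] := (nbhs_ballP _ _).1 (generically_dense aybe).
have [e5 /= e50 He5] := (nbhs_ballP _ _).1 hg.
have [e e0 [E1 E2 E3 E4 E5]] : exists2 e : C, 0 < e & [/\ e <= e1, e <= e2, e <= e3, e <= e4 & e <= e5].
  have [d1 ? ->] := gt0_realC e10; have [d2 ? ->] := gt0_realC e20.
  have [d3 ? ->] := gt0_realC e30; have [d4 ? ->] := gt0_realC e40.
  have [d5 ? ->] := gt0_realC e50.
  exists (Num.min d1 (Num.min d2 (Num.min d3 (Num.min d4 d5))))%:C.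
    by rewrite ltcR !lt_min; apply/and5P.
  by rewrite !lecR !ge_min !lexx !orbT.
pose B (u v : C) := `|u| < e /\ `|v| < e.
have Bball u v : B u v -> ball (0 : C * C) e (u, v).
  by move=> [? ?]; split; rewrite -ball_normE /= sub0r normrN.
have Bopp u v : B u v -> B (- u) (- v) by rewrite /B !normrN.
pose nz (u v : C) := [/\ h (u, v) != 0, hu (u, v) != 0 & hn (u, v) != 0].
(* Symmetrized under [(u, v) |-> (- u, - v)], so that unitarity can be applied freely on the
   locus. *)
pose G u v := [/\ B u v, nz u v & nz (- u) (- v)].
have ballS (V : normedModType C) (x y : V) d : e <= d -> ball x e y -> ball x d y.
  by move=> ed; apply: le_ball.
have cont1 (V : normedModType C) := @differentiable_near_nonzero V.
have nz_near u v : B u v -> nz u v -> \forall x \near ((u, v) : C * C), nz x.1 x.2.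
  move=> /Bball Buv [n1 n2 n3].
  have d1 := (He1 _ (ballS _ _ _ _ E1 Buv)).1.
  have d2 := (He2 _ (ballS _ _ _ _ E2 Buv)).1.
  have d3 := (He3 _ (ballS _ _ _ _ E3 Buv)).1.
  by apply: filterS3 (cont1 _ _ _ d1 n1) (cont1 _ _ _ d2 n2) (cont1 _ _ _ d3 n3) => -[x y].
have Gopen u v : G u v -> \forall x \near ((u, v) : C * C), G x.1 x.2.
  move=> [Buv nuv noo].
  have n1 := nz_near _ _ Buv nuv.
  have n2 : \forall x \near ((u, v) : C * C), nz (- x.1) (- x.2).
    have : (- x.1, - x.2) @[x --> ((u, v) : C * C)] --> ((- u, - v) : C * C).
      have cf : x.1 @[x --> ((u, v) : C * C)] --> u by exact: cvg_fst.
      have cs : x.2 @[x --> ((u, v) : C * C)] --> v by exact: cvg_snd.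
      exact: (cvg_pair (cvgN cf) (cvgN cs)).
    by move=> /(_ _ (nz_near _ _ (Bopp _ _ Buv) noo)).
  have n3 : \forall x \near ((u, v) : C * C), B x.1 x.2.
    have : nbhs ((u, v) : C * C) (ball (0 : C * C) e).
      by apply: open_nbhs_nbhs; split; [exact: ball_open|exact: Bball].
    by apply: filterS => -[x y] []; rewrite -!ball_normE /= !sub0r !normrN.
  by apply: filterS3 n1 n2 n3 => x ? ? ?; split.
have Gopp u v : G u v -> G (- u) (- v).
  by move=> [? ? ?]; split; rewrite ?opprK //; exact: Bopp.
have Gcont u v : G u v -> r x.1 x.2 @[x --> ((u, v) : C * C)] --> r u v.
  move=> [Buv [n1 _ _] _]; have Bb := Bball _ _ Buv.
  have dh := (He1 _ (ballS _ _ _ _ E1 Bb)).1.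
  have dg := He5 _ (ballS _ _ _ _ E5 Bb).
  have ruv := (He1 _ (ballS _ _ _ _ E1 Bb)).2 n1.
  have lim : (h x)^-1 *: g x @[x --> ((u, v) : C * C)] --> r u v.
    rewrite ruv; apply: cvgZ; last exact: differentiable_continuous.
    by apply: cvgV => //; exact: differentiable_continuous.
  apply: cvg_trans lim; apply: near_eq_cvg.
  have nb : nbhs ((u, v) : C * C) (ball (0 : C * C) e).
    by apply: open_nbhs_nbhs; split => //; exact: ball_open.
  apply: filterS2 nb (cont1 _ _ _ dh n1) => x xb hx.
  by rewrite ((He1 _ (ballS _ _ _ _ E1 xb)).2 hx).
have Gunit u v : G u v -> leg21 (r (- u) (- v)) = - r u v.
  by move=> [/Bball Buv [_ n2 _] _]; exact: (He2 _ (ballS _ _ _ _ E2 Buv)).2 n2.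
(* Injectivity of [tract (r u v)] is nondegeneracy at [(- u, - v)], since unitarity absorbs the
   exchange [leg21]. *)
have Ginj u v : G u v -> forall y, tract (r u v) y = 0 -> y = 0.
  move=> Guv y ry; have [/Bball Buv [_ _ n3] _] := Gopp _ _ Guv.
  have nduv := (He3 _ (ballS _ _ _ _ E3 Buv)).2 n3.
  apply: (nondegenerate_tract nduv); rewrite Gunit //.
  by rewrite (linear_opp (tract_linearl y)) ry oppr0.
have Ggen : generically (0 : C * C) (fun x => G x.1 x.2).
  have gnz : generically (0 : C * C) (fun x => nz x.1 x.2).
    have := genericallyI (generically_nonzero hh) (genericallyI (generically_nonzero hhu) (generically_nonzero hhn)).
    by apply: genericallyS => -[x y] [? [? ?]].
  have gB : generically (0 : C * C) (fun x => B x.1 x.2).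
    apply: generically_near; apply/nbhs_ballP; exists e => // -[x y] [].
    by rewrite -!ball_normE /= !sub0r !normrN.
  have := genericallyI gB (genericallyI gnz (generically_opp gnz)).
  by apply: genericallyS => x [? [? ?]].
have Gaybe a b v w : G a v -> G b w -> G (a + b) v -> G b (w - v) ->
    G (a + b) w -> G (- a) (w - v) ->
    leg12 (r a v) *m leg13 (r b w) - leg23 (r b (w - v)) *m leg12 (r (a + b) v)
    + leg13 (r (a + b) w) *m leg23 (r (- a) (w - v)) = 0.
  move=> g1 g2 g3 g4 g5 g6.
  (* The substitution [u = a + b], [u' = - a], [v' = w - v] brings the AYBE to the arguments [a],
     [b], [v], [w]. *)
  pose x0 : C * C * C * C := (a + b, - a, v, w - v).
  pose F (x : C * C * C * C) : 'M[C]_(N * N * N) :=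
    leg12 (r (- x.1.1.2) x.1.2) *m leg13 (r (x.1.1.1 + x.1.1.2) (x.1.2 + x.2))
    - leg23 (r (x.1.1.1 + x.1.1.2) x.2) *m leg12 (r x.1.1.1 x.1.2)
    + leg13 (r x.1.1.1 (x.1.2 + x.2)) *m leg23 (r x.1.1.2 x.2).
  have f4 : {for x0, continuous (fst : C * C * C * C -> C * C * C)} by exact: cvg_fst.
  have f3 : {for x0.1, continuous (fst : C * C * C -> C * C)} by exact: cvg_fst.
  have s3 : {for x0.1, continuous (snd : C * C * C -> C)} by exact: cvg_snd.
  have f2 : {for x0.1.1, continuous (fst : C * C -> C)} by exact: cvg_fst.
  have s2 : {for x0.1.1, continuous (snd : C * C -> C)} by exact: cvg_snd.
  have f43 : {for x0, continuous (fst \o fst : C * C * C * C -> C * C)} by exact: continuous_comp.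
  have c1 : x.1.1.1 @[x --> x0] --> a + b.
    exact: (@continuous_comp _ _ _ (fst \o fst : C * C * C * C -> C * C) fst x0 f43 f2).
  have c2 : x.1.1.2 @[x --> x0] --> - a.
    exact: (@continuous_comp _ _ _ (fst \o fst : C * C * C * C -> C * C) snd x0 f43 s2).
  have c3 : x.1.2 @[x --> x0] --> v.
    exact: (@continuous_comp _ _ _ (fst : C * C * C * C -> C * C * C) snd x0 f4 s3).
  have c4 : x.2 @[x --> x0] --> w - v by exact: cvg_snd.
  have c5 : x.1.1.1 + x.1.1.2 @[x --> x0] --> b.
    have abE : a + b + - a = b by rewrite addrAC subrr add0r.
    exact: cvg_addC c1 c2 abE.
  have c6 : x.1.2 + x.2 @[x --> x0] --> w.
    have vwE : v + (w - v) = w by rewrite addrC subrK.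
    exact: cvg_addC c3 c4 vwE.
  have c7 : - x.1.1.2 @[x --> x0] --> a.
    exact: cvg_oppC c2 (opprK a).
  have rc (f k : C * C * C * C -> C) p q : G p q -> f x @[x --> x0] --> p ->
      k x @[x --> x0] --> q -> r (f x) (k x) @[x --> x0] --> r p q.
    by move=> Gpq; exact: (cvg_curry (Gcont _ _ Gpq)).
  have FC : F x @[x --> x0] --> leg12 (r a v) *m leg13 (r b w) - leg23 (r b (w - v)) *m leg12 (r (a + b) v)
      + leg13 (r (a + b) w) *m leg23 (r (- a) (w - v)).
    have r1 := rc _ _ _ _ g1 c7 c3; have r2 := rc _ _ _ _ g2 c5 c6.
    have r3 := rc _ _ _ _ g4 c5 c4; have r4 := rc _ _ _ _ g3 c1 c3.
    have r5 := rc _ _ _ _ g5 c1 c6; have r6 := rc _ _ _ _ g6 c2 c4.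
    exact: (cvg_AYBE r1 r2 r3 r4 r5 r6).
  (* The AYBE is given only generically. Were the left-hand side nonzero here, it would be nonzero
     nearby by continuity of the six tensors, against the density of the points where the equation
     holds. *)
  set L := (X in X = 0); apply/eqP/negPn/negP => L0.
  have FN0 : \forall x \near x0, F x != 0.
    have /cvgrPdist_lt /(_ `|L|) := FC; rewrite normr_gt0 => /(_ L0).
    by apply: filterS => x; apply: contraTneq => ->; rewrite subr0 ltxx.
  have x0b : ball (0 : C * C * C * C) e4 x0.
    have [[ab _] _ _] := g3; have [[ma wv] _ _] := g6; have [[_ vv] _ _] := g1.
    by do 3 (split; last by rewrite -ball_normE /= sub0r normrN; apply: lt_le_trans E4);
      rewrite -ball_normE /= sub0r normrN; apply: lt_le_trans E4.
  by have [[[[p q] s] t] /= + E] := He4 _ x0b _ FN0; rewrite /F /= E eqxx.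
have cslice t z : differentiable h (t, z) -> derivable (fun z => h (t, z)) z 1.
  exact: differentiable_slice.
have P1 : \forall t \near (0 : C)^', \forall z \near (0 : C)^', G t z.
  have gf := @generically_fubini _ _ _ (0 : C) (0 : C) G Ggen.
  by have /generically1P := genericallyS (fun t => (generically1P 0 (G t)).1) gf.
have P2 : \forall v \near (0 : C)^', \forall u \near (0 : C)^', G u v.
  have gsw := @generically_swap _ _ (0 : C) (0 : C) G Ggen.
  have gf := @generically_fubini _ _ _ (0 : C) (0 : C) (fun v u => G u v) gsw.
  by have /generically1P := genericallyS (fun v => (generically1P 0 (G^~ v)).1) gf.
have P3 : \forall v \near (0 : C)^', (r u v - u^-1 *: 1%:M) @[u --> (0 : C)^'] --> c 0%N v.
  have /generically1P := genericallyS (fun v => @power_series_cvg0 _ (c^~ v) (fun u => r u v - u^-1 *: 1%:M)) lau.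
  exact.
have P4 : \forall v \near (0 : C)^', derivable (c 0%N) v 1.
  have [g0 [h0 [hg0 hh0 c0E]]] := cm 0%N.
  have [d d0 Hd] := holomorphic_nearP hh0.1 c0E.
  have [d' /= d'0 Hd'] := (nbhs_ballP _ _).1 hg0.
  have /generically1P h0N := generically_nonzero hh0.
  have b1 : \forall v \near (0 : C)^', ball (0 : C) d v /\ ball (0 : C) d' v.
    by apply: nbhs_dnbhs; apply: filterI; exact: nbhsx_ballx.
  apply: filterS2 h0N b1 => v h0v [vd vd'].
  have cE : \forall z \near v, c 0%N z = (h0 z)^-1 *: g0 z.
    have nb : nbhs v (ball (0 : C) d).
      by apply: open_nbhs_nbhs; split => //; exact: ball_open.
    by apply: filterS2 nb (cont1 _ _ _ (Hd _ vd).1 h0v) => z /Hd[_ +] => /[apply].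
  have dd : derivable (fun z => (h0 z)^-1 *: g0 z) v 1.
    apply: derivable_mx => i j.
    have -> : (fun z => ((h0 z)^-1 *: g0 z) i j) = (fun z => (h0 z)^-1 * g0 z i j).
      by apply/funext => z; rewrite mxE.
    apply: derivable_mulC.
      by apply: derivable_invC => //; apply: diff_derivable; exact: (Hd _ vd).1.
    apply: diff_derivable.
    exact: (differentiable_comp (Hd' _ vd') (differentiable_coord (g0 v) i j)).
  apply: near_eq_derivable dd.
  by apply: filterS cE => z ->.
have P5 : \forall t \near (0 : C)^', `|t| < e.
  apply: nbhs_dnbhs; have := nbhsx_ballx (0 : C) _ e0.
  by apply: filterS => z; rewrite -ball_normE /= sub0r normrN.
have [s1 s10 H1] := (near_punctured_disc _).1 P1.
have [s2 s20 H2] := (near_punctured_disc _).1 P2.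
have [s3 s30 H3] := (near_punctured_disc _).1 P3.
have [s4 s40 H4] := (near_punctured_disc _).1 P4.
have [s5 s50 H5] := (near_punctured_disc _).1 P5.
pose s := Num.min s1 (Num.min s2 (Num.min s3 (Num.min s4 s5))).
have s0 : 0 < s by rewrite !lt_min; apply/and5P.
have Hs z : punctured_disc s z -> [/\ (\forall x \near (0 : C)^', G z x),
    (\forall u \near (0 : C)^', G u z),
    (r u z - u^-1 *: 1%:M) @[u --> (0 : C)^'] --> c 0%N z, derivable (c 0%N) z 1 & `|z| < e].
  rewrite /punctured_disc !lt_min => -[z0 /and5P[z1 z2 z3 z4 z5]].
  split; [exact: H1|exact: H2|exact: H3|exact: H4|exact: H5].
exists G, s; split => //; try by move=> z /Hs[].
move=> t /Hs[Gt _ _ _ te].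
have Bt z : ball (0 : C) e z -> ball (0 : C * C) e (t, z).
  by move=> ez; split => //=; rewrite -ball_normE /= sub0r normrN.
have nb : \forall z \near (0 : C), ball (0 : C) e z by exact: nbhsx_ballx.
apply: (@meromorphic_order _ _ _ (r t) (fun z => g (t, z)) (fun z => h (t, z))).
- move=> i j; apply: filterS nb => z /Bt zb.
  apply: (differentiable_slice (g := fun x => g x i j)).
  exact: (differentiable_comp (He5 _ (ballS _ _ _ _ E5 zb)) (differentiable_coord (g (t, z)) i j)).
- apply: filterS nb => z /Bt zb; apply: differentiable_slice.
  exact: (He1 _ (ballS _ _ _ _ E1 zb)).1.
- move=> h0; have := nbhs_dnbhs h0 => {}h0.
  have [z] := filter_ex (filterI Gt h0).
  by move=> [[_ [+ _ _] _]] /= => /eqP.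
have nb' := nbhs_dnbhs nb.
apply: filterS2 nb' Gt => z /Bt zb [_ [hz _ _] _].
exact: (He1 _ (ballS _ _ _ _ E1 zb)).2.
Qed.


End RegularLocus.

(** * The pole along v = 0 *)

Section PuncturedLimits.
Context {R : realType}.
Notation C := R[i].
Notation nc := (@Normc.normc R).

(* Inductive rather than a definition, so that unification never unfolds the limit. *)
Variant lim0 (W : normedModType C) (F : C -> W) (l : W) : Prop :=
  Lim0 of F e @[e --> (0 : C)^'] --> l.

Lemma lim0_eq (W : normedModType C) (F H : C -> W) l :
  (\forall e \near (0 : C)^', F e = H e) -> lim0 F l -> lim0 H l.
Proof. by move=> FH [Fl]; exact: Lim0 (cvg_dnbhs_eq FH Fl). Qed.

Lemma lim0_cst (W : normedModType C) (l : W) : lim0 (fun=> l) l.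
Proof. by apply: Lim0; exact: cvg_cst. Qed.

Lemma lim0_add (W : normedModType C) (F H : C -> W) k l :
  lim0 F k -> lim0 H l -> lim0 (fun e => F e + H e) (k + l).
Proof. by move=> [Fk] [Hl]; exact: Lim0 (cvgD Fk Hl). Qed.

Lemma lim0_opp (W : normedModType C) (F : C -> W) k :
  lim0 F k -> lim0 (fun e => - F e) (- k).
Proof. by move=> [Fk]; exact: Lim0 (cvgN Fk). Qed.

Lemma lim0_sub (W : normedModType C) (F H : C -> W) k l :
  lim0 F k -> lim0 H l -> lim0 (fun e => F e - H e) (k - l).
Proof. by move=> [Fk] [Hl]; exact: Lim0 (cvgB Fk Hl). Qed.

Lemma lim0_linear (m n : nat) (W : normedModType C) (L : 'M[C]_(m, n) -> W) F l :
  linear L -> lim0 F l -> lim0 (fun e => L (F e)) (L l).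
Proof. by move=> Ll [Fl]; exact: Lim0 (linear_cvg Ll Fl). Qed.

Lemma lim0_bilinear (m n p q : nat) (W : normedModType C)
    (B : 'M[C]_(m, n) -> 'M[C]_(p, q) -> W) F k H l :
  (forall y, linear (B^~ y)) -> (forall x, linear (B x)) ->
  lim0 F k -> lim0 H l -> lim0 (fun e => B (F e) (H e)) (B k l).
Proof. by move=> B1 B2 [Fk] [Hl]; exact: Lim0 (bilinear_cvg B1 B2 Fk Hl). Qed.

Lemma lim0_mul (m n p : nat) (F : C -> 'M[C]_(m, n)) k (H : C -> 'M[C]_(n, p)) l :
  lim0 F k -> lim0 H l -> lim0 (fun e => F e *m H e) (k *m l).
Proof. by move=> [Fk] [Hl]; exact: Lim0 (cvg_mulmx Fk Hl). Qed.

Lemma lim0_scale (W : normedModType C) (f : C -> C) (F : C -> W) (k : C) (l : W) :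
  lim0 f k -> lim0 F l -> lim0 (fun e => f e *: F e) (k *: l).
Proof. by move=> [fk] [Fl]; apply: Lim0; apply: cvgZ; [exact: fk|exact: Fl]. Qed.

Lemma lim0_unique (W : normedModType C) (F : C -> W) k l :
  lim0 F k -> lim0 F l -> k = l.
Proof. by move=> [Fk] [Fl]; apply: (cvg_unique _ Fk Fl); exact: norm_hausdorff. Qed.

Lemma lim0_expr n : (0 < n)%N -> lim0 (fun e : C => e ^+ n) (0 : C).
Proof. by move=> n0; exact: Lim0 (cvg_dnbhs_expr n0). Qed.

Lemma near0_scale (k : C) (P : C -> Prop) : k != 0 ->
  (\forall e \near (0 : C)^', P e) -> \forall e \near (0 : C)^', P (k * e).
Proof.
move=> k0 /near_dnbhs_normcP[d d0 H]; apply/near_dnbhs_normcP.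
have nk : 0 < nc k by rewrite normc_gt0.
exists (d / nc k); first by rewrite divr_gt0.
move=> z z0; rewrite subr0 ltr_pdivlMr // => zd; apply: H.
  by rewrite mulf_neq0.
by rewrite subr0 Normc.normcM mulrC.
Qed.

Lemma lim0_comp_scale (W : normedModType C) (k : C) (F : C -> W) l : k != 0 ->
  lim0 F l -> lim0 (fun e => F (k * e)) l.
Proof. by move=> k0 [Fl]; apply: Lim0 => P lP; exact: (near0_scale k0 (Fl P lP)). Qed.

Lemma near0_opp (P : C -> Prop) :
  (\forall e \near (0 : C)^', P e) -> \forall e \near (0 : C)^', P (- e).
Proof.
have N1 : -1 != 0 :> C by rewrite oppr_eq0 oner_eq0.
by move=> /(near0_scale N1); apply: filterS => e; rewrite mulN1r.
Qed.

Lemma lim0_comp_opp (W : normedModType C) (F : C -> W) l :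
  lim0 F l -> lim0 (fun e => F (- e)) l.
Proof. by move=> [Fl]; apply: Lim0 => P lP; exact: (near0_opp (Fl P lP)). Qed.

Lemma lim0_shift (v : C) : lim0 (fun e => v + e) v.
Proof.
apply: Lim0; apply: (@cvg_dnbhs0_lipschitz _ _ _ 1 1) => // z _ _.
by rewrite addrAC subrr add0r mul1r.
Qed.

Lemma near0_comp (V : normedModType C) (f : C -> V) (p : V) (P : V -> Prop) :
  (\forall x \near p, P x) -> lim0 f p -> \forall e \near (0 : C)^', P (f e).
Proof. by move=> nP [fp]; exact: (fp _ nP). Qed.

Lemma lim0_curry (V : normedModType C) (r : C -> C -> V) (f k : C -> C) (p q : C) :
  r x.1 x.2 @[x --> ((p, q) : C * C)] --> r p q ->
  lim0 f p -> lim0 k q -> lim0 (fun e => r (f e) (k e)) (r p q).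
Proof. by move=> rl [fp] [kq]; exact: Lim0 (cvg_curry rl fp kq). Qed.

Lemma near0_curry (P : C -> C -> Prop) (f k : C -> C) (p q : C) :
  (\forall x \near ((p, q) : C * C), P x.1 x.2) ->
  lim0 f p -> lim0 k q -> \forall e \near (0 : C)^', P (f e) (k e).
Proof.
move=> nP [fp] [kq].
have fk : (f e, k e) @[e --> (0 : C)^'] --> ((p, q) : C * C) by exact: (cvg_pair fp kq).
exact: (fk _ nP).
Qed.

Lemma near0_and (P Q : C -> Prop) : (\forall e \near (0 : C)^', P e) ->
  (\forall e \near (0 : C)^', Q e) -> \forall e \near (0 : C)^', P e /\ Q e.
Proof. by move=> p q; apply: filterS2 p q => e; split. Qed.

Lemma near0_ex (P : C -> Prop) : (\forall e \near (0 : C)^', P e) -> exists e, P e.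
Proof. by move=> p; exact: (filter_ex p). Qed.

Lemma near0_neq0 : \forall e \near (0 : C)^', e != 0.
Proof. exact: nbhs_dnbhs_neq. Qed.

End PuncturedLimits.

Section OperatorEquation.
Context {R : realType} {N : nat}.
Notation C := R[i].
Notation nc := (@Normc.normc R).
Notation A := 'M[R[i]]_N.
Notation AA := 'M[R[i]]_(N * N).
Variables (r : C -> C -> AA) (c0 : C -> AA) (G : C -> C -> Prop) (s : R).
Hypothesis rl : regular_locus r c0 G s.
Notation D := (punctured_disc s).

(** The last contraction produces [leg21 (r (- a) (w - v))], which unitarity rewrites as
    [- r a (v - w)]. *)
Lemma AYBE_operator a b v w y z : G a v -> G b w -> G (a + b) v -> G (a + b) w ->
  G b (w - v) -> G a (v - w) ->
  tract (r a v) y *m tract (r b w) z =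
  tract (r (a + b) v) (y *m tract (r b (w - v)) z) +
  tract (r (a + b) w) (tract (r a (v - w)) y *m z).
Proof.
move=> g1 g2 g3 g4 g5 g6; have g7 := locus_opp rl g6; rewrite opprB in g7.
have := locus_AYBE rl g1 g2 g3 g5 g4 g7.
move=> /(congr1 (contract23 y z)); have c23 : linear (contract23 y z) by exact: tlift3_linear.
rewrite (linear_zero c23) (linear_add c23) (linear_sub c23).
rewrite [X in X - _ + _]contract_12_13 [X in _ - X + _]contract_23_12 [X in _ + X]contract_13_23.
have := locus_unitary rl g6; rewrite opprB => ->.
rewrite (linear_opp (tract_linearl y)) mulNmx (linear_opp (tract_linearr _)).
by move=> /eqP; rewrite subr_eq0 => /eqP <-; rewrite subrKC.
Qed.

Lemma lim0_locus a v (f k : C -> C) : G a v -> lim0 f a -> lim0 k v ->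
  lim0 (fun e => r (f e) (k e)) (r a v).
Proof. by move=> /(locus_continuous rl); exact: lim0_curry. Qed.

Lemma near0_locus a v (f k : C -> C) : G a v -> lim0 f a -> lim0 k v ->
  \forall e \near (0 : C)^', G (f e) (k e).
Proof. by move=> /(locus_open rl); exact: near0_curry. Qed.

Lemma lim0_tract (F : C -> AA) (H : C -> A) k l : lim0 F k -> lim0 H l ->
  lim0 (fun e => tract (F e) (H e)) (tract k l).
Proof. exact: (lim0_bilinear (@tract_linearl C N) (@tract_linearr C N)). Qed.

(* The leading term of [AYBE_operator] at [w = v + e] as [e] tends to 0. *)
Lemma pole_relation a b (k : nat) (ta tb : AA) : D a -> D b -> D (a + b) -> (0 < k)%N ->
  lim0 (fun e => e ^+ k *: r a e) ta -> lim0 (fun e => e ^+ k *: r b e) tb ->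
  forall y z, y *m tract tb z + (-1) ^+ k *: (tract ta y *m z) = 0.
Proof.
move=> Da Db Dab k0 la lb y z.
have sa := locus_slice_v rl Da; have sb := locus_slice_v rl Db.
have sab := locus_slice_v rl Dab.
have [v [gav [gbv gabv]]] := near0_ex (near0_and sa (near0_and sb sab)).
have ve := lim0_shift v; have ca := lim0_cst a; have cb := lim0_cst b.
have cab := lim0_cst (a + b).
apply: (locus_inj rl gabv); rewrite (linear_add (tract_linearr _)).
pose F e := tract (r (a + b) v) (y *m tract (e ^+ k *: r b e) z) +
     tract (r (a + b) (v + e)) ((-1) ^+ k *: (tract ((- e) ^+ k *: r a (- e)) y *m z)).
have lr : lim0 F (tract (r (a + b) v) (y *m tract tb z) +
    tract (r (a + b) v) ((-1) ^+ k *: (tract ta y *m z))).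
  apply: (lim0_add (lim0_tract (lim0_cst _) (lim0_mul (lim0_cst _) (lim0_tract lb (lim0_cst _))))).
  apply: (lim0_tract (lim0_locus gabv cab ve)).
  apply: (lim0_scale (lim0_cst _)); apply: (lim0_mul _ (lim0_cst _)).
  exact: (lim0_tract (lim0_comp_opp la) (lim0_cst _)).
apply: (lim0_unique lr).
have ll : lim0 (fun e => e ^+ k *: (tract (r a v) y *m tract (r b (v + e)) z)) (0 : A).
  rewrite -[X in lim0 _ X](scale0r (tract (r a v) y *m tract (r b v) z)).
  apply: (lim0_scale (lim0_expr k0)); apply: (lim0_mul (lim0_cst _)).
  exact: (lim0_tract (lim0_locus gbv cb ve) (lim0_cst _)).
apply: lim0_eq ll.
have h1 := near0_and (near0_locus gbv cb ve) (near0_locus gabv cab ve).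
have h2 := near0_and sb (near0_opp sa).
apply: filterS2 h1 h2 => e [g1 g2] [g3 g4].
have w1 : v + e - v = e by rewrite addrAC subrr add0r.
have w2 : v - (v + e) = - e by rewrite opprD addrA subrr add0r.
rewrite /F (@AYBE_operator a b v (v + e)) ?w1 ?w2 //.
have scale1 (q : C) (P Q : AA) : q *: tract P (y *m tract Q z) = tract P (y *m tract (q *: Q) z).
  by rewrite (linear_scale (tract_linearl z)) -scalemxAr (linear_scale (tract_linearr P)).
have scale2 (q : C) (P Q : AA) : q ^+ k *: tract P (tract Q y *m z) =
    tract P ((-1) ^+ k *: (tract ((- q) ^+ k *: Q) y *m z)).
  rewrite (linear_scale (tract_linearl y)) -scalemxAl scalerA -exprMn mulN1r opprK.
  by rewrite (linear_scale (tract_linearr P)).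
rewrite scalerDr; congr (_ + _); [exact: scale1|exact: scale2].
Qed.

End OperatorEquation.

Section LinearInverse.
Context {K : fieldType} {m n : nat}.
Notation A := 'M[K]_(m, n).

Lemma linear_bijective (f : A -> A) : linear f -> (forall x, f x = 0 -> x = 0) ->
  exists g : A -> A, [/\ linear g, cancel f g & cancel g f].
Proof.
move=> fl f0; pose F : {linear A -> A} := HB.pack f (GRing.isLinear.Build _ _ _ _ _ fl).
have Fe x : linfun F x = f x by rewrite lfunE.
have kF : lker (linfun F) == 0%VS.
  apply/lker0P => x y; rewrite !Fe => xy; apply/eqP; rewrite -subr_eq0; apply/eqP.
  by apply: f0; rewrite (linear_sub fl) xy subrr.
exists ((linfun F)^-1)%VF; split.
- by move=> c x y; rewrite linearP.
- by move=> x; rewrite -Fe lker0_lfunK.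
- by move=> x; rewrite -Fe lker0_lfunVK.
Qed.

End LinearInverse.

Section SimplePole.
Context {R : realType} {N : nat}.
Notation C := R[i].
Notation nc := (@Normc.normc R).
Notation A := 'M[R[i]]_N.
Notation AA := 'M[R[i]]_(N * N).
Variables (r : C -> C -> AA) (c0 : C -> AA) (G : C -> C -> Prop) (s : R).
Hypothesis rl : regular_locus r c0 G s.
Notation D := (punctured_disc s).

Lemma punctured_discMn (d : R) n m (t : C) : (0 < m <= n)%N ->
  punctured_disc (d / n%:R) t -> punctured_disc d (t *+ m).
Proof.
move=> /andP[m0 mn] [t0]; rewrite ltr_pdivlMr ?ltr0n ?(leq_trans m0) // => td.
split; first by rewrite mulrn_eq0 negb_or t0 -lt0n m0.
rewrite -mulr_natr Normc.normcM; apply: le_lt_trans td.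
apply: ler_wpM2l; first exact: normc_ge0.
have -> : m%:R = (m%:R)%:C :> C by rewrite rmorph_nat.
by rewrite normc_real ger0_norm ?ler0n // ler_nat.
Qed.

(** [pole_relation] ties the leading tensors at [a] and [b] together. Were the orders different, the
    smaller one would contribute a zero leading term and the other tensor would vanish. For equal
    orders, [tract ta] is, up to sign, multiplication by [tract ta 1%:M] on either side; this matrix
    is central, hence scalar, and [(-1) ^+ ka] must be [-1]. *)
Lemma pole_constant a b ka kb (ta tb : AA) : D a -> D b -> D (a + b) -> D (a *+ 2) ->
  (0 < ka)%N -> ta != 0 -> lim0 (fun e => e ^+ ka *: r a e) ta ->
  ((0 < kb)%N -> tb != 0) -> lim0 (fun e => e ^+ kb *: r b e) tb ->
  exists2 c : C, c != 0 & [/\ (-1) ^+ ka = -1 :> C,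
    lim0 (fun e => e ^+ ka *: r a e) (c *: flip_tensor) &
    lim0 (fun e => e ^+ ka *: r b e) (c *: flip_tensor)].
Proof.
move=> Da Db Dab Daa ka0 ta0 la tb0 lb.
have raise (x : C) k k' (t : AA) : (k < k')%N -> lim0 (fun e => e ^+ k *: r x e) t ->
    lim0 (fun e => e ^+ k' *: r x e) (0 : AA).
  move=> kk lx; rewrite -(scale0r t).
  have d0 : (0 < k' - k)%N by rewrite subn_gt0.
  apply: lim0_eq (lim0_scale (lim0_expr d0) lx); apply: nearW => e.
  by rewrite scalerA -exprD subnK // ltnW.
have [kab|kba|kab] := ltngtP ka kb.
- have la0 := raise _ _ _ _ kab la; have kb0 : (0 < kb)%N by exact: leq_trans kab.
  have H := pole_relation rl Da Db Dab kb0 la0 lb.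
  case/negP: (tb0 kb0); apply/eqP; apply: tract_inj => y.
  by have := H 1%:M y; rewrite !(linear_zero (tract_linearl _)) mul0mx scaler0 addr0 mul1mx.
- have lb0 := raise _ _ _ _ kba lb.
  have H := pole_relation rl Da Db Dab ka0 la lb0.
  case/negP: ta0; apply/eqP; apply: tract_inj => y.
  have := H y 1%:M; rewrite !(linear_zero (tract_linearl _)) mulmx0 add0r mulmx1.
  by move=> /eqP; rewrite scaler_eq0 signr_eq0 => /eqP.
rewrite -{}kab in lb tb0.
have H := pole_relation rl Da Db Dab ka0 la lb.
have Dba : D (b + a) by rewrite addrC.
have H' := pole_relation rl Db Da Dba ka0 lb la.
have Daa2 : D (a + a) by rewrite -mulr2n.
have H2 := pole_relation rl Da Da Daa2 ka0 la la.
set sg : C := (-1) ^+ ka in H H' H2 *.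
have sgsg : sg * sg = 1 by rewrite /sg -expr2 sqrr_sign.
have tbE z : tract tb z = - sg *: (tract ta 1%:M *m z).
  have := H 1%:M z; rewrite mul1mx => /eqP; rewrite addr_eq0 => /eqP ->.
  by rewrite scaleNr.
have taE z : tract ta z = - sg *: (tract tb 1%:M *m z).
  have := H' 1%:M z; rewrite mul1mx => /eqP; rewrite addr_eq0 => /eqP ->.
  by rewrite scaleNr.
have taE2 z : tract ta z = - sg *: (tract ta 1%:M *m z).
  have := H2 1%:M z; rewrite mul1mx => /eqP; rewrite addr_eq0 => /eqP ->.
  by rewrite scaleNr.
have tab z : tract tb z = tract ta z by rewrite tbE [RHS]taE2.
have Xc z : tract ta 1%:M *m z = z *m tract ta 1%:M.
  have := H2 z 1%:M; rewrite [X in _ + _ *: X]mulmx1 => /eqP; rewrite addr_eq0 => /eqP ->.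
  by rewrite (taE2 z) scalerA mulrN sgsg scaleN1r opprK.
have [c cE] := central_scalar Xc.
have X0 : tract ta 1%:M != 0.
  apply: contraNneq ta0 => X0; apply/eqP; apply: tract_inj => y.
  by rewrite taE2 X0 mul0mx scaler0 (linear_zero (tract_linearl _)).
have sg1 : - sg = 1.
  have := taE2 1%:M; rewrite mulmx1 -[X in X = _]scale1r => /eqP.
  by rewrite -subr_eq0 -scalerBl scaler_eq0 (negPf X0) orbF subr_eq0 eq_sym => /eqP.
have taF : ta = c *: flip_tensor.
  apply: tract_inj => y.
  by rewrite taE2 sg1 scale1r cE mul_scalar_mx (linear_scale (tract_linearl _)) tract_flip.
have tbF : tb = c *: flip_tensor.
  by rewrite -taF; apply: tract_inj => y; rewrite tab.
exists c; first by apply: contraNneq X0 => c0'; rewrite cE c0' raddf0.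
by rewrite -taF {2}taF -tbF; split=> //; rewrite -[LHS]opprK sg1.
Qed.

(* Leading terms of [AYBE_operator] at [a = b = t], [v = e], [w = 2 e]:
   [2^-k c^2 = c^2 - 2^-k c^2]. *)
Lemma pole_exponent t k (c : C) : (0 < N)%N -> c != 0 -> D t -> D (t + t) -> (0 < k)%N ->
  (-1) ^+ k = -1 :> C -> lim0 (fun e => e ^+ k *: r t e) (c *: flip_tensor) ->
  lim0 (fun e => e ^+ k *: r (t + t) e) (c *: flip_tensor) -> k = 1%N.
Proof.
move=> N0 cN0 Dt Dtt k0 sg lt ltt.
have two0 : 2 != 0 :> C by rewrite pnatr_eq0.
pose q : C := 2 ^+ k; have q0 : q != 0 by rewrite expf_neq0.
have Tf d (y : A) : tract (d *: flip_tensor) y = d *: y.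
  by rewrite (linear_scale (tract_linearl _)) tract_flip.
have scaled x : lim0 (fun e => e ^+ k *: r x e) (c *: flip_tensor) ->
    lim0 (fun e => e ^+ k *: r x (2 * e)) (q^-1 *: (c *: flip_tensor)).
  move=> /(lim0_comp_scale two0) lx; apply: lim0_eq (lim0_scale (lim0_cst q^-1) lx).
  by apply: nearW => e; rewrite scalerA exprMn mulKf.
have opp x : lim0 (fun e => e ^+ k *: r x e) (c *: flip_tensor) ->
    lim0 (fun e => e ^+ k *: r x (- e)) (- (c *: flip_tensor)).
  move=> /lim0_comp_opp lx; rewrite -scaleN1r; apply: lim0_eq (lim0_scale (lim0_cst (-1 : C)) lx).
  by apply: nearW => e; rewrite scalerA exprNn sg mulrA mulrNN !mul1r.
pose L e := tract (e ^+ k *: r t e) 1%:M *m tract (e ^+ k *: r t (2 * e)) 1%:M.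
have ll : lim0 L (tract (c *: flip_tensor) 1%:M *m tract (q^-1 *: (c *: flip_tensor)) 1%:M).
  exact: (lim0_mul (lim0_tract lt (lim0_cst _)) (lim0_tract (scaled _ lt) (lim0_cst _))).
pose L' e := tract (e ^+ k *: r (t + t) e) (1%:M *m tract (e ^+ k *: r t e) 1%:M) +
  tract (e ^+ k *: r (t + t) (2 * e)) (tract (e ^+ k *: r t (- e)) 1%:M *m 1%:M).
have ll' : lim0 L' (tract (c *: flip_tensor) (1%:M *m tract (c *: flip_tensor) 1%:M) +
    tract (q^-1 *: (c *: flip_tensor)) (tract (- (c *: flip_tensor)) 1%:M *m 1%:M)).
  apply: lim0_add.
    exact: (lim0_tract ltt (lim0_mul (lim0_cst _) (lim0_tract lt (lim0_cst _)))).
  exact: (lim0_tract (scaled _ ltt) (lim0_mul (lim0_tract (opp _ lt) (lim0_cst _)) (lim0_cst _))).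
have st := locus_slice_v rl Dt; have stt := locus_slice_v rl Dtt.
have LL : \forall e \near (0 : C)^', L e = L' e.
  apply: filterS2 (near0_and (near0_and st stt) (near0_opp st))
    (near0_and (near0_scale two0 st) (near0_scale two0 stt)) => e [[g1 g2] g3] [g4 g5].
  have e2 : 2 * e - e = e by rewrite mulr_natl mulr2n addrK.
  have e3 : e - 2 * e = - e by rewrite -opprB e2.
  have := @AYBE_operator _ _ _ _ _ _ rl t t e (2 * e) 1%:M 1%:M g1 g4 g2 g5.
  rewrite e2 e3 => /(_ g1 g3) E.
  rewrite /L /L' !(linear_scale (tract_linearl _)) -!scalemxAl -!scalemxAr E.
  by rewrite !(linear_scale (tract_linearr _)) -!scalerDr.
have := lim0_unique (lim0_eq LL ll) ll'.
rewrite !mulmx1 !mul1mx scalerA -scaleNr !Tf -!scalemxAl mul1mx !scalerA -scalerDl.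
move=> /eqP; rewrite -subr_eq0 -scalerBl scaler_eq0 => /orP[|]; last first.
  by rewrite -mxrank_eq0 mxrank1 eqn0Ngt N0.
rewrite (_ : _ - _ = c * c * q^-1 * (2 - q)); last by field.
rewrite !mulf_eq0 (negPf cN0) /= invr_eq0 (negPf q0) /= subr_eq0 /q => /eqP.
rewrite -natrX -[X in X%:R = _]expn1 => /eqP; rewrite eqr_nat eqn_exp2l // => /eqP.
by [].
Qed.

End SimplePole.

Section OperatorLimits.
Context {R : realType} {N : nat}.
Notation C := R[i].
Notation nc := (@Normc.normc R).
Notation A := 'M[R[i]]_N.
Notation AA := 'M[R[i]]_(N * N).
Variables (r : C -> C -> AA) (c0 : C -> AA) (G : C -> C -> Prop) (s : R).
Hypothesis rl : regular_locus r c0 G s.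
Notation D := (punctured_disc s).

Lemma near0_disc v (f : C -> C) : D v -> lim0 f v -> \forall e \near (0 : C)^', D (f e).
Proof.
move=> [v0 vs] fv; pose d := Num.min (nc v) (s - nc v).
have d0 : 0 < d by rewrite lt_min normc_gt0 v0 subr_gt0.
have nv : \forall z \near v, D z.
  apply/near_normcP; exists d => // z; rewrite lt_min => /andP[z1 z2]; split.
    by apply: contraTneq z1 => ->; rewrite sub0r normcN ltxx.
  by rewrite -(subrK v z); apply: le_lt_trans (ler_normcD _ _) _; rewrite -ltrBrDr.
exact: near0_comp nv fv.
Qed.

Lemma lim0_residue v (f : C -> C) : D v -> lim0 f v -> lim0 (fun e => c0 (f e)) (c0 v).
Proof.
move=> /(locus_derivable rl) dv [fv]; apply: Lim0.
have cv : {for v, continuous c0}.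
  by apply: differentiable_continuous; apply/derivable1_diffP; exact: dv.
exact: (cvg_comp _ _ fv cv).
Qed.

Lemma lim0_traceless v y : D v -> \tr y = 0 ->
  lim0 (fun u => tract (r u v) y) (tract (c0 v) y).
Proof.
move=> Dv y0; have rc : lim0 (fun u => r u v - u^-1 *: 1%:M) (c0 v).
  by apply: Lim0; exact: (locus_residue rl Dv).
apply: lim0_eq (lim0_tract rc (lim0_cst y)); apply: nearW => u.
by rewrite (linear_sub (tract_linearl _)) (linear_scale (tract_linearl _)) tract1 y0
  scale0r scaler0 subr0.
Qed.

(** This is [AYBE_operator] at [(a, b) = (u, t)] as [u] tends to 0; on a traceless [y] the pole
    [u^-1] contributes nothing. *)
Lemma residue_operator t v w y z : \tr y = 0 -> D v -> D (v - w) -> G t v -> G t w ->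
  G t (w - v) -> tract (c0 v) y *m tract (r t w) z =
  tract (r t v) (y *m tract (r t (w - v)) z) + tract (r t w) (tract (c0 (v - w)) y *m z).
Proof.
move=> y0 Dv Dvw gv gw gvw.
have lt : lim0 (fun u => u + t) t.
  by apply: lim0_eq (lim0_shift t); apply: nearW => u; rewrite addrC.
have cv := lim0_cst v; have cw := lim0_cst w.
have ll : lim0 (fun u => tract (r u v) y *m tract (r t w) z)
    (tract (c0 v) y *m tract (r t w) z).
  exact: (lim0_mul (lim0_traceless Dv y0) (lim0_cst _)).
apply: (lim0_unique ll).
have lr : lim0 (fun u => tract (r (u + t) v) (y *m tract (r t (w - v)) z) +
    tract (r (u + t) w) (tract (r u (v - w)) y *m z))
  (tract (r t v) (y *m tract (r t (w - v)) z) + tract (r t w) (tract (c0 (v - w)) y *m z)).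
  apply: (lim0_add (lim0_tract (lim0_locus rl gv lt cv) (lim0_cst _))).
  exact: (lim0_tract (lim0_locus rl gw lt cw) (lim0_mul (lim0_traceless Dvw y0) (lim0_cst _))).
apply: lim0_eq lr.
have h1 := near0_and (locus_slice_u rl Dv) (locus_slice_u rl Dvw).
have h2 := near0_and (near0_locus rl gv lt cv) (near0_locus rl gw lt cw).
apply: filterS2 h1 h2 => u [g1 g2] [g3 g4].
by rewrite -(AYBE_operator rl).
Qed.

(** In the absence of a pole along [v = 0] one may let [w] tend to [v] in [AYBE_operator]; letting
    [v] tend to 0 as well gives [pole_free_limit]. *)
Lemma pole_free_operator a b v (Sa Sb : AA) y z : D a -> D b ->
  lim0 (r a) Sa -> lim0 (r b) Sb -> G a v -> G b v -> G (a + b) v ->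
  tract (r a v) y *m tract (r b v) z = tract (r (a + b) v) (y *m tract Sb z + tract Sa y *m z).
Proof.
move=> Da Db la lb ga gb gab.
have ve := lim0_shift v; have cb := lim0_cst b; have cab := lim0_cst (a + b).
have ll : lim0 (fun e => tract (r a v) y *m tract (r b (v + e)) z)
    (tract (r a v) y *m tract (r b v) z).
  exact: (lim0_mul (lim0_cst _) (lim0_tract (lim0_locus rl gb cb ve) (lim0_cst _))).
apply: (lim0_unique ll).
have lr : lim0 (fun e => tract (r (a + b) v) (y *m tract (r b e) z) +
    tract (r (a + b) (v + e)) (tract (r a (- e)) y *m z))
  (tract (r (a + b) v) (y *m tract Sb z + tract Sa y *m z)).
  rewrite (linear_add (tract_linearr _)).
  apply: (lim0_add (lim0_tract (lim0_cst _) (lim0_mul (lim0_cst _) (lim0_tract lb (lim0_cst _))))).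
  apply: (lim0_tract (lim0_locus rl gab cab ve) (lim0_mul _ (lim0_cst _))).
  exact: (lim0_tract (lim0_comp_opp la) (lim0_cst _)).
apply: lim0_eq lr.
have h1 := near0_and (near0_locus rl gb cb ve) (near0_locus rl gab cab ve).
have h2 := near0_and (locus_slice_v rl Db) (near0_opp (locus_slice_v rl Da)).
apply: filterS2 h1 h2 => e [g1 g2] [g3 g4].
have w1 : v + e - v = e by rewrite addrAC subrr add0r.
have w2 : v - (v + e) = - e by rewrite opprD addrA subrr add0r.
by rewrite (@AYBE_operator _ _ _ _ _ _ rl a b v (v + e)) ?w1 ?w2.
Qed.

Lemma pole_free_limit a b (Sa Sb Sab : AA) y z : D a -> D b -> D (a + b) ->
  lim0 (r a) Sa -> lim0 (r b) Sb -> lim0 (r (a + b)) Sab ->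
  tract Sa y *m tract Sb z = tract Sab (y *m tract Sb z + tract Sa y *m z).
Proof.
move=> Da Db Dab la lb lab.
apply: (lim0_unique (lim0_mul (lim0_tract la (lim0_cst y)) (lim0_tract lb (lim0_cst z)))).
apply: lim0_eq (lim0_tract lab (lim0_cst _)).
have h1 := near0_and (locus_slice_v rl Da) (locus_slice_v rl Db).
apply: filterS2 h1 (locus_slice_v rl Dab) => e [g1 g2] g3.
by rewrite (@pole_free_operator a b e Sa Sb).
Qed.

(** [x] is the limit of [tract (c0 e) y] as [e] tends to 0. It exists because [residue_operator]
    expresses the product of this matrix with [tract (r t w) z] through convergent terms, and [z]
    can be chosen to make the second factor 1. *)
Lemma pole_free_residue t (S : AA) y : D t -> lim0 (r t) S -> \tr y = 0 ->
  exists x, forall z, x *m tract S z = tract S (y *m tract S z + x *m z).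
Proof.
move=> Dt lS y0; have st := locus_slice_v rl Dt.
have Dnear : \forall e \near (0 : C)^', D e.
  by apply/near_punctured_disc; exists s => //; exact: (locus_gt0 rl).
have key w : G t w -> D w -> forall z, lim0 (fun e => tract (c0 e) y *m tract (r t w) z)
    (tract S (y *m tract (r t w) z) + tract (r t w) (tract (c0 (- w)) y *m z)).
  move=> gw Dw z.
  have lw : lim0 (fun e => w - e) w := lim0_comp_opp (lim0_shift w).
  have lNw : lim0 (fun e => e - w) (- w).
    by apply: lim0_eq (lim0_shift (- w)); apply: nearW => e; rewrite addrC.
  have DNw : D (- w) by split; [rewrite oppr_eq0; case: Dw|rewrite normcN; case: Dw].
  have ct := lim0_cst t.
  have lr : lim0 (fun e => tract (r t e) (y *m tract (r t (w - e)) z) +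
     tract (r t w) (tract (c0 (e - w)) y *m z))
    (tract S (y *m tract (r t w) z) + tract (r t w) (tract (c0 (- w)) y *m z)).
    apply: lim0_add.
      apply: (lim0_tract lS (lim0_mul (lim0_cst _) _)).
      exact: (lim0_tract (lim0_locus rl gw ct lw) (lim0_cst _)).
    apply: (lim0_tract (lim0_cst _) (lim0_mul _ (lim0_cst _))).
    exact: (lim0_tract (lim0_residue DNw lNw) (lim0_cst _)).
  apply: lim0_eq lr.
  have h1 := near0_and Dnear (near0_disc DNw lNw).
  have h2 := near0_and st (near0_locus rl gw ct lw).
  apply: filterS2 h1 h2 => e [d1 d2] [g1 g2].
  by rewrite -residue_operator.
have [w [gw Dw]] := near0_ex (near0_and st Dnear).
have [g [gl _ Tg]] := linear_bijective (tract_linearr (r t w)) (locus_inj rl gw).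
have := key w gw Dw (g 1%:M); rewrite Tg.
set x := (X in lim0 _ X) => lx; exists x.
have {}lx : lim0 (fun e => tract (c0 e) y) x.
  by apply: lim0_eq lx; apply: nearW => e; rewrite mulmx1.
move=> z.
apply: (lim0_unique (lim0_mul (lim0_cst x) (lim0_tract lS (lim0_cst z)))).
have lr : lim0 (fun e => tract S (y *m tract (r t e) z) + tract (r t e) (tract (c0 (- e)) y *m z))
    (tract S (y *m tract S z + x *m z)).
  rewrite (linear_add (tract_linearr _)); apply: lim0_add.
    exact: (lim0_tract (lim0_cst _) (lim0_mul (lim0_cst _) (lim0_tract lS (lim0_cst _)))).
  exact: (lim0_tract lS (lim0_mul (lim0_comp_opp lx) (lim0_cst _))).
apply: lim0_eq lr; apply: filterS2 st Dnear => e ge De.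
by rewrite (lim0_unique (key e ge De z) (lim0_mul lx (lim0_cst _))).
Qed.

End OperatorLimits.

(** * Exclusion of the pole-free case *)

Section PoleExistence.
Context {R : realType} {N : nat}.
Notation C := R[i].
Notation nc := (@Normc.normc R).
Notation A := 'M[R[i]]_N.
Notation AA := 'M[R[i]]_(N * N).
Variables (r : C -> C -> AA) (c0 : C -> AA) (G : C -> C -> Prop) (s : R).
Hypothesis rl : regular_locus r c0 G s.
Hypothesis N1 : (1 < N)%N.
Notation D := (punctured_disc s).

Let N0 : N%:R != 0 :> C. Proof. by rewrite pnatr_eq0 -lt0n ltnW. Qed.

Lemma exists_traceless : exists2 y : A, \tr y = 0 & y != 0.
Proof.
pose i : 'I_N := Ordinal (ltnW N1); pose j : 'I_N := Ordinal N1.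
exists (delta_mx i j).
  by rewrite /mxtrace big1 // => k _; rewrite mxE; case: eqP => //= ->.
by apply/eqP => /matrixP/(_ i j); rewrite !mxE !eqxx => /eqP; rewrite oner_eq0.
Qed.

Lemma traceless_scalar (x : A) : (forall y, \tr y = 0 -> \tr (x *m y) = 0) ->
  x = (\tr x / N%:R)%:M.
Proof.
move=> x0; apply/eqP; rewrite -subr_eq0; apply/eqP; rewrite -/(pr x).
apply: trace_pairing => m; rewrite -[RHS](x0 (pr m)); last exact: trace_pr.
rewrite /pr mulmxBl mulmxBr mul_scalar_mx mul_mx_scalar !mxtraceD !linearN /= !mxtraceZ.
by rewrite mulrAC [\tr x * _]mulrC mulrAC.
Qed.

(* The two-sided ideal generated by a nonzero [X] is the whole matrix algebra. *)
Lemma linear_ideal (W : lmodType C) (f : A -> W) (X : A) : linear f -> X != 0 ->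
  (forall p q, f (p *m X *m q) = 0) -> forall x, f x = 0.
Proof.
move=> fl X0 fX x.
have [k [l Xkl]] : exists k l, X k l != 0.
  apply: contra_neqP X0 => H; apply/matrixP => k l; rewrite mxE.
  by apply: contra_notP H => /eqP H; exists k, l.
rewrite (linear_delta_sum x fl) big1 // => i _; rewrite big1 // => j _.
have E : delta_mx i j = (X k l)^-1 *: (delta_mx i k *m X *m delta_mx l j).
  apply/matrixP => p q; rewrite !mxE (bigD1 l) //= big1 ?addr0 => [|m ml]; last first.
    by rewrite [delta_mx l j _ _]mxE (negPf ml) mulr0.
  rewrite !mxE (bigD1 k) //= big1 ?addr0 => [|m mk]; last by rewrite !mxE (negPf mk) andbF mul0r.
  rewrite !mxE !eqxx andbT andTb; case: (p == i); case: (q == j);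
    by rewrite ?mul1r ?mul0r ?mulr1 ?mulr0 // mulVf.
by rewrite E (linear_scale fl) fX !scaler0.
Qed.

Section PoleFree.
Variables (t : C) (S : nat -> AA).
Hypothesis Dt : forall m, (0 < m <= 14)%N -> D (t *+ m).
Hypothesis lS : forall m, (0 < m <= 14)%N -> lim0 (r (t *+ m)) (S m).

(** A common second argument for all multiples of [t] in use. The largest that occurs below is
    [9 t], from [(1 + (m + 1)) + (2 + (m + 1))] with [m = 2], so the bound 14 suffices. *)
Let slice : exists v, forall m, (0 < m <= 14)%N -> G (t *+ m) v.
Proof.
apply: near0_ex.
have H k : (k <= 14)%N -> \forall v \near (0 : C)^', forall m, (0 < m <= k)%N -> G (t *+ m) v.
  elim: k => [|k IH] k14.
    by apply: nearW => v m /andP[m0]; rewrite leqn0 => /eqP m00; rewrite m00 in m0.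
  have k1 : (0 < k.+1 <= 14)%N by [].
  apply: filterS2 (IH (ltnW k14)) (locus_slice_v rl (Dt k1)) => v h1 h2 m /andP[m0].
  by rewrite leq_eqVlt => /orP[/eqP ->|]; [exact: h2|rewrite ltnS => mk; apply: h1; rewrite m0].
exact: H.
Qed.

(** If [S m] killed a nonzero [x], with image [X] under [tract (r (t *+ m) v)], then [pf] would
    write each [p *m X *m q] as the image of a matrix killed by [S (a + (m + b))]. The ideal
    generated by [X] is everything, so this limit operator would be 0. Two such vanishing limits
    inserted in [pf] give [1 = 0]. *)
Lemma pole_free_injective m : (0 < m <= 2)%N -> forall x, tract (S m) x = 0 -> x = 0.
Proof.
move=> m2 x Sx; apply: contraPP isT => /eqP x0 _.
have [v gv] := slice.
have pf a b y z : (0 < a)%N -> (0 < b)%N -> (a + b <= 14)%N ->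
    tract (r (t *+ a) v) y *m tract (r (t *+ b) v) z =
    tract (r (t *+ (a + b)) v) (y *m tract (S b) z + tract (S a) y *m z).
  move=> a0 b0 ab; have a14 : (0 < a <= 14)%N by rewrite a0 (leq_trans _ ab) ?leq_addr.
  have b14 : (0 < b <= 14)%N by rewrite b0 (leq_trans _ ab) ?leq_addl.
  rewrite mulrnDr; apply: (pole_free_operator rl y z (Dt a14) (Dt b14) (lS a14) (lS b14));
    rewrite -?mulrnDr; apply: gv => //.
  by rewrite addn_gt0 a0.
have pl a b y z : (0 < a)%N -> (0 < b)%N -> (a + b <= 14)%N ->
    tract (S a) y *m tract (S b) z =
    tract (S (a + b)%N) (y *m tract (S b) z + tract (S a) y *m z).
  move=> a0 b0 ab; have a14 : (0 < a <= 14)%N by rewrite a0 (leq_trans _ ab) ?leq_addr.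
  have b14 : (0 < b <= 14)%N by rewrite b0 (leq_trans _ ab) ?leq_addl.
  have ab14 : (0 < a + b <= 14)%N by rewrite ab addn_gt0 a0.
  by apply: (pole_free_limit rl y z (Dt a14) (Dt b14) _ (lS a14) (lS b14)); rewrite -mulrnDr; auto.
have m0 : (0 < m)%N by case/andP: m2.
have m14 : (0 < m <= 14)%N by case/andP: m2 => -> /leq_trans ->.
pose X := tract (r (t *+ m) v) x.
have X0 : X != 0 by apply: contra_neq x0; exact: (locus_inj rl (gv _ m14)).
have inv k : (0 < k <= 14)%N -> exists g, [/\ linear g, cancel (tract (r (t *+ k) v)) g &
    cancel g (tract (r (t *+ k) v))].
  by move=> k14; exact: linear_bijective (tract_linearr _) (locus_inj rl (gv _ k14)).
have zero a b : (0 < a)%N -> (0 < b)%N -> (a + (m + b) <= 14)%N ->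
    forall y, tract (S (a + (m + b))%N) y = 0.
  move=> a0 b0 ab y.
  have b14 : (m + b <= 14)%N by rewrite (leq_trans _ ab) ?leq_addl.
  have mb0 : (0 < m + b)%N by rewrite addn_gt0 m0.
  have ba : (0 < a <= 14)%N by rewrite a0 (leq_trans _ ab) // leq_addr.
  have bb : (0 < b <= 14)%N by rewrite b0 (leq_trans _ b14) // leq_addl.
  have mab : (0 < a + (m + b) <= 14)%N by rewrite ab addn_gt0 a0.
  have [ga [_ _ Ta]] := inv a ba; have [gb [_ _ Tb]] := inv b bb.
  have [g [gl gK Tg]] := inv _ mab.
  have fl : linear (fun w => tract (S (a + (m + b))%N) (g w)).
    by move=> c u w; rewrite gl tract_linearr.
  rewrite -[y]gK; apply: (linear_ideal fl X0) => p q.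
  have [z zE] : exists z, z = x *m tract (S b) (gb q) by eexists.
  have add0 (U V : A) : U + 0 *m V = U by rewrite mul0mx addr0.
  have mul0 (U V : A) : U *m 0 + V = V by rewrite mulmx0 add0r.
  have Sz : tract (S (m + b)%N) z = 0.
    have := pl m b x (gb q) m0 b0 b14.
    by rewrite Sx [X in _ = tract _ X]add0 -zE [X in X = _]mul0mx => <-.
  have Xq : X *m q = tract (r (t *+ (m + b)) v) z.
    have := pf m b x (gb q) m0 b0 b14.
    by rewrite Tb Sx [X in _ = tract _ X]add0 -zE.
  have -> : p *m X *m q = tract (r (t *+ (a + (m + b))) v) (tract (S a) (ga p) *m z).
    have := pf a (m + b)%N (ga p) z a0 mb0 ab.
    by rewrite Ta Sz [X in _ = tract _ X]mul0 -Xq mulmxA.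
  rewrite gK; have := pl a (m + b)%N (ga p) z a0 mb0 ab.
  by rewrite Sz [X in _ = tract _ X]mul0 [X in X = _]mulmx0 => <-.
have m5 : (m <= 2)%N by case/andP: m2.
have Z1 := zero 1%N 1%N isT isT; have Z2 := zero 2%N 1%N isT isT.
have e1 : (1 + (m + 1) <= 14)%N by case: (m) m5 => [|[|[|//]]].
have e2 : (2 + (m + 1) <= 14)%N by case: (m) m5 => [|[|[|//]]].
have e3 : (1 + (m + 1) + (2 + (m + 1)) <= 14)%N.
  by case: (m) m5 => [|[|[|//]]].
have {e1}Z1 := Z1 e1; have {e2}Z2 := Z2 e2.
have p1 : (0 < 1 + (m + 1) <= 14)%N by rewrite (leq_trans _ e3) ?leq_addr.
have p2 : (0 < 2 + (m + 1) <= 14)%N by rewrite (leq_trans _ e3) ?leq_addl.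
have [g1 [_ _ T1]] := inv _ p1; have [g2 [_ _ T2]] := inv _ p2.
have := pf (1 + (m + 1))%N (2 + (m + 1))%N (g1 1%:M) (g2 1%:M) isT isT e3.
rewrite T1 T2 Z1 Z2 mulmx0 mul0mx addr0 (linear_zero (tract_linearr _)) mulmx1.
by move=> /eqP; rewrite -mxrank_eq0 mxrank1 eqn0Ngt ltnW.
Qed.

(* With [d] the inverse of the operator [S 1], [e = d - d 1] is a derivation, hence inner,
   and every traceless matrix is in its range. *)
Lemma pole_free_absurd : False.
Proof.
have d1 := Dt (isT : (0 < 1 <= 14)%N); have d2 := Dt (isT : (0 < 2 <= 14)%N).
have l1 := lS (isT : (0 < 1 <= 14)%N); have l2 := lS (isT : (0 < 2 <= 14)%N).
have i1 := pole_free_injective (isT : (0 < 1 <= 2)%N).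
have i2 := pole_free_injective (isT : (0 < 2 <= 2)%N).
have pl y z : tract (S 1) y *m tract (S 1) z =
    tract (S 2) (y *m tract (S 1) z + tract (S 1) y *m z).
  by apply: (pole_free_limit rl y z d1 d1 _ l1 l1); rewrite mulr1n -mulr2n.
have [d [dl dK Kd]] := linear_bijective (tract_linearr (S 1)) i1.
have [d' [dl' dK' Kd']] := linear_bijective (tract_linearr (S 2)) i2.
have D2 p q : d' (p *m q) = d p *m q + p *m d q.
  by rewrite -{1}[p]Kd -{1}[q]Kd pl dK' !Kd addrC.
have dc q : d 1%:M *m q = q *m d 1%:M.
  have h1 := D2 1%:M q; have h2 := D2 q 1%:M.
  move: h2; rewrite !mulmx1 -[in d' q](mul1mx q) h1 mul1mx [RHS]addrC => /addIr.
  by [].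
pose e p := d p - d 1%:M *m p.
have el : linear e.
  move=> c x y; rewrite /e dl mulmx_linearr scalerBr opprD addrACA //.
have eM x y : e (x *m y) = e x *m y + x *m e y.
  have h := D2 1%:M (x *m y); rewrite mul1mx D2 mul1mx in h.
  rewrite /e mulmxBl mulmxBr !mulmxA -dc.
  have -> : d (x *m y) = d x *m y + x *m d y - d 1%:M *m (x *m y) by rewrite h addrC addKr.
  rewrite !mulmxA; move: (d x *m y) (x *m d y) (d 1%:M *m x *m y) => u v w.
  by apply/matrixP => i j; rewrite !mxE; ring.
have [x xE] := derivation_inner el eM.
have [y y0 yN0] := exists_traceless.
have res w : \tr w = 0 -> exists u, e u = w.
  move=> w0; have [u uE] := pole_free_residue rl d1 l1 w0.
  exists u; have := uE (d 1%:M); rewrite !Kd mulmx1 => /(congr1 d).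
  by rewrite dK mulmx1 /e -dc => ->; rewrite addrK.
(* A traceless [w] is now a commutator [[x, u]], and [x *m [x, u]] has trace 0. So [x] is orthogonal
   to all traceless matrices, hence scalar, and [e] vanishes although its range contains the nonzero
   [y]. *)
have x0 w : \tr w = 0 -> \tr (x *m w) = 0.
  by move=> /res[u <-]; rewrite xE mulmxBr linearB /= [X in X - _]mxtrace_mulC -mulmxA subrr.
have [u] := res y y0; rewrite xE (traceless_scalar x0) mul_scalar_mx mul_mx_scalar subrr.
by move=> yE; rewrite -yE eqxx in yN0.
Qed.

End PoleFree.

(** If all small [t] were pole-free, the multiples of one of them would contradict
    [pole_free_absurd]. A single [t0] with a pole suffices: [pole_constant] with [a = t0] transports
    order and residue to every [t] with [nc t < nc t0]. *)
Lemma simple_pole : exists (c : C) (d : R), [/\ c != 0, 0 < d, d <= s &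
  forall t, punctured_disc d t -> lim0 (fun e => e *: r t e) (c *: flip_tensor)].
Proof.
have s0 := locus_gt0 rl.
pose b := s / 14%:R; have b0 : 0 < b by rewrite divr_gt0.
have DM t m : punctured_disc b t -> (0 < m <= 14)%N -> D (t *+ m).
  by move=> Dt m14; exact: (punctured_discMn m14 Dt).
have order x : D x -> exists k l, lim0 (fun e => e ^+ k *: r x e) l /\ ((0 < k)%N -> l != 0).
  by move=> Dx; have [k [l [lx ln]]] := locus_order rl Dx; exists k, l; split=> //; exact: Lim0 lx.
have half (d : R) : 0 < d -> punctured_disc d (d / 2)%:C.
  move=> d0; split; first by rewrite -normc_gt0 normc_real gtr0_norm divr_gt0.
  by rewrite normc_real ger0_norm ?divr_ge0 ?ltW // ltr_pdivrMr // ltr_pMr // ltr1n.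
have [t0 [Dt0 [k [l [k0 l0 lt]]]]] : exists t, punctured_disc b t /\
    exists k l, [/\ (0 < k)%N, l != 0 & lim0 (fun e => e ^+ k *: r t e) l].
  apply: contrapT => H; pose t : C := (b / 14%:R / 2)%:C.
  have bt : punctured_disc (b / 14%:R) t by apply: half; rewrite divr_gt0.
  have DtM m : (0 < m <= 14)%N -> punctured_disc b (t *+ m).
    by move=> m14; exact: (punctured_discMn m14 bt).
  have b14 : b < s by rewrite ltr_pdivrMr // ltr_pMr // ltr1n.
  have bs x : punctured_disc b x -> D x by move=> [x0 xb]; split=> //; exact: lt_trans b14.
  have limits m : exists S, (0 < m <= 14)%N -> lim0 (r (t *+ m)) S.
    case: (boolP (0 < m <= 14)%N) => m14; last by exists 0.
    have [[|k] [l [lx ln]]] := order _ (bs _ (DtM m m14)).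
      by exists l => _; apply: lim0_eq lx; apply: nearW => e; rewrite expr0 scale1r.
    by case: H; exists (t *+ m); split; [exact: DtM|exists k.+1, l; split=> //; exact: ln].
  have [S lS] := choice limits.
  exact: (pole_free_absurd (fun m m14 => bs _ (DtM m m14)) lS).
(* For [nc x < nc t0] the sum [t0 + x] is nonzero, as [pole_constant] requires. *)
pose d := nc t0; have d0 : 0 < d by rewrite normc_gt0; case: Dt0.
have Ds1 := DM _ 1%N Dt0 isT; have Ds2 := DM _ 2%N Dt0 isT; rewrite mulr1n in Ds1.
have ds : d <= s by rewrite ltW //; case: Ds1.
have key x : punctured_disc d x -> exists2 c : C, c != 0 & [/\ (-1) ^+ k = -1 :> C,
    lim0 (fun e => e ^+ k *: r t0 e) (c *: flip_tensor) &
    lim0 (fun e => e ^+ k *: r x e) (c *: flip_tensor)].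
  move=> [x0 xd]; have Dx : D x by split=> //; exact: lt_le_trans ds.
  have Dtx : D (t0 + x).
    split; first by apply: contraTneq xd => /eqP; rewrite addr_eq0 /d => /eqP ->; rewrite normcN ltxx.
    apply: le_lt_trans (ler_normcD _ _) _; case: Ds2 => _.
    have -> : t0 *+ 2 = t0 * (2 : R)%:C by rewrite rmorph_nat mulr_natr.
    rewrite Normc.normcM -/d normc_real ger0_norm //.
    by move: xd; lra.
  have [kx [lx [Lx lnx]]] := order x Dx.
  exact: (pole_constant rl Ds1 Dx Dtx Ds2 k0 l0 lt lnx Lx).
(* Small enough for both [t1] and [t1 + t1] to lie in the disc, since [pole_exponent] compares the
   two. *)
pose t1 : C := (d / 2 / 2)%:C; have d20 : 0 < d / 2 by rewrite divr_gt0.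
have Dd1 : punctured_disc d t1.
  by have [h1 h2] := half _ d20; split=> //; apply: lt_trans h2 _; lra.
have Dd2 : punctured_disc d (t1 + t1).
  have -> : t1 + t1 = (d / 2)%:C by rewrite /t1 -rmorphD /= -splitr.
  exact: half.
have [c cN0 [sg lc lt1]] := key t1 Dd1.
have uniq x : punctured_disc d x -> lim0 (fun e => e ^+ k *: r x e) (c *: flip_tensor).
  by move=> /key[c' _ [_ lc' lx]]; rewrite (lim0_unique lc lc').
have dD x : punctured_disc d x -> D x by move=> [x0 xd]; split=> //; exact: lt_le_trans ds.
have k1 : k = 1%N.
  exact: (pole_exponent rl (ltnW N1) cN0 (dD _ Dd1) (dD _ Dd2) k0 sg lt1 (uniq _ Dd2)).
exists c, d; split=> // t Dt; apply: lim0_eq (uniq t Dt).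
by apply: nearW => e; rewrite k1 expr1.
Qed.

End PoleExistence.

(** * The residue at u = 0 *)

Section ZeroDerivative.
Context {R : realType}.
Notation C := R[i].
Notation nc := (@Normc.normc R).
Local Notation Re := complex.Re.
Local Notation Im := complex.Im.

Lemma derivative_zero_Re (f : C -> C) (a b : C) :
  (forall t : R, 0 <= t <= 1 -> is_derive (segment_path a b t) (1 : C) f 0) ->
  Re (f a) = Re (f b).
Proof.
move=> df; have [->//|ab] := eqVneq a b.
pose g (t : R) := Re (f (segment_path a b t)).
have dg (t : R) : 0 <= t <= 1 -> is_derive t (1 : R) g 0.
  move=> /df[dz vz]; set z := segment_path a b t in dz vz.
  have lz : h^-1 *: (f (h *: 1 + z) - f z) @[h --> (0 : C)^'] --> (0 : C).
    have dz' : h^-1 *: (f (h *: 1 + z) - f z) @[h --> (0 : C)^'] --> 'D_1 f z by exact: dz.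
    by rewrite vz in dz'.
  suff lg : h^-1 *: (g (h *: 1 + t) - g t) @[h --> (0 : R)^'] --> (0 : R).
    have d1 : derivable (g : R -> R^o) t 1 by exact: (cvgP _ lg).
    have d2 : 'D_1 (g : R -> R^o) t = 0 by exact: (cvg_lim (@norm_hausdorff _ _) lg).
    exact: (DeriveDef d1 d2).
  have nba : 0 < nc (b - a) by rewrite normc_gt0 subr_eq0 eq_sym.
  apply/(@cvgrPdist_lt _ _ _ (0^')) => e e0.
  have eC : 0 < (e / nc (b - a))%:C :> C by rewrite ltcR divr_gt0.
  have /(@cvgrPdist_lt _ _ _ (0^')) /(_ _ eC) /near_dnbhs_normcP[d d0 H] := lz.
  apply/nbhs_ballP; exists (d / nc (b - a)); first by rewrite /= divr_gt0.
  move=> h; rewrite /ball /= sub0r normrN ltr_pdivlMr // => hd h0.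
  pose k : C := h%:C * (b - a).
  have k0 : k != 0 by apply: mulf_neq0; [rewrite -normc_gt0 normc_real normr_gt0|rewrite subr_eq0 eq_sym].
  have nk : nc k = `|h| * nc (b - a) by rewrite Normc.normcM normc_real.
  have := H k k0; rewrite subr0 nk => /(_ hd); rewrite sub0r normrN normrcE ltcR.
  rewrite -[k *: 1]/(k * 1) mulr1 Normc.normcM Normc.normcV nk => Hk.
  have gE : g (h *: 1 + t) = Re (f (k + z)).
    congr (Re (f _)); rewrite /k /z /segment_path -[h *: 1]/(h * 1) mulr1 rmorphD /=; ring.
  rewrite sub0r normrN gE -[_ *: _]/(_ * _) normrM normfV.
  have hn : 0 < `|h| by rewrite normr_gt0.
  have fz : `|Re (f (k + z)) - g t| <= nc (f (k + z) - f z).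
    by apply: le_trans (ler_Re_normc _); rewrite raddfB.
  rewrite mulrC ltr_pdivrMr //; apply: le_lt_trans fz _.
  rewrite mulrC ltr_pdivrMr ?mulr_gt0 // in Hk.
  by apply: lt_le_trans Hk _; rewrite mulrCA divfK ?gt_eqF // mulrC.
have cg : {within `[0, 1], continuous g}.
  apply: derivable_within_continuous => t; rewrite in_itv /= => t01.
  by have [] := dg t t01.
have dg01 (t : R) : t \in `]0, 1[ -> is_derive t (1 : R) g 0.
  by rewrite in_itv /= => /andP[t0 t1]; apply: dg; rewrite !ltW.
have [c _] := @MVT R g (fun=> 0) 0 1 ltr01 dg01 cg.
rewrite mul0r => /eqP; rewrite subr_eq0 /g /segment_path !rmorph0 rmorph1 mul0r addr0 mul1r.
by rewrite subrKC => /eqP.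
Qed.

Lemma derivative_zero_segment (f : C -> C) (a b : C) :
  (forall t : R, 0 <= t <= 1 -> is_derive (segment_path a b t) (1 : C) f 0) -> f a = f b.
Proof.
move=> df; have h1 := derivative_zero_Re df.
have : Re ('i * f a) = Re ('i * f b).
  apply: (@derivative_zero_Re (fun z => 'i * f z)) => t /df dt.
  by apply: is_derive_eq; rewrite !scaler0 ?addr0.
by move: h1; case: (f a) => x y; case: (f b) => u v /= -> /eqP; rewrite !mul0r !mul1r !sub0r
  eqr_opp => /eqP ->.
Qed.

(** A punctured disc is not convex, but the segment from [p] to [p * q] avoids 0 unless [q] is real
    and at most 0. If [b / a] is such a number, the path makes a detour through [a * 'i]. *)
Lemma derivative_zero_punctured_disc (s : R) (f : C -> C) (a b : C) :
  (forall z, punctured_disc s z -> is_derive z (1 : C) f 0) ->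
  punctured_disc s a -> punctured_disc s b -> f a = f b.
Proof.
move=> df Da Db.
have visible (p q : C) : punctured_disc s p -> punctured_disc s (p * q) ->
    0 < Re q \/ Im q != 0 -> f p = f (p * q).
  move=> [p0 ps] [_ pqs] q0; apply: derivative_zero_segment => t /andP[t0 t1]; apply: df.
  have E : segment_path p (p * q) t = p * ((1 - t)%:C + t%:C * q).
    by rewrite /segment_path rmorphB /=; ring.
  split.
    rewrite E mulf_neq0 //; case: q {pqs E} q0 => x y /= q0.
    apply/negP; rewrite eq_complex /= !mul0r subr0 add0r addr0 => /andP[/eqP e1 /eqP e2].
    case: q0 => [x0|y0]; first by have := mulr_ge0 t0 (ltW x0); nra.
    by have := mulf_eq0 t y; rewrite e2 eqxx (negPf y0) orbF => /esym/eqP t00; move: e1; rewrite t00; lra.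
  have -> : segment_path p (p * q) t = (1 - t)%:C * p + t%:C * (p * q).
    by rewrite E; ring.
  apply: le_lt_trans (ler_normcD _ _) _.
  rewrite Normc.normcM [X in _ + X]Normc.normcM !normc_real !ger0_norm ?subr_ge0 //.
  have [t1'|t1'] := ltP t 1; last first.
    have -> : t = 1 by apply/le_anti/andP.
    by rewrite subrr mul0r add0r mul1r.
  have h1 : (1 - t) * nc p < (1 - t) * s by rewrite ltr_pM2l // subr_gt0.
  have h2 : t * nc (p * q) <= t * s by rewrite ler_wpM2l // ltW.
  by move: h1 h2; move: (nc p) (nc (p * q)) => x y; lra.
have [a0 as_] := Da; have [b0 bs] := Db.
have bE : b = a * (b / a) by rewrite mulrC divfK.
have [q0|q0] := pselect (0 < Re (b / a) \/ Im (b / a) != 0).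
  by rewrite bE; apply: visible => //; rewrite -bE.
have Dia : punctured_disc s (a * 'i).
  split; first by rewrite mulf_neq0 // eq_complex /= oner_eq0 andbF.
  by rewrite Normc.normcM [nc 'i]/= expr0n expr1n add0r sqrtr1 mulr1.
have bE2 : b = a * 'i * (- 'i * (b / a)).
  rewrite (_ : _ * _ = a * (b / a) * - ('i * 'i)); last by ring.
  by rewrite -expr2 sqr_i opprK mulr1.
rewrite (visible _ _ Da Dia); last by right; rewrite /= oner_neq0.
rewrite [in RHS]bE2; apply: visible; rewrite -?bE2 //; right.
have : b / a != 0 by rewrite mulf_neq0 ?invr_eq0.
move: q0; case: (b / a) => x y /= q0.
rewrite eq_complex /= negb_and => xy; apply/negP => /eqP H.
have y0 : y = 0 by apply: contrapT => /eqP y0; apply: q0; right.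
have x0 : x = 0 by move: H; rewrite y0; lra.
by rewrite x0 y0 eqxx in xy.
Qed.

End ZeroDerivative.

Section InjectiveLimit.
Context {R : realType}.
Notation C := R[i].

Lemma lim0_sum (I : Type) (q : seq I) (W : normedModType C) (F : I -> C -> W) l :
  (forall i, lim0 (F i) (l i)) -> lim0 (fun e => \sum_(i <- q) F i e) (\sum_(i <- q) l i).
Proof. by move=> Fl; apply: Lim0; apply: cvg_sumr => i; case: (Fl i). Qed.

Lemma lim0_prod (I : Type) (q : seq I) (F : I -> C -> C) l :
  (forall i, lim0 (F i) (l i)) -> lim0 (fun e => \prod_(i <- q) F i e) (\prod_(i <- q) l i).
Proof.
move=> Fl; elim: q => [|i q IH].
  by rewrite big_nil; apply: lim0_eq (lim0_cst (1 : C)); apply: nearW => e; rewrite big_nil.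
rewrite big_cons; apply: lim0_eq (lim0_scale (Fl i) IH).
by apply: nearW => e; rewrite big_cons.
Qed.

Lemma lim0_det (n : nat) (F : C -> 'M[C]_n) (l : 'M[C]_n) :
  (forall i j, lim0 (fun e => F e i j) (l i j)) -> lim0 (fun e => \det (F e)) (\det l).
Proof.
by move=> Fl; apply: lim0_sum => p; apply: (lim0_scale (lim0_cst _)); apply: lim0_prod => i.
Qed.

Lemma lim0_neq0 (f : C -> C) l : l != 0 -> lim0 f l -> \forall e \near (0 : C)^', f e != 0.
Proof.
move=> l0 fl; apply: (@near0_comp _ _ f l (fun z => z != 0) _ fl).
apply/near_normcP; exists (Normc.normc l).
  by rewrite normc_gt0.
by move=> z; apply: contraTneq => ->; rewrite sub0r normcN ltxx.
Qed.

(** In finite dimension pointwise convergence of linear maps is convergence of their matrices, and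
    the limit has determinant a power of [c], hence nonzero. *)
Lemma lim0_injective (m n : nat) (L : C -> 'M[C]_(m, n) -> 'M[C]_(m, n)) (c : C) :
  c != 0 -> (forall e, linear (L e)) -> (forall y, lim0 (L^~ y) (c *: y)) ->
  \forall e \near (0 : C)^', forall y, L e y = 0 -> y = 0.
Proof.
move=> c0 Ll Ly.
pose F e : {linear 'M[C]_(m, n) -> 'M[C]_(m, n)} :=
  HB.pack (L e) (GRing.isLinear.Build _ _ _ _ _ (Ll e)).
have dl : lim0 (fun e => \det (lin_mx (F e))) (\det (c%:M : 'M[C]_(m * n))).
  apply: lim0_det => i j.
  have E : c%:M i j = mxvec (c *: vec_mx (delta_mx 0 i)) 0 j.
    by rewrite linearZ /= vec_mxK !mxE eqxx /= mulr_natr eq_sym.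
  rewrite E; have vP : linear (fun M : 'M[C]_(m, n) => (mxvec M 0 j : C)).
    by move=> a x y; rewrite linearP !mxE.
  apply: lim0_eq (lim0_linear vP (Ly (vec_mx (delta_mx 0 i)))).
  by apply: nearW => e; rewrite /lin_mx [RHS]mxE.
have d0 : \det (c%:M : 'M[C]_(m * n)) != 0 by rewrite det_scalar expf_neq0.
apply: filterS (lim0_neq0 d0 dl) => e de y Ley.
have /(congr1 mxvec) := Ley; rewrite -[L e y]/(F e y) -mul_vec_lin linear0 => H.
apply: (can_inj mxvecK); rewrite linear0.
by rewrite -[LHS](mulmxK (_ : lin_mx (F e) \in unitmx)) ?H ?mul0mx // unitmxE unitfE.
Qed.

End InjectiveLimit.

Section ResidueAtU0.
Context {R : realType} {N : nat}.
Notation C := R[i].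
Notation nc := (@Normc.normc R).
Notation A := 'M[R[i]]_N.
Notation AA := 'M[R[i]]_(N * N).
Variables (r : C -> C -> AA) (c0 : C -> AA) (G : C -> C -> Prop) (s : R).
Hypothesis rl : regular_locus r c0 G s.
Notation D := (punctured_disc s).

Lemma punctured_discN (d : R) z : punctured_disc d z -> punctured_disc d (- z).
Proof. by move=> [z0 zd]; split; [rewrite oppr_eq0|rewrite normcN]. Qed.

Lemma near_disc (d : R) : 0 < d -> \forall e \near (0 : C)^', punctured_disc d e.
Proof. by move=> d0; apply/near_punctured_disc; exists d. Qed.

Lemma residue_lim v : D v -> lim0 (fun u => r u v - u^-1 *: 1%:M) (c0 v).
Proof. by move=> Dv; apply: Lim0; exact: (locus_residue rl Dv). Qed.

Lemma leg21_1 : leg21 (1%:M : AA) = 1%:M.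
Proof. by rewrite -tens11 leg21_tens. Qed.

Lemma residue_unitary v : D v -> leg21 (c0 v) = - c0 (- v).
Proof.
move=> Dv; have l1 := lim0_linear (@leg21P C N) (residue_lim Dv).
apply: (lim0_unique l1).
apply: lim0_eq (lim0_opp (lim0_comp_opp (residue_lim (punctured_discN Dv)))).
apply: filterS (locus_slice_u rl Dv) => u guv.
rewrite (linear_sub leg21P) (linear_scale leg21P) leg21_1 invrN scaleNr opprK opprD.
have := locus_unitary rl (locus_opp rl guv); rewrite !opprK => ->.
by [].
Qed.

(* The terms [1 (x) 1 / u] only contribute products in which some tensor factor is
   the identity, and [pr3] kills these. *)
Lemma residue_AYBE v w : N%:R != 0 :> C -> D v -> D w -> D (w - v) ->
  pr3 (leg12 (c0 v) *m leg13 (c0 w) - leg23 (c0 (w - v)) *m leg12 (c0 v)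
       + leg13 (c0 w) *m leg23 (c0 (w - v))) = 0.
Proof.
move=> N0 Dv Dw Dx; have two0 : 2 != 0 :> C by rewrite pnatr_eq0.
pose rho u z := r u z - u^-1 *: 1%:M : AA.
have l1 z : D z -> lim0 (rho^~ z) (c0 z) := @residue_lim z.
have l2 z : D z -> lim0 (fun t => rho (2 * t) z) (c0 z).
  by move=> Dz; exact: (lim0_comp_scale two0 (l1 z Dz)).
have lN z : D z -> lim0 (fun t => rho (- t) z) (c0 z).
  by move=> Dz; exact: (lim0_comp_opp (l1 z Dz)).
have m12 := lim0_linear (@leg12P C N); have m13 := lim0_linear (@leg13P C N).
have m23 := lim0_linear (@leg23P C N).
(* The choice [a = - t], [b = 2 t], [a + b = t] keeps all first arguments nonzero while a single
   parameter tends to 0. *)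
pose F t := pr3 (leg12 (rho (- t) v) *m leg13 (rho (2 * t) w)
   - leg23 (rho (2 * t) (w - v)) *m leg12 (rho t v)
   + leg13 (rho t w) *m leg23 (rho t (w - v))).
have lF : lim0 F (pr3 (leg12 (c0 v) *m leg13 (c0 w) - leg23 (c0 (w - v)) *m leg12 (c0 v)
       + leg13 (c0 w) *m leg23 (c0 (w - v)))).
  apply: (lim0_linear (@pr3P C N)); apply: lim0_add; first apply: lim0_sub.
  - exact: (lim0_mul (m12 _ _ (lN v Dv)) (m13 _ _ (l2 w Dw))).
  - exact: (lim0_mul (m23 _ _ (l2 _ Dx)) (m12 _ _ (l1 v Dv))).
  - exact: (lim0_mul (m13 _ _ (l1 w Dw)) (m23 _ _ (l1 _ Dx))).
apply: (lim0_unique lF); apply: lim0_eq (lim0_cst _).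
have sv := locus_slice_u rl Dv; have sw := locus_slice_u rl Dw; have sx := locus_slice_u rl Dx.
apply: filterS2 (near0_and (near0_and (near0_opp sv) sv) (near0_and (near0_scale two0 sw) sw))
  (near0_and (near0_scale two0 sx) sx) => t [[g1 g2] [g3 g4]] [g5 g6].
have tt : - t + 2 * t = t by ring.
have := @locus_AYBE _ _ _ _ _ _ rl (- t) (2 * t) v w g1 g3.
rewrite tt opprK => /(_ g2 g5 g4 g6) /(congr1 pr3); rewrite (linear_zero (@pr3P C N)) => <-.
have rhoE u z : r u z = rho u z + u^-1 *: 1%:M by rewrite subrK.
have leg1 : [/\ leg12 (1%:M : AA) = 1%:M, leg13 (1%:M : AA) = 1%:M & leg23 (1%:M : AA) = 1%:M].
  by rewrite -[X in leg12 X]tens11 -[X in leg13 X]tens11 -[X in leg23 X]tens11 leg12_tens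
    leg13_tens leg23_tens !tens11.
have [u12 u13 u23] := leg1.
have k1 : pr3 (1%:M : 'M[C]_(N * N * N)) = 0 by rewrite -u12 pr3_leg12.
have x12 (x : AA) p : leg12 (x + p *: 1%:M) = leg12 x + p *: 1%:M.
  by rewrite (linear_add leg12P) (linear_scale leg12P) u12.
have x13 (x : AA) p : leg13 (x + p *: 1%:M) = leg13 x + p *: 1%:M.
  by rewrite (linear_add leg13P) (linear_scale leg13P) u13.
have x23 (x : AA) p : leg23 (x + p *: 1%:M) = leg23 x + p *: 1%:M.
  by rewrite (linear_add leg23P) (linear_scale leg23P) u23.
have E (X Y : 'M[C]_(N * N * N)) p q : pr3 X = 0 -> pr3 Y = 0 ->
    pr3 ((X + p *: 1%:M) *m (Y + q *: 1%:M)) = pr3 (X *m Y).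
  move=> X0 Y0; rewrite mulmxDl !mulmxDr -!scalemxAl -!scalemxAr !mulmx1 !mul1mx.
  rewrite !(linear_add (@pr3P C N)) !(linear_scale (@pr3P C N)) k1 X0 Y0.
  by rewrite !scaler0 !addr0.
have E1 (x y : AA) p q : pr3 (leg12 (x + p *: 1%:M) *m leg13 (y + q *: 1%:M)) =
    pr3 (leg12 x *m leg13 y).
  by rewrite x12 x13; exact: E (pr3_leg12 N0 x) (pr3_leg13 N0 y).
have E2 (x y : AA) p q : pr3 (leg23 (x + p *: 1%:M) *m leg12 (y + q *: 1%:M)) =
    pr3 (leg23 x *m leg12 y).
  by rewrite x23 x12; exact: E (pr3_leg23 N0 x) (pr3_leg12 N0 y).
have E3 (x y : AA) p q : pr3 (leg13 (x + p *: 1%:M) *m leg23 (y + q *: 1%:M)) =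
    pr3 (leg13 x *m leg23 y).
  by rewrite x13 x23; exact: E (pr3_leg13 N0 x) (pr3_leg23 N0 y).
rewrite !rhoE (linear_add (@pr3P C N)) (linear_sub (@pr3P C N)).
rewrite [X in X - _ + _]E1 [X in _ - X + _]E2 [X in _ + X]E3.
by rewrite -(linear_sub (@pr3P C N)) -(linear_add (@pr3P C N)).
Qed.

(* The image of [residue_AYBE] under the permutation of the outer factors. *)
Lemma residue_AYBE_flip v w : N%:R != 0 :> C -> D v -> D w -> D (w - v) ->
  pr3 (leg23 (c0 (w - v)) *m leg13 (c0 w) - leg12 (c0 v) *m leg23 (c0 (w - v))
       + leg13 (c0 w) *m leg12 (c0 v)) = 0.
Proof.
move=> N0 Dv Dw Dx.
have wv : - v - - w = w - v by rewrite opprK addrC.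
have wx : - w - - (w - v) = - v by rewrite opprK addKr.
have flip (p q t P Q T : 'M[C]_(N * N * N)) : flip13 p = - P -> flip13 q = - Q ->
    flip13 t = - T -> flip13 (p *m q - t *m p + q *m t) = P *m Q - T *m P + Q *m T.
  move=> pP qQ tT; rewrite (linear_add (@flip13P C N)) (linear_sub (@flip13P C N)).
  by rewrite !flip13M pP qQ tT !mulmxN !mulNmx !opprK.
have f12 z : D z -> flip13 (leg12 (c0 (- z))) = - leg23 (c0 z).
  move=> Dz; rewrite flip13_leg12 (residue_unitary (punctured_discN Dz)) opprK.
  exact: (linear_opp (@leg23P C N)).
have f13 z : D z -> flip13 (leg13 (c0 (- z))) = - leg13 (c0 z).
  move=> Dz; rewrite flip13_leg13 (residue_unitary (punctured_discN Dz)) opprK.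
  exact: (linear_opp (@leg13P C N)).
have f23 z : D z -> flip13 (leg23 (c0 (- z))) = - leg12 (c0 z).
  move=> Dz; rewrite flip13_leg23 (residue_unitary (punctured_discN Dz)) opprK.
  exact: (linear_opp (@leg12P C N)).
have := @residue_AYBE (- (w - v)) (- w) N0 (punctured_discN Dx) (punctured_discN Dw).
rewrite wx => /(_ (punctured_discN Dv)) /(congr1 flip13).
rewrite -pr3_flip13 (linear_zero (@flip13P C N)) => <-.
by rewrite (flip _ _ _ _ _ _ (f12 _ Dx) (f13 _ Dw) (f23 _ Dv)).
Qed.

Lemma residue_CYBE v w : N%:R != 0 :> C -> D v -> D w -> D (w - v) ->
  commutator (leg12 (pr2 (c0 v))) (leg13 (pr2 (c0 w)))
  - commutator (leg23 (pr2 (c0 (w - v)))) (leg12 (pr2 (c0 v)))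
  + commutator (leg13 (pr2 (c0 w))) (leg23 (pr2 (c0 (w - v)))) = 0.
Proof.
move=> N0 Dv Dw Dx.
have cyclic (p q t : 'M[C]_(N * N * N)) : pr3 (p *m q - t *m p + q *m t) = 0 ->
    pr3 (t *m q - p *m t + q *m p) = 0 ->
    pr3 (commutator p q) - pr3 (commutator t p) + pr3 (commutator q t) = 0.
  move=> h1 h2; have := congr2 (fun x y => x - y) h1 h2.
  rewrite subr0 -!(linear_sub (@pr3P C N)) -(linear_add (@pr3P C N)) => <-.
  congr pr3; rewrite /commutator.
  move: (p *m q) (q *m p) (t *m p) (p *m t) (q *m t) (t *m q) => e1 e2 e3 e4 e5 e6.
  by apply/matrixP => i j; rewrite !mxE; ring.
have := cyclic _ _ _ (residue_AYBE N0 Dv Dw Dx) (residue_AYBE_flip N0 Dv Dw Dx).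
by rewrite [X in X - _ + _]pr3_commutator_12_13 [X in _ - X + _]pr3_commutator_23_12
  [X in _ + X]pr3_commutator_13_23.
Qed.

Section Pole.
Variables (c : C) (d : R).
Hypotheses (c_neq0 : c != 0) (d_gt0 : 0 < d) (d_le : d <= s).
Hypothesis pole : forall t, punctured_disc d t -> lim0 (fun e => e *: r t e) (c *: flip_tensor).

(** [residue_operator] at the points [w - e] and [w] contains [r t e]. Its pole must be balanced by
    the term with [c0 (- e)], because the left-hand side stays bounded; inverting [tract (r t w)]
    isolates that term. *)
Lemma residue_pole y : \tr y = 0 -> lim0 (fun e => e *: tract (c0 e) y) (c *: y).
Proof.
move=> y0.
have [t Dt] := near0_ex (near_disc d_gt0).
have Dst : D t by case: Dt => t0 td; split=> //; exact: lt_le_trans d_le.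
have st := locus_slice_v rl Dst; have Dn := near_disc (locus_gt0 rl).
have [w [gw Dw]] := near0_ex (near0_and st Dn).
have [g [gl gK Tg]] := linear_bijective (tract_linearr (r t w)) (locus_inj rl gw).
have lw : lim0 (fun e => w - e) w := lim0_comp_opp (lim0_shift w).
have id0 : lim0 (fun e : C => e) (0 : C).
  by apply: lim0_eq (lim0_expr (isT : (0 < 1)%N)); apply: nearW => e; rewrite expr1.
have h1 : lim0 (fun e => e *: (tract (c0 (w - e)) y *m tract (r t w) 1%:M)) (0 : A).
  rewrite -[X in lim0 _ X](scale0r (tract (c0 w) y *m tract (r t w) 1%:M)).
  apply: (lim0_scale id0); apply: (lim0_mul _ (lim0_cst _)).
  exact: (lim0_tract (lim0_residue rl Dw lw) (lim0_cst _)).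
have h2 : lim0 (fun e => tract (r t (w - e)) (y *m tract (e *: r t e) 1%:M))
    (tract (r t w) (c *: y)).
  have -> : c *: y = y *m tract (c *: flip_tensor) 1%:M.
    by rewrite (linear_scale (tract_linearl _)) tract_flip -scalemxAr mulmx1.
  apply: (lim0_tract (lim0_locus rl gw (lim0_cst t) lw)); apply: (lim0_mul (lim0_cst _)).
  exact: (lim0_tract (pole Dt) (lim0_cst _)).
have h3 : lim0 (fun e => e *: tract (c0 (- e)) y) (- (c *: y)).
  have := lim0_linear gl (lim0_sub h1 h2); rewrite sub0r (linear_opp gl) gK.
  apply: lim0_eq; have h4 := near0_and (near0_disc Dw lw) (near0_opp Dn).
  have h5 := near0_and st (near0_locus rl gw (lim0_cst t) lw).
  apply: filterS2 h4 h5 => e [d1 d2] [g1 g2].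
  have w1 : w - (w - e) = e by rewrite opprB addrC subrK.
  have w2 : w - e - w = - e by rewrite addrAC subrr add0r.
  have := @residue_operator _ _ _ _ _ _ rl t (w - e) w y 1%:M y0 d1.
  rewrite w1 w2 => /(_ d2 g2 gw g1) ->; rewrite (linear_scale (tract_linearl _)) -scalemxAr.
  rewrite (linear_scale (tract_linearr _)) -scalerBr (linear_scale gl) addrAC subrr add0r gK.
  by rewrite mulmx1.
have := lim0_opp (lim0_comp_opp h3); rewrite opprK; apply: lim0_eq.
by apply: nearW => e; rewrite scaleNr opprK opprK.
Qed.

(** The operators [L e] complete the rescaled projected operator by the scalar [c] on multiples of
    the identity. They tend to multiplication by [c], so they are injective for small [e]. *)
Lemma residue_nondegenerate : N%:R != 0 :> C -> \forall v \near (0 : C)^',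
  forall y, pr (tract (c0 v) (pr y)) = 0 -> pr y = 0.
Proof.
move=> N0; pose L e y := e *: pr (tract (c0 e) (pr y)) + c *: (y - pr y) : A.
have prP := @pr_linear C N.
have lin (P Q : A -> A) e : linear P -> linear Q ->
    linear (fun y => e *: P y + c *: (y - Q y) : A).
  move=> Pl Ql a x y; rewrite Pl Ql; move: (P x) (P y) (Q x) (Q y) => p1 p2 q1 q2.
  by apply/matrixP => i j; rewrite !mxE; ring.
have prl e : linear (fun y => pr (tract (c0 e) (pr y))).
  by move=> a x y; rewrite prP tract_linearr prP.
have Ll e : linear (L e) := lin _ _ e (prl e) prP.
have Ly y : lim0 (L^~ y) (c *: y).
  have -> : c *: y = pr (c *: pr y) + c *: (y - pr y).
    by rewrite (linear_scale prP) (pr_idem N0) -scalerDr subrKC.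
  apply: lim0_add (lim0_cst _).
  apply: lim0_eq (lim0_linear prP (residue_pole (trace_pr N0 y))).
  by apply: nearW => e; rewrite (linear_scale prP).
apply: filterS (lim0_injective c_neq0 Ll Ly) => e inj y y0; apply: inj.
by rewrite /L (pr_idem N0) y0 scaler0 subrr scaler0 addr0.
Qed.

End Pole.
End ResidueAtU0.

(** * The product of r(-u, v) and r(u, v) *)

Section SquareRelation.
Context {R : realType} {N : nat}.
Notation C := R[i].
Notation nc := (@Normc.normc R).
Notation A := 'M[R[i]]_N.
Notation AA := 'M[R[i]]_(N * N).
Variables (r : C -> C -> AA) (c0 : C -> AA) (G : C -> C -> Prop) (s : R).
Hypothesis rl : regular_locus r c0 G s.
Hypothesis N0 : N%:R != 0 :> C.
Notation D := (punctured_disc s).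

Let sandwichl := @sandwich_linearl C N.
Let sandwichr := @sandwich_linearr C N.

Lemma merge_AYBE a b v w : G a v -> G b w -> G (a + b) v -> G b (w - v) ->
  G (a + b) w -> G (- a) (w - v) ->
  r a v *m r b w - sandwich (r (a + b) v) (r b (w - v))
  + sandwich (r (a + b) w) (r (- a) (w - v)) = 0.
Proof.
move=> g1 g2 g3 g4 g5 g6; have := locus_AYBE rl g1 g2 g3 g4 g5 g6.
move=> /(congr1 merge23); have mP : linear (@merge23 C N) by exact: tlift3_linear.
rewrite (linear_zero mP) (linear_add mP) (linear_sub mP).
by rewrite [X in X - _ + _]merge_12_13 [X in _ - X + _]merge_23_12 [X in _ + X]merge_13_23.
Qed.

(* The limit [u -> 0] of [merge_AYBE] at [(a, b) = (- t, t + u)] shows that this is of the form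
   [1 (x) X] and only depends on [t] and [w - v]. *)
Definition square_defect t v w : AA :=
  r (- t) v *m r t w - sandwich (c0 v - c0 w) (r t (w - v)).

(** The poles [u^-1] of [r u v] and [r u w] are sandwiched with [r (t + u) (w - v)] and
    [r t (w - v)], so together they leave a difference quotient in [t]. Its limit need not be known,
    only its shape and its dependence on [w - v]. *)
Lemma square_defect_lim t v w : D v -> D w -> G (- t) v -> G t w -> G t (w - v) ->
  lim0 (fun u => 1%:M *t mult_tensor (u^-1 *: (r (t + u) (w - v) - r t (w - v))))
    (square_defect t v w).
Proof.
move=> Dv Dw g1 g2 g3; have lt := lim0_shift t.
pose F u := r (- t) v *m r (t + u) w - sandwich (r u v - u^-1 *: 1%:M) (r (t + u) (w - v))
  + sandwich (r u w - u^-1 *: 1%:M) (r t (w - v)).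
have lF : lim0 F (square_defect t v w).
  have -> : square_defect t v w = r (- t) v *m r t w - sandwich (c0 v) (r t (w - v))
      + sandwich (c0 w) (r t (w - v)).
    by rewrite /square_defect (linear_sub (sandwichl _)) opprB addrA addrAC.
  apply: lim0_add; first apply: lim0_sub.
  - exact: (lim0_mul (lim0_cst _) (lim0_locus rl g2 lt (lim0_cst w))).
  - apply: (lim0_bilinear sandwichl sandwichr (residue_lim rl Dv)).
    exact: (lim0_locus rl g3 lt (lim0_cst _)).
  - exact: (lim0_bilinear sandwichl sandwichr (residue_lim rl Dw) (lim0_cst _)).
apply: lim0_eq lF.
have h1 := near0_and (locus_slice_u rl Dv) (locus_slice_u rl Dw).
have h2 := near0_and (near0_locus rl g2 lt (lim0_cst w)) (near0_locus rl g3 lt (lim0_cst (w - v))).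
apply: filterS2 h1 h2 => u [k1 k2] [k3 k4].
have tu : - t + (t + u) = u by rewrite addKr.
have := @merge_AYBE (- t) (t + u) v w g1 k3; rewrite tu opprK => /(_ k1 k4 k2 g3) /eqP.
rewrite addr_eq0 subr_eq => /eqP E; rewrite /F E.
have mP : linear (@mult_tensor C N) by exact: tlift_linear.
rewrite !(linear_sub (sandwichl _)) !(linear_scale (sandwichl _)) !sandwich1.
rewrite (linear_scale mP) (linear_sub mP) (linear_scale (tensmx_linearr _)).
rewrite (linear_sub (tensmx_linearr _)) scalerBr.
have cancel (e1 e2 e3 e4 : AA) : - e2 + e1 - (e1 - e3) + (e2 - e4) = e3 - e4.
  by apply/matrixP => i j; rewrite !mxE; ring.
exact: cancel.
Qed.

Lemma square_defect_translate t v w v' w' : D v -> D w -> G (- t) v -> G t w ->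
  D v' -> D w' -> G (- t) v' -> G t w' -> G t (w - v) -> w - v = w' - v' ->
  square_defect t v w = square_defect t v' w'.
Proof.
move=> Dv Dw g1 g2 Dv' Dw' g1' g2' g3 E; have g3' := g3; rewrite E in g3'.
apply: (lim0_unique (square_defect_lim Dv Dw g1 g2 g3)).
by rewrite E; exact: (square_defect_lim Dv' Dw' g1' g2' g3').
Qed.

(** [L] is a linear projection onto the tensors [1 (x) X], so a limit of such tensors is again
    one. *)
Lemma square_defect_right t v w : D v -> D w -> G (- t) v -> G t w -> G t (w - v) ->
  exists X, square_defect t v w = 1%:M *t X.
Proof.
move=> Dv Dw g1 g2 g3; have l := square_defect_lim Dv Dw g1 g2 g3.
pose L M : AA := 1%:M *t (N%:R^-1 *: tract (leg21 M) 1%:M : A).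
have Ll : linear L.
  move=> a x y; rewrite /L leg21P tract_linearl scalerDr scalerA mulrC -scalerA.
  exact: tensmx_linearr.
exists (N%:R^-1 *: tract (leg21 (square_defect t v w)) 1%:M).
apply: (lim0_unique l); apply: lim0_eq (lim0_linear Ll l); apply: nearW => u.
by rewrite /L leg21_tens tract_tens mulmx1 mxtrace1 scalerA mulVf // scale1r.
Qed.

Section Pole.
Variables (c : C) (d : R).
Hypotheses (c_neq0 : c != 0) (d_gt0 : 0 < d) (d_le : d <= s).
Hypothesis pole : forall t, punctured_disc d t -> lim0 (fun e => e *: r t e) (c *: flip_tensor).

(** The partial trace over the second factor of the derivative of [c0]. *)
Definition residue_slope v : A := tract ('D_1 c0 v) 1%:M.

Lemma residue_derive v : D v -> lim0 (fun x => x^-1 *: (c0 (v + x) - c0 v)) ('D_1 c0 v).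
Proof.
move=> /(locus_derivable rl) dv; apply: Lim0.
have dv' : h^-1 *: (c0 (h *: 1 + v) - c0 v) @[h --> (0 : C)^'] --> 'D_1 c0 v by exact: dv.
apply: cvg_dnbhs_eq dv'; apply: nearW => h.
have -> : h *: 1 + v = v + h by rewrite -[LHS]/(h * 1 + v) mulr1 addrC.
by [].
Qed.

(** As [w] tends to [v], the zero of [c0 v - c0 w] meets the simple pole of [r t (w - v)]: the
    sandwich tends to minus that of the derivative with [c *: flip_tensor], which [sandwich_flip]
    evaluates. *)
Lemma square_defect_diagonal t v : punctured_disc d t -> D v -> G (- t) v -> G t v ->
  lim0 (fun x => square_defect t v (v + x))
    (r (- t) v *m r t v + c *: (residue_slope v *t 1%:M)).
Proof.
move=> Dt Dv g1 g2; have lv := lim0_shift v.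
have -> : c *: (residue_slope v *t 1%:M) = sandwich ('D_1 c0 v) (c *: flip_tensor).
  by rewrite (linear_scale (sandwichr _)) sandwich_flip.
have l2 := lim0_bilinear sandwichl sandwichr (residue_derive Dv) (pole Dt).
have l1 := lim0_mul (lim0_cst (r (- t) v)) (lim0_locus rl g2 (lim0_cst t) lv).
apply: lim0_eq (lim0_add l1 l2); apply: filterS near0_neq0 => x x0.
have vx : v + x - v = x by rewrite addrAC subrr add0r.
rewrite /square_defect vx (linear_scale (sandwichl _)) (linear_scale (sandwichr _)) scalerA.
rewrite mulVf // scale1r -(linear_opp (sandwichl _)) opprB //.
Qed.

(** [X] is read off at a base point [v0]; since the defect is translation invariant, its limit on
    the diagonal is the same at every [v]. *)
Lemma square_relation t : punctured_disc d t -> exists X, forall v, D v ->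
  G (- t) v -> G t v -> r (- t) v *m r t v = 1%:M *t X - c *: (residue_slope v *t 1%:M).
Proof.
move=> Dt; have Dn := near_disc (locus_gt0 rl).
have Dst : D t by case: Dt => t0 td; split=> //; exact: lt_le_trans d_le.
have st := locus_slice_v rl Dst; have sNt := locus_slice_v rl (punctured_discN Dst).
have [v0 [Dv0 [g1 g2]]] := near0_ex (near0_and Dn (near0_and sNt st)).
have l0 := square_defect_diagonal Dt Dv0 g1 g2.
have good v : D v -> G t v -> \forall x \near (0 : C)^', [/\ D (v + x), G t (v + x) & G t (v + x - v)].
  move=> Dv gv; have h := near0_and (near0_disc Dv (lim0_shift v)) (near0_locus rl gv (lim0_cst t) (lim0_shift v)).
  apply: filterS2 h st => x [h1 h2] h3; split=> //.
  by rewrite (_ : v + x - v = x) // addrAC subrr add0r.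
have [X XE] : exists X, r (- t) v0 *m r t v0 + c *: (residue_slope v0 *t 1%:M) = 1%:M *t X.
  pose L M : AA := 1%:M *t (N%:R^-1 *: tract (leg21 M) 1%:M : A).
  have Ll : linear L.
    move=> a x y; rewrite /L leg21P tract_linearl scalerDr scalerA mulrC -scalerA.
    exact: tensmx_linearr.
  exists (N%:R^-1 *: tract (leg21 (r (- t) v0 *m r t v0 + c *: (residue_slope v0 *t 1%:M))) 1%:M).
  apply: (lim0_unique l0); apply: lim0_eq (lim0_linear Ll l0).
  apply: filterS (good v0 Dv0 g2) => x [h1 h2 h3].
  have [X ->] := square_defect_right Dv0 h1 g1 h2 h3.
  by rewrite /L leg21_tens tract_tens mulmx1 mxtrace1 scalerA mulVf // scale1r.
exists X => v Dv gNv gv; apply/eqP; rewrite -XE eq_sym subr_eq; apply/eqP; apply: (lim0_unique l0).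
apply: lim0_eq (square_defect_diagonal Dt Dv gNv gv).
apply: filterS2 (good v0 Dv0 g2) (good v Dv gv) => x [h1 h2 h3] [k1 k2 k3].
apply: square_defect_translate => //.
by rewrite addrAC subrr add0r addrAC subrr add0r.
Qed.

Lemma slope_relation t : punctured_disc d t -> exists X, forall v, D v ->
  G (- t) v -> G t v ->
  [/\ r (- t) v *m r t v = 1%:M *t X - c *: (residue_slope v *t 1%:M) &
      pr X = - (c *: pr (residue_slope v))].
Proof.
move=> Dt; have [X XE] := square_relation Dt.
have [X' XE'] := square_relation (punctured_discN Dt).
exists X => v Dv gNv gv; split; first exact: XE.
have gN := locus_opp rl gv; have gNN := locus_opp rl gNv; rewrite opprK in gNN.
(* Exchanging the tensor factors in the relation at [(t, - v)] gives, by unitarity, the relation at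
   [(- t, v)]; the two right-hand sides are then compared in the first factor modulo scalars. *)
have := XE (- v) (punctured_discN Dv) gN gNN => /(congr1 leg21).
have u1 := locus_unitary rl gv; have u2 := locus_unitary rl gNv; rewrite opprK in u2.
rewrite leg21M u1 u2 mulNmx mulmxN opprK.
have := XE' v Dv; rewrite opprK => /(_ gv gNv) ->.
rewrite (linear_sub (@leg21P C N)) (linear_scale (@leg21P C N)) !leg21_tens.
have prP := @pr_linear C N; have tP := @tract_linearl C N 1%:M.
have pr1 : pr (1%:M : A) = 0 by exact: pr_scalar.
have prl (U V : A) : pr (tract (U *t 1%:M - c *: (1%:M *t V)) 1%:M) = N%:R *: pr U.
  rewrite (linear_sub tP) (linear_scale tP) !tract_tens !mulmx1 mxtrace1.
  by rewrite (linear_sub prP) !(linear_scale prP) pr1 !scaler0 subr0.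
have prr (U V : A) : pr (tract (1%:M *t U - c *: (V *t 1%:M)) 1%:M) = N%:R *: - (c *: pr V).
  rewrite (linear_sub tP) (linear_scale tP) !tract_tens !mulmx1 mxtrace1.
  rewrite (linear_sub prP) !(linear_scale prP) pr1 scaler0 sub0r scalerN !scalerA.
  by rewrite mulrC.
move=> /(congr1 (fun M => pr (tract M 1%:M))) /esym E.
exact: (scalerI N0 (etrans (esym (prl _ _)) (etrans E (prr _ _)))).
Qed.

Lemma slope_constant : exists2 M : A, \tr M = 0 &
  (forall v, D v -> pr (residue_slope v) = M) /\
  (forall t v, punctured_disc d t -> D v -> G (- t) v -> G t v ->
     exists k, r (- t) v *m r t v = - c *: coproduct M + k *: 1%:M).
Proof.
have Dn := near_disc d_gt0.
have [v0 Dv0] := near0_ex (near_disc (locus_gt0 rl)).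
pose M := pr (residue_slope v0); exists M; first exact: trace_pr.
have cst v : D v -> pr (residue_slope v) = M.
  move=> Dv; have sv := locus_slice_u rl Dv; have sv0 := locus_slice_u rl Dv0.
  have [t [Dt [[g1 g2] [g3 g4]]]] := near0_ex (near0_and Dn (near0_and
    (near0_and (near0_opp sv) sv) (near0_and (near0_opp sv0) sv0))).
  have [X XE] := slope_relation Dt.
  have [_ e1] := XE v Dv g1 g2; have [_ e2] := XE v0 Dv0 g3 g4.
  have e3 := etrans (esym e1) e2.
  exact: (scalerI c_neq0 (oppr_inj e3)).
split=> // t v Dt Dv g1 g2; have [X XE] := slope_relation Dt.
have [-> e2] := XE v Dv g1 g2; rewrite (cst v Dv) in e2.
exists (\tr X / N%:R - c * (\tr (residue_slope v) / N%:R)).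
rewrite {1}(prE X) e2 {1}(prE (residue_slope v)) (cst v Dv) /coproduct.
rewrite (linear_add (tensmx_linearr _)) (linear_add (tensmx_linearl _)).
rewrite (linear_opp (tensmx_linearr _)) !(linear_scale (tensmx_linearr _)).
rewrite !(linear_scale (tensmx_linearl _)) !tens11.
have collect (p q e : AA) (x y : C) : - (c *: p) + x *: e - c *: (q + y *: e) =
    - c *: (q + p) + (x - c * y) *: e.
  by apply/matrixP => i j; rewrite !mxE; ring.
exact: collect.
Qed.

End Pole.
End SquareRelation.

(** * The obstruction M *)

Section Obstruction.
Context {R : realType} {N : nat}.
Notation C := R[i].
Notation nc := (@Normc.normc R).
Notation A := 'M[R[i]]_N.
Notation AA := 'M[R[i]]_(N * N).
Notation AAA := 'M[R[i]]_(N * N * N).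
Variables (r : C -> C -> AA) (c0 : C -> AA) (G : C -> C -> Prop) (s : R).
Hypothesis rl : regular_locus r c0 G s.
Hypothesis N0 : N%:R != 0 :> C.
Notation D := (punctured_disc s).
Variables (c : C) (d : R) (M : A).
Hypotheses (c_neq0 : c != 0) (d_gt0 : 0 < d) (d_le : d <= s) (M_traceless : \tr M = 0).
Hypothesis slope : forall v, D v -> pr (residue_slope c0 v) = M.
Hypothesis square : forall t v, punctured_disc d t -> D v -> G (- t) v -> G t v ->
  exists k, r (- t) v *m r t v = - c *: coproduct M + k *: 1%:M.

(** Replacing [t] by [- t] exchanges the two factors at the cost of another scalar; comparing traces
    shows that the scalars agree. *)
Lemma square_commute t v : punctured_disc d t -> D v -> G (- t) v -> G t v ->
  exists k, r (- t) v *m r t v = - c *: coproduct M + k *: 1%:M /\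
            r t v *m r (- t) v = - c *: coproduct M + k *: 1%:M.
Proof.
move=> Dt Dv g1 g2; have [k E] := square Dt Dv g1 g2.
have g2' := g2; rewrite -(opprK t) in g2'.
have [k' E'] := square (punctured_discN Dt) Dv g2' g1; rewrite opprK in E'.
exists k; split=> //; rewrite E'; congr (_ + _).
have := mxtrace_mulC (r t v) (r (- t) v); rewrite E E' !mxtraceD => /addrI.
rewrite !mxtraceZ mxtrace1 natrM => H; congr (_ *: _); apply: (mulIf (mulf_neq0 N0 N0)).
exact: H.
Qed.

(** By associativity of [r t v *m r (- t) v *m r t v], the common value of the two products commutes
    with [r t v]. *)
Lemma coproduct_symmetry t v : punctured_disc d t -> D v -> G (- t) v -> G t v ->
  commutator (coproduct M) (r t v) = 0.
Proof.
move=> Dt Dv g1 g2; have [k [E E']] := square_commute Dt Dv g1 g2.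
have : r t v *m (r (- t) v *m r t v) = (r t v *m r (- t) v) *m r t v by rewrite mulmxA.
rewrite E E' mulmxDl mulmxDr -!scalemxAl -!scalemxAr mulmx1 mul1mx => /addIr.
move=> H; apply: (scalerI c_neq0); apply: oppr_inj; rewrite scaler0 oppr0 -scaleNr.
by rewrite /commutator scalerBr -H subrr.
Qed.

Lemma residue_symmetry v : D v -> commutator (coproduct M) (c0 v) = 0.
Proof.
move=> Dv; have cl : linear (commutator (coproduct M)).
  by move=> a x y; rewrite /commutator mulmx_linearl mulmx_linearr scalerBr opprD addrACA.
apply: (lim0_unique (lim0_linear cl (residue_lim rl Dv))).
apply: lim0_eq (lim0_cst _); have sv := locus_slice_u rl Dv.
apply: filterS2 (near_disc d_gt0) (near0_and (near0_opp sv) sv) => u Du [g1 g2].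
rewrite (linear_sub cl) (linear_scale cl) (coproduct_symmetry Du Dv g1 g2).
by rewrite /commutator mulmx1 mul1mx subrr scaler0 subr0.
Qed.

Lemma projected_residue_symmetry v : D v ->
  commutator (coproduct M) (pr2 (c0 v)) = 0.
Proof.
by move=> Dv; rewrite -pr2_commutator_coproduct residue_symmetry // (linear_zero (@pr2P C N)).
Qed.

(** The points at which the AYBE with first arguments [- u], [u + u] and their sum [u], as well as
    its flipped form, may be used. *)
Definition QYBE_locus u v w := [/\ punctured_disc d u, D v, G u v, G (- u) v &
  [/\ G (u + u) w, G (u + u) (w - v), G u w & G u (w - v)]].

(** The AYBE at [a = - u], [b = u + u] expresses [r^13 r^23] and, after exchange of the outer
    factors, [r^23 r^13] through [r (u + u)] and [r (- u)]. After substitution in the cubic products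
    the terms [r^12 r^23 r^12] cancel. What remains is [r (u + u) w] in legs 13, multiplied on
    either side by the products of [r u v] and [r (- u) v]. *)
Lemma QYBE_defect u v w : QYBE_locus u v w ->
  leg12 (r u v) *m leg13 (r u w) *m leg23 (r u (w - v)) -
  leg23 (r u (w - v)) *m leg13 (r u w) *m leg12 (r u v) =
  c *: leg13 (commutator (M *t 1%:M) (r (u + u) w)).
Proof.
move=> [Du Dv g1 g2 [g3 g4 g5 g6]].
have uu : - u + (u + u) = u by rewrite addKr.
have E1 : leg13 (r u w) *m leg23 (r u (w - v)) =
    leg23 (r (u + u) (w - v)) *m leg12 (r u v) - leg12 (r (- u) v) *m leg13 (r (u + u) w).
  have := @locus_AYBE _ _ _ _ _ _ rl (- u) (u + u) v w g2 g3; rewrite uu opprK.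
  by move=> /(_ g1 g4 g5 g6) /eqP; rewrite addrC addr_eq0 opprB => /eqP.
have vw : - w - - (w - v) = - v by rewrite opprK addKr.
have flip (p q t p' q' t' P Q T P' Q' T' : AAA) : flip13 p = - P -> flip13 q = - Q ->
    flip13 t = - T -> flip13 p' = - P' -> flip13 q' = - Q' -> flip13 t' = - T' ->
    p *m q - t *m p' + q' *m t' = 0 -> P *m Q = T *m P' - Q' *m T'.
  move=> e1 e2 e3 e4 e5 e6 /(congr1 flip13).
  rewrite (linear_zero (@flip13P C N)) (linear_add (@flip13P C N)) (linear_sub (@flip13P C N)).
  rewrite !flip13M e1 e2 e3 e4 e5 e6 !mulmxN !mulNmx !opprK => /eqP.
  by rewrite -addrA addr_eq0 opprD opprK => /eqP.
have f12 a z : G a z -> flip13 (leg12 (r (- a) (- z))) = - leg23 (r a z).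
  move=> Dz; rewrite flip13_leg12 (locus_unitary rl Dz).
  exact: (linear_opp (@leg23P C N)).
have f13 a z : G a z -> flip13 (leg13 (r (- a) (- z))) = - leg13 (r a z).
  move=> Dz; rewrite flip13_leg13 (locus_unitary rl Dz).
  exact: (linear_opp (@leg13P C N)).
have f23 a z : G a z -> flip13 (leg23 (r (- a) (- z))) = - leg12 (r a z).
  move=> Dz; rewrite flip13_leg23 (locus_unitary rl Dz).
  exact: (linear_opp (@leg12P C N)).
have E2 : leg23 (r u (w - v)) *m leg13 (r u w) =
    leg12 (r u v) *m leg23 (r (u + u) (w - v)) - leg13 (r (u + u) w) *m leg12 (r (- u) v).
  have g2' := locus_opp rl g2; rewrite opprK in g2'.
  have g3' := locus_opp rl g3; have g4' := locus_opp rl g4; rewrite !opprD -opprD in g3' g4'.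
  have := @locus_AYBE _ _ _ _ _ _ rl (- u) (- u) (- (w - v)) (- w).
  have wx : - w - - (w - v) = - v by rewrite opprK addKr.
  rewrite wx -opprD opprK => /(_ (locus_opp rl g6) (locus_opp rl g5)).
  move=> /(_ (locus_opp rl g4) (locus_opp rl g1) (locus_opp rl g3) g2').
  have f23' := f23 (- u) v g2; rewrite opprK in f23'.
  exact: (flip _ _ _ _ _ _ _ _ _ _ _ _ (f12 _ _ g6) (f13 _ _ g5) (f23 _ _ g1) (f12 _ _ g4)
    (f13 _ _ g3) f23').
have [k [sq sq']] := square_commute Du Dv g2 g1.
have l1 : leg12 (1%:M : AA) = 1%:M by rewrite -[X in leg12 X]tens11 leg12_tens !tens11.
have Q : leg12 (r (- u) v) *m leg12 (r u v) = - c *: leg12 (coproduct M) + k *: 1%:M.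
  by rewrite -leg12M sq (linear_add leg12P) !(linear_scale leg12P) l1.
have Q' : leg12 (r u v) *m leg12 (r (- u) v) = - c *: leg12 (coproduct M) + k *: 1%:M.
  by rewrite -leg12M sq' (linear_add leg12P) !(linear_scale leg12P) l1.
have combine (p q t p' q' t' : AAA) : q *m t = t' *m p - p' *m q' ->
    t *m q = p *m t' - q' *m p' -> p *m q *m t - t *m q *m p = q' *m (p' *m p) - (p *m p') *m q'.
  move=> e1 e2; rewrite -mulmxA e1 e2 mulmxBr mulmxBl !mulmxA opprB.
  by rewrite addrC addrA subrK.
rewrite -commutator_leg12_leg13; have := combine _ _ _ _ _ _ E1 E2.
rewrite [X in _ = _ *m X - _]Q [X in _ = _ - X *m _]Q' => ->.
have collect (p q : AAA) : q *m (- c *: p + k *: 1%:M) - (- c *: p + k *: 1%:M) *m q =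
    c *: commutator p q.
  rewrite mulmxDr mulmxDl -!scalemxAl -!scalemxAr mulmx1 mul1mx opprD addrACA subrr addr0.
  by rewrite !scaleNr opprK scalerBr addrC.
exact: collect.
Qed.

Lemma QYBE_of_traceless u v w : M = 0 -> QYBE_locus u v w ->
  leg12 (r u v) *m leg13 (r u w) *m leg23 (r u (w - v)) =
  leg23 (r u (w - v)) *m leg13 (r u w) *m leg12 (r u v).
Proof.
move=> M0 /QYBE_defect E; apply/eqP; rewrite -subr_eq0; apply/eqP; rewrite {}E M0.
have -> : commutator (0 *t 1%:M) (r (u + u) w) = 0.
  by rewrite (linear_zero (tensmx_linearl _)) /commutator mul0mx mulmx0 subrr.
by rewrite [leg13 0](linear_zero (@leg13P C N)) scaler0.
Qed.

Lemma tract_mull (a : A) (t : AA) y : tract ((a *t 1%:M) *m t) y = a *m tract t y.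
Proof.
move: t; apply: tens_ext => [x p q|x p q|p q].
- by rewrite mulmx_linearr tract_linearl.
- by rewrite tract_linearl mulmx_linearr.
- by rewrite tensmx_mul !tract_tens mul1mx -scalemxAr.
Qed.

Lemma tract_mulr (a : A) (t : AA) y : tract (t *m (a *t 1%:M)) y = tract t y *m a.
Proof.
move: t; apply: tens_ext => [x p q|x p q|p q].
- by rewrite mulmx_linearl tract_linearl.
- by rewrite tract_linearl mulmx_linearl.
- by rewrite tensmx_mul !tract_tens mulmx1 -scalemxAl.
Qed.

(** The bracket of [M *t 1%:M] with [r (u + u) w] vanishes, so [M] commutes with the range of an
    invertible operator, that is, with all matrices; a traceless scalar is 0. *)
Lemma QYBE_obstruction u v w : QYBE_locus u v w ->
  leg12 (r u v) *m leg13 (r u w) *m leg23 (r u (w - v)) =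
  leg23 (r u (w - v)) *m leg13 (r u w) *m leg12 (r u v) -> M = 0.
Proof.
move=> L /eqP; rewrite -subr_eq0 (QYBE_defect L) scaler_eq0 (negPf c_neq0) => /eqP.
move=> /(leg13_inj N0); case: L => [_ _ _ _ [g3 _ _ _]] /eqP; rewrite subr_eq0 => /eqP E.
have [g [_ _ Tg]] := linear_bijective (tract_linearr (r (u + u) w)) (locus_inj rl g3).
have [k kE] : exists k, M = k%:M.
  by apply: central_scalar => y; rewrite -(Tg y) -tract_mull E tract_mulr.
move: M_traceless; rewrite kE mxtrace_scalar -mulr_natr => /eqP.
by rewrite mulf_eq0 (negPf N0) orbF => /eqP ->; rewrite raddf0.
Qed.

Lemma square_obstruction t v k : punctured_disc d t -> D v -> G (- t) v -> G t v ->
  r t v *m r (- t) v = k *: 1%:M -> M = 0.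
Proof.
move=> Dt Dv g1 g2 E; have [k' [_]] := square_commute Dt Dv g1 g2.
rewrite E => /eqP; rewrite -subr_eq -scalerBl => /eqP H.
apply: (coproduct_scalar N0 M_traceless (c := - c^-1 * (k - k'))).
rewrite -scalerA H !scaleNr scalerN opprK scalerA mulVf // scale1r //.
Qed.

End Obstruction.

(** * The scalar parts of the residue and the projected AYBE *)

Section ResidueSlope.
Context {R : realType} {N : nat}.
Notation C := R[i].
Notation nc := (@Normc.normc R).
Notation A := 'M[R[i]]_N.
Notation AA := 'M[R[i]]_(N * N).
Notation AAA := 'M[R[i]]_(N * N * N).
Variables (r : C -> C -> AA) (c0 : C -> AA) (G : C -> C -> Prop) (s : R).
Hypothesis rl : regular_locus r c0 G s.
Hypothesis N0 : N%:R != 0 :> C.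
Notation D := (punctured_disc s).
Variable M : A.
Hypothesis M_traceless : \tr M = 0.
Hypothesis slope : forall v, D v -> pr (residue_slope c0 v) = M.

Lemma lim0_is_derive (f : C -> C) (z l : C) :
  lim0 (fun x => x^-1 * (f (z + x) - f z)) l -> is_derive z (1 : C) f l.
Proof.
move=> [fl].
have lf : h^-1 *: (f (h *: 1 + z) - f z) @[h --> (0 : C)^'] --> l.
  apply: cvg_dnbhs_eq fl; apply: nearW => h.
  have -> : h *: 1 + z = z + h by rewrite -[LHS]/(h * 1 + z) mulr1 addrC.
  by [].
have d1 : derivable f z 1 by exact: (cvgP _ lf).
by apply: DeriveDef d1 _; exact: (cvg_lim (@norm_hausdorff _ _) lf).
Qed.

Lemma leg21_derive v : D v -> leg21 ('D_1 c0 v) = 'D_1 c0 (- v).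
Proof.
move=> Dv; have l1 := lim0_linear (@leg21P C N) (residue_derive rl Dv).
have DNv := punctured_discN Dv.
apply: (lim0_unique l1); apply: lim0_eq (lim0_comp_opp (residue_derive rl DNv)).
apply: filterS (near0_disc Dv (lim0_shift v)) => x Dx.
rewrite (linear_scale (@leg21P C N)) (linear_sub (@leg21P C N)).
rewrite (residue_unitary rl Dx) (residue_unitary rl Dv) -opprD opprK invrN scaleNr -scalerN.
by rewrite opprB addrC.
Qed.

Lemma left_part_derive v : D v -> left_part ('D_1 c0 v) = N%:R^-1 *: M.
Proof. by move=> Dv; rewrite /left_part -(slope Dv). Qed.

Lemma right_part_derive v : D v -> right_part ('D_1 c0 v) = N%:R^-1 *: M.
Proof.
move=> Dv; rewrite /right_part (leg21_derive Dv); exact: left_part_derive (punctured_discN Dv).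
Qed.

Lemma unprojected_derive v : D v ->
  exists k, derive1 (fun w => c0 w - pr2 (c0 w)) v = N%:R^-1 *: coproduct M + k *: 1%:M.
Proof.
move=> Dv; have [k kE] := tensor_decomposition ('D_1 c0 v); exists k.
have prP := @pr2P C N.
pose Lf X : AA := X - pr2 X; have L : linear Lf.
  by move=> a x y; rewrite /Lf prP scalerBr opprD addrACA.
have l1 := lim0_linear L (residue_derive rl Dv).
have [l2] : lim0 (fun h => h^-1 *: ((c0 (h + v) - pr2 (c0 (h + v))) - (c0 v - pr2 (c0 v))))
    ('D_1 c0 v - pr2 ('D_1 c0 v)).
  apply: lim0_eq l1; apply: nearW => h.
  by rewrite [v + h]addrC (linear_scale L) (linear_sub L).
transitivity ('D_1 c0 v - pr2 ('D_1 c0 v)).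
  exact: (cvg_lim (@norm_hausdorff _ _) l2).
rewrite {1}kE (left_part_derive Dv) (right_part_derive Dv) /coproduct scalerDr.
rewrite (linear_scale (tensmx_linearl _)) (linear_scale (tensmx_linearr _)).
move: (pr2 _) (_ *: (_ *t _)) (_ *: (_ *t _)) => p q t.
by apply/matrixP => i j; rewrite !mxE; ring.
Qed.

Lemma slope_obstruction v k : D v ->
  derive1 (fun w => c0 w - pr2 (c0 w)) v = k *: 1%:M -> M = 0.
Proof.
move=> /unprojected_derive[k' ->] H.
have {}H : N%:R^-1 *: coproduct M = (k - k') *: 1%:M by rewrite scalerBl -H addrK.
apply: (coproduct_scalar N0 M_traceless (c := N%:R * (k - k'))).
by rewrite -scalerA -H scalerA mulfV // scale1r.
Qed.

(** The derivative of [left_part (c0 z)] is the constant [N%:R^-1 *: M]; subtracting the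
    corresponding linear function leaves a function with zero derivative on the punctured disc. *)
Lemma left_part_affine v w : D v -> D w ->
  left_part (c0 w) - left_part (c0 v) = ((w - v) / N%:R) *: M.
Proof.
move=> Dv Dw; apply/matrixP => i j.
pose f z := left_part (c0 z) i j - z * (N%:R^-1 * M i j) : C.
have df z : D z -> is_derive z (1 : C) f 0.
  move=> Dz; apply: lim0_is_derive.
  have L : linear (fun X : AA => (left_part X i j : C)).
    move=> a x y; rewrite left_partP; move: (left_part x) (left_part y) => p q.
    by rewrite !mxE.
  have := lim0_sub (lim0_linear L (residue_derive rl Dz)) (lim0_cst (N%:R^-1 * M i j : C)).
  rewrite (left_part_derive Dz) [X in lim0 _ (X - _)]mxE subrr; apply: lim0_eq.
  apply: filterS near0_neq0 => x x0; rewrite (linear_scale L) (linear_sub L) /f.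
  have ar (p q t : C) : x^-1 * (p - q) - t = x^-1 * (p - (z + x) * t - (q - z * t)) by field.
  exact: ar.
have /eqP := derivative_zero_punctured_disc df Dv Dw.
rewrite /f; move: (left_part (c0 v)) (left_part (c0 w)) => p q; rewrite !mxE -subr_eq0 => /eqP h.
apply/eqP; rewrite -subr_eq0 -oppr_eq0 -[X in _ == X]h; apply/eqP.
by field.
Qed.

Lemma right_partE v : D v -> right_part (c0 v) = - left_part (c0 (- v)).
Proof.
by move=> Dv; rewrite /right_part (residue_unitary rl Dv) (linear_opp (@left_partP C N)).
Qed.

(** The correction terms of [pr3_mul_12_13] and its companions pair off: each projected tensor is
    accompanied by a sum or difference of left and right parts, which [left_part_affine] evaluates
    as [v / N], [w / N] or [(w - v) / N] times [M]. *)
Lemma projected_AYBE v w : D v -> D w -> D (w - v) ->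
  pr3 (leg12 (pr2 (c0 v)) *m leg13 (pr2 (c0 w))
       - leg23 (pr2 (c0 (w - v))) *m leg12 (pr2 (c0 v))
       + leg13 (pr2 (c0 w)) *m leg23 (pr2 (c0 (w - v)))) =
  - (N%:R^-1 *: (v *: (pr2 (c0 v) *t M) + w *: ins13 (pr2 (c0 w)) M
                 + (w - v) *: ins23 (pr2 (c0 (w - v))) M)).
Proof.
move=> Dv Dw Dx; set x := w - v in Dx *.
have split3 (p q t : AAA) : pr3 (p - q + t) = pr3 p - pr3 q + pr3 t.
  by rewrite (linear_add (@pr3P C N)) (linear_sub (@pr3P C N)).
have := residue_AYBE rl N0 Dv Dw Dx; rewrite -/x [X in X = 0 -> _]split3.
rewrite [X in X - _ + _ = 0 -> _](pr3_mul_12_13 N0) [X in _ - X + _ = 0 -> _](pr3_mul_23_12 N0).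
rewrite [X in _ + X = 0 -> _](pr3_mul_13_23 N0) [X in _ -> X = _]split3.
have DNw := punctured_discN Dw; have DNx := punctured_discN Dx; have DNv := punctured_discN Dv.
have a1 : right_part (c0 w) - right_part (c0 x) = (v / N%:R) *: M.
  rewrite (right_partE Dw) (right_partE Dx) opprK addrC (left_part_affine DNw DNx).
  by congr (_ / _ *: _); rewrite /x; ring.
have a2 : right_part (c0 v) + left_part (c0 x) = (w / N%:R) *: M.
  rewrite (right_partE Dv) addrC (left_part_affine DNv Dx).
  by congr (_ / _ *: _); rewrite /x; ring.
have a3 : left_part (c0 w) - left_part (c0 v) = (x / N%:R) *: M by exact: left_part_affine.
have E1 : pr2 (c0 v) *t right_part (c0 w) - pr2 (c0 v) *t right_part (c0 x) =
    (v / N%:R) *: (pr2 (c0 v) *t M).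
  have := linear_sub (tensmx_linearr (pr2 (c0 v))) (right_part (c0 w)) (right_part (c0 x)).
  by rewrite a1 (linear_scale (tensmx_linearr _)) => ->.
have E2 : ins13 (pr2 (c0 w)) (right_part (c0 v)) + ins13 (pr2 (c0 w)) (left_part (c0 x)) =
    (w / N%:R) *: ins13 (pr2 (c0 w)) M.
  have := linear_add (ins13_linearr (pr2 (c0 w))) (right_part (c0 v)) (left_part (c0 x)).
  by rewrite a2 (linear_scale (@ins13_linearr C N _)) => ->.
have E3 : ins23 (pr2 (c0 x)) (left_part (c0 w)) - ins23 (pr2 (c0 x)) (left_part (c0 v)) =
    (x / N%:R) *: ins23 (pr2 (c0 x)) M.
  have := linear_sub (ins23_linearr (pr2 (c0 x))) (left_part (c0 w)) (left_part (c0 v)).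
  by rewrite a3 (linear_scale (@ins23_linearr C N _)) => ->.
have conclude (P1 P2 P3 e1 e2 e3 e4 e5 e6 F1 F2 F3 : AAA) :
    e1 - e2 = F1 -> e3 + e4 = F2 -> e5 - e6 = F3 ->
    P1 + e1 + e3 - (P2 + e2 + e6) + (P3 + e5 + e4) = 0 -> P1 - P2 + P3 = - (F1 + F2 + F3).
  move=> <- <- <- H; apply/eqP; rewrite -subr_eq0 -[X in _ == X]H; apply/eqP.
  by apply/matrixP => i j; rewrite !mxE; ring.
have distr (a b f : AAA) : N%:R^-1 *: (v *: a + w *: b + x *: f) =
    (v / N%:R) *: a + (w / N%:R) *: b + (x / N%:R) *: f.
  by rewrite !scalerDr !scalerA ![N%:R^-1 * _]mulrC.
by rewrite distr; exact: conclude E1 E2 E3.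
Qed.

Lemma trace_dual (X : A) : X != 0 -> exists y, \tr (X *m y) = 1.
Proof.
move=> X0; apply: contrapT => H; case/eqP: X0; apply: trace_pairing => y.
apply: contrapT => /eqP Xy; apply: H; exists ((\tr (X *m y))^-1 *: y).
by rewrite -scalemxAr mxtraceZ mulVf.
Qed.

(* [pr2 rho] would have rank at most 2. *)
Lemma rank_obstruction (rho : AA) (X Y : A) : (1 < N)%N ->
  (forall y, pr (tract rho (pr y)) = 0 -> pr y = 0) ->
  pr2 rho <> X *t M + M *t Y.
Proof.
move=> N1 nd E; have [y [My Yy yc]] := pairing_kernel M Y N1.
have := nd y; rewrite -(tract_pr2 rho y) E (linear_add (tract_linearl _)) !tract_tens.
rewrite My Yy !scale0r addr0 => /(_ erefl) /eqP; rewrite subr_eq0 => /eqP.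
exact: yc.
Qed.

Lemma projected_AYBE_obstruction v w : (1 < N)%N -> D v -> D w -> D (w - v) ->
  (forall y, pr (tract (c0 v) (pr y)) = 0 -> pr y = 0) ->
  pr3 (leg12 (pr2 (c0 v)) *m leg13 (pr2 (c0 w))
       - leg23 (pr2 (c0 (w - v))) *m leg12 (pr2 (c0 v))
       + leg13 (pr2 (c0 w)) *m leg23 (pr2 (c0 (w - v)))) = 0 -> M = 0.
Proof.
move=> N1 Dv Dw Dx nd; rewrite projected_AYBE // => /eqP.
rewrite oppr_eq0 scaler_eq0 invr_eq0 (negPf N0) => /eqP E.
apply: contrapT => /eqP M0.
(* Contracting the last factor against [m] will express [pr2 (c0 v)] in the form
   [X *t M + M *t Y]. *)
have [m m1] := trace_dual M0.
have v0 : v != 0 by case: Dv.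
have cP := @contract3P C N m.
have expand (a b f : C) (p q t : AA) :
    contract3 m (a *: (p *t M) + b *: ins13 q M + f *: ins23 t M) =
    a *: p + (b *: (tract q m *t M) + f *: (M *t tract t m)).
  have lin3 (e1 e2 e3 : AAA) : contract3 m (a *: e1 + b *: e2 + f *: e3) =
      a *: contract3 m e1 + b *: contract3 m e2 + f *: contract3 m e3.
    by rewrite !(linear_add cP) !(linear_scale cP).
  rewrite lin3 addrA; congr (_ *: _ + _ *: _ + _ *: _).
  - by rewrite contract3_ins12 m1 scale1r.
  - exact: contract3_ins13.
  - exact: contract3_ins23.
have := congr1 (contract3 m) E; rewrite [X in X = _]expand (linear_zero cP).
move: (tract _ m) (tract _ m) => Y X H.
apply: (rank_obstruction (X := - (v^-1 * w) *: X) (Y := - (v^-1 * (w - v)) *: Y) N1 nd).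
have solve (p q t : AA) : v *: p + (w *: q + (w - v) *: t) = 0 ->
    p = - (v^-1 * w) *: q + - (v^-1 * (w - v)) *: t.
  move=> /eqP; rewrite addr_eq0 => /eqP h; apply: (scalerI v0); rewrite h.
  by rewrite opprD scalerDr !scalerA !mulrN !mulrA mulfV // !mul1r !scaleNr.
rewrite (linear_scale (tensmx_linearl M)) (linear_scale (tensmx_linearr M)).
exact: solve H.
Qed.

End ResidueSlope.

(** * Continuation along the plane *)

Section Quotients.
Context {R : realType}.
Notation C := R[i].
Notation nc := (@Normc.normc R).

Lemma near_translate (x z : C) (P : C -> Prop) :
  (\forall y \near (z + x), P y) -> \forall y \near z, P (y + x).
Proof.
move=> /near_normcP[d d0 H]; apply/near_normcP; exists d => // y yz; apply: H.
by rewrite opprD addrACA subrr addr0.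
Qed.

Lemma near_dnbhs_translate (x z : C) (P : C -> Prop) :
  (\forall y \near (z + x)^', P y) -> \forall y \near z^', P (y + x).
Proof.
move=> /near_dnbhs_normcP[d d0 H]; apply/near_dnbhs_normcP; exists d => // y yz yd; apply: H.
  by rewrite (inj_eq (addIr x)).
by rewrite opprD addrACA subrr addr0.
Qed.

(** About a nearby [w] other than [z], a disc of radius at most [nc (w - z)] avoids [z]. This makes
    conditions on punctured neighbourhoods open in the centre. *)
Lemma near_dnbhs_near (z : C) (P : C -> Prop) : (\forall y \near z^', P y) ->
  \forall w \near z, \forall y \near w^', P y.
Proof.
move=> /near_dnbhs_normcP[d d0 H]; apply/near_normcP; exists d => // w wz.
have [->|wN] := eqVneq w z; first by apply/near_dnbhs_normcP; exists d.
have wp : 0 < nc (w - z) by rewrite normc_gt0 subr_eq0.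
apply/near_dnbhs_normcP; exists (Num.min (nc (w - z)) (d - nc (w - z))).
  by rewrite lt_min wp subr_gt0.
move=> y _; rewrite lt_min => /andP[y1 y2]; apply: H.
  by apply: contraTneq y1 => ->; rewrite -opprB normcN ltxx.
rewrite (_ : y - z = (y - w) + (w - z)); last by rewrite addrA subrK.
by apply: le_lt_trans (ler_normcD _ _) _; rewrite -ltrBrDr.
Qed.

Section Matrices.
Variables m n : nat.
Implicit Types f g : C -> 'M[C]_(m, n).

Definition holomorphic_mx f (z : C) :=
  forall i j, \forall y \near z, derivable (fun y => f y i j) y 1.

(** Meromorphy in one variable as the identity [h f = g] off the point, without division. This form
    is stable under sums, linear and bilinear maps and translations. *)
Definition quotient_mx f (z : C) := exists (h : C -> C) g,
  [/\ (\forall y \near z, derivable h y 1), (\forall y \near z^', h y != 0),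
      holomorphic_mx g z & \forall y \near z^', h y *: f y = g y].

Lemma holomorphic_mx_ext f g z : (forall y, f y = g y) -> holomorphic_mx f z ->
  holomorphic_mx g z.
Proof. by move=> /funext ->. Qed.

Lemma holomorphic_mx_add f g z : holomorphic_mx f z -> holomorphic_mx g z ->
  holomorphic_mx (fun y => f y + g y) z.
Proof.
move=> hf hg i j; apply: filterS2 (hf i j) (hg i j) => y df dg.
rewrite (_ : (fun y => _) = fun y => f y i j + g y i j); last by apply/funext => w; rewrite mxE.
exact: (derivable_addC df dg).
Qed.

Lemma holomorphic_mx_scale (h : C -> C) f (z : C) : (\forall y \near z, derivable h y 1) ->
  holomorphic_mx f z -> holomorphic_mx (fun y => h y *: f y) z.
Proof.
move=> dh hf i j; apply: filterS2 dh (hf i j) => y dhy df.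
rewrite (_ : (fun y => _) = fun y => h y * f y i j); last by apply/funext => w; rewrite mxE.
exact: (derivable_mulC dhy df).
Qed.

Lemma holomorphic_mx_cst (X : 'M[C]_(m, n)) z : holomorphic_mx (fun=> X) z.
Proof.
move=> i j; apply: (filterS _ (@filterT _ (nbhs z) _)) => y _.
exact: (@derivable_cstC R (X i j) y).
Qed.

Lemma holomorphic_mx_sum (I : Type) (q : seq I) (F : I -> C -> 'M[C]_(m, n)) z :
  (forall i, holomorphic_mx (F i) z) -> holomorphic_mx (fun y => \sum_(i <- q) F i y) z.
Proof.
move=> hF; elim: q => [|i q IH].
  by apply: holomorphic_mx_ext (holomorphic_mx_cst 0 z) => y; rewrite big_nil.
by apply: holomorphic_mx_ext (holomorphic_mx_add (hF i) IH) => y; rewrite big_cons.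
Qed.

Lemma quotient_mx_add f g z : quotient_mx f z -> quotient_mx g z ->
  quotient_mx (fun y => f y + g y) z.
Proof.
move=> [h [f1 [dh h0 df E]]] [k [g1 [dk k0 dg E']]].
exists (fun y => h y * k y), (fun y => k y *: f1 y + h y *: g1 y); split.
- apply: filterS2 dh dk => y d1 d2; exact: (derivable_mulC d1 d2).
- apply: filterS2 h0 k0 => y a b; exact: (mulf_neq0 a b).
- exact: (holomorphic_mx_add (holomorphic_mx_scale dk df) (holomorphic_mx_scale dh dg)).
- apply: filterS2 E E' => y <- <-; rewrite scalerDr !scalerA [k y * _]mulrC.
  exact: erefl.
Qed.

Lemma quotient_mx_scale (k : C -> C) f (z : C) : (\forall y \near z, derivable k y 1) ->
  quotient_mx f z -> quotient_mx (fun y => k y *: f y) z.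
Proof.
move=> dk [h [f1 [dh h0 df E]]]; exists h, (fun y => k y *: f1 y); split; [exact: dh|exact: h0| |].
  exact: (holomorphic_mx_scale dk df).
apply: filterS E => y <-; rewrite !scalerA [k y * _]mulrC.
exact: erefl.
Qed.

Lemma quotient_mx_cst (X : 'M[C]_(m, n)) z : quotient_mx (fun=> X) z.
Proof.
exists (fun=> 1), (fun=> X); split.
- by apply: (filterS _ (@filterT _ (nbhs z) _)) => y _; exact: (@derivable_cstC R 1 y).
- by apply: (filterS _ (@filterT _ (z^') _)) => y _; exact: oner_neq0.
- exact: holomorphic_mx_cst.
- by apply: (filterS _ (@filterT _ (z^') _)) => y _; rewrite scale1r.
Qed.

Lemma quotient_mx_dichotomy f z : quotient_mx f z ->
  (\forall y \near z^', f y = 0) \/ (\forall y \near z^', f y <> 0).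
Proof.
move=> [h [g [dh h0 dg E]]].
have [H|/existsNP[i /existsNP[j H]]] :=
    pselect (forall i j, \forall y \near z^', g y i j = 0).
  left; have {}H : \forall y \near z^', forall i j, g y i j = 0.
    suff : \forall y \near z^', forall ij : 'I_m * 'I_n, g y ij.1 ij.2 = 0.
      by apply: filterS => y gy i j; exact: (gy (i, j)).
    by apply: filter_forall => ij; exact: H.
  apply: filterS2 h0 (filterI E H) => y hy [Ey g0]; apply: (scalerI hy).
  by rewrite Ey scaler0; apply/matrixP => i j; rewrite g0 mxE.
right; have [g0|gN0] := holomorphic_isolated (dg i j).
  by case: H; exact: nbhs_dnbhs.
apply: filterS2 gN0 E => y gy Ey f0; move: gy.
by rewrite -Ey f0 scaler0 mxE eqxx.
Qed.

Lemma quotient_mx_translate (x : C) f z : quotient_mx f (z + x) ->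
  quotient_mx (fun y => f (y + x)) z.
Proof.
move=> [h [g [dh h0 dg E]]].
have dt (k : C -> C) y : derivable k (y + x) 1 -> derivable (fun y => k (y + x)) y 1.
  move=> dk; rewrite (_ : (fun y => _) = fun y => k (x + y)); last by apply/funext => w; rewrite addrC.
  by apply: derivable_shiftC; rewrite addrC.
exists (fun y => h (y + x)), (fun y => g (y + x)); split.
- by apply: filterS (near_translate dh) => y; exact: dt.
- exact: near_dnbhs_translate h0.
- move=> i j; apply: filterS (near_translate (dg i j)) => y.
  exact: (dt (fun y => g y i j)).
- exact: near_dnbhs_translate E.
Qed.

Lemma meromorphic_quotient_mx f z : meromorphic_at f z -> quotient_mx f z.
Proof.
move=> [g [h [dg [dh hN0] E]]]; exists h, g.
have dh' : \forall y \near z, derivable h y 1.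
  by apply: filterS dh => y; exact: diff_derivable.
have hN : \forall y \near z^', h y != 0.
  by have [//|] := holomorphic_isolated dh'.
split; [exact: dh'|exact: hN| |].
  move=> i j; apply: filterS dg => y dgy; apply: diff_derivable.
  exact: (differentiable_comp dgy (differentiable_coord (g y) i j)).
by apply: filterS2 hN (nbhs_dnbhs E) => y hy /(_ hy) ->; rewrite scalerA mulfV // scale1r.
Qed.

(** By [quotient_mx_dichotomy], the parameters around whose point on the line from 0 to [p] the
    function vanishes form a set that is open with open complement; the real line is connected. *)
Lemma quotient_mx_identity f : (forall z, quotient_mx f z) ->
  (\forall y \near (0 : C)^', f y = 0) -> forall p, \forall y \near p^', f y = 0.
Proof.
move=> qf f0 p.
pose B := [set t : R | \forall y \near (segment_path 0 p t)^', f y = 0].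
have cont (P : C -> Prop) t : (\forall y \near (segment_path 0 p t), P y) ->
    \forall u \near t, P (segment_path 0 p u).
  by move=> h; exact: (segment_path_continuous h).
have oB : open B.
  by rewrite openE => t Bt; exact: (cont _ _ (near_dnbhs_near Bt)).
have oNB : open (~` B).
  rewrite openE => t Bt; have [//|fN] := quotient_mx_dichotomy (qf (segment_path 0 p t)).
  have := cont _ _ (near_dnbhs_near fN); apply: filterS => u fu Bu.
  by have [y [h1 h2]] := filter_ex (filterI fu Bu).
have cB : closed B by rewrite -(setCK B) closedC.
have cT : connected [set: R] by apply/connected_intervalP.
have BT : B = setT.
  apply: cT.
  - by exists 0; rewrite /B /= /segment_path rmorph0 mul0r addr0.
  - by exists B => //; rewrite setTI.
  - by exists B => //; rewrite setTI.
have : B 1 by rewrite BT.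
by rewrite /B /= /segment_path rmorph1 mul1r add0r subr0.
Qed.

End Matrices.

Lemma quotient_mx_linear (m n m' n' : nat) (L : 'M[C]_(m, n) -> 'M[C]_(m', n')) f z :
  linear L -> quotient_mx f z -> quotient_mx (fun y => L (f y)) z.
Proof.
move=> Ll [h [g [dh h0 dg E]]]; exists h, (fun y => L (g y)); split; [exact: dh|exact: h0| |].
  apply: (@holomorphic_mx_ext _ _ (fun y => \sum_i \sum_j g y i j *: L (delta_mx i j))).
    by move=> y; rewrite (linear_delta_sum (g y) Ll).
  apply: holomorphic_mx_sum => i; apply: holomorphic_mx_sum => j.
  exact: (holomorphic_mx_scale (dg i j) (holomorphic_mx_cst _ z)).
apply: filterS E => y <-; rewrite (linear_scale Ll).
exact: erefl.
Qed.

Lemma quotient_mx_bilinear (m n m' n' m2 n2 : nat)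
    (B : 'M[C]_(m, n) -> 'M[C]_(m', n') -> 'M[C]_(m2, n2)) f f' z :
  (forall y, linear (B^~ y)) -> (forall x, linear (B x)) ->
  quotient_mx f z -> quotient_mx f' z -> quotient_mx (fun y => B (f y) (f' y)) z.
Proof.
move=> Bl Br [h [g [dh h0 dg E]]] [h' [g' [dh' h0' dg' E']]].
exists (fun y => h y * h' y), (fun y => B (g y) (g' y)); split.
- apply: filterS2 dh dh' => y d1 d2; exact: (derivable_mulC d1 d2).
- apply: filterS2 h0 h0' => y a b; exact: (mulf_neq0 a b).
- apply: (@holomorphic_mx_ext _ _ (fun y => \sum_i \sum_j g y i j *:
      \sum_k \sum_l g' y k l *: B (delta_mx i j) (delta_mx k l))).
    move=> y; rewrite (linear_delta_sum (g y) (Bl (g' y))).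
    by apply: eq_bigr => i _; apply: eq_bigr => j _; rewrite (linear_delta_sum (g' y) (Br _)).
  apply: holomorphic_mx_sum => i; apply: holomorphic_mx_sum => j.
  apply: (holomorphic_mx_scale (dg i j)).
  apply: holomorphic_mx_sum => k; apply: holomorphic_mx_sum => l.
  exact: (holomorphic_mx_scale (dg' k l) (holomorphic_mx_cst _ z)).
- apply: filterS2 E E' => y <- <-.
  by rewrite (linear_scale (Bl _)) (linear_scale (Br _)) scalerA.
Qed.

End Quotients.

Section Period.
Context {R : realType} {N : nat}.
Notation C := R[i].
Notation nc := (@Normc.normc R).
Notation A := 'M[R[i]]_N.
Notation AA := 'M[R[i]]_(N * N).
Notation AAA := 'M[R[i]]_(N * N * N).
Variables (r : C -> C -> AA) (c0 : C -> AA) (G : C -> C -> Prop) (s : R).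
Hypothesis rl : regular_locus r c0 G s.
Hypothesis N0 : N%:R != 0 :> C.
Notation D := (punctured_disc s).
Variable M : A.
Hypothesis slope : forall v, D v -> pr (residue_slope c0 v) = M.

(* The identity [projected_AYBE] is bilinear in the values at [v] and [v + x], up to
   the explicit factors [v] and [v + x]. It continues along [C] for [x] fixed; under
   [v |-> v + p] only these factors change. *)
Lemma period_obstruction (F : C -> AA) (p : C) : (1 < N)%N ->
  (\forall v \near (0 : C)^', forall y, pr (tract (c0 v) (pr y)) = 0 -> pr y = 0) ->
  (forall z, quotient_mx F z) -> (\forall v \near (0 : C)^', F v = pr2 (c0 v)) ->
  p != 0 -> (forall z, \forall v \near z^', F (v + p) = F v) -> M = 0.
Proof.
move=> N1 nd qF Fc p0 Fp; apply: contrapT => /eqP M0.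
have [m m1] := trace_dual M0.
have good := near0_and (near_disc (locus_gt0 rl)) Fc.
(* [x] has a good punctured neighbourhood of its own, so that [v] and [v + x] are both admissible
   for all small nonzero [v]. *)
have [x [[Dx _] goodx]] := near0_ex (near0_and good (nbhs_dnbhs (near_dnbhs_near good))).
pose rho := pr2 (c0 x).
pose H v := pr3 (leg12 (F v) *m leg13 (F (v + x)) - leg23 rho *m leg12 (F v)
  + leg13 (F (v + x)) *m leg23 rho)
  + N%:R^-1 *: (v *: (F v *t M) + (v + x) *: ins13 (F (v + x)) M + x *: ins23 rho M) : AAA.
have goodx0 : \forall v \near (0 : C)^', D (v + x) /\ F (v + x) = pr2 (c0 (v + x)).
  have := @near_dnbhs_translate R x 0 (fun y => D y /\ F y = pr2 (c0 y)).
  by rewrite add0r; apply; exact: goodx.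
have H0 : \forall v \near (0 : C)^', H v = 0.
  apply: filterS2 good goodx0 => v [Dv Fv] [Dvx Fvx].
  have vx : v + x - v = x by rewrite addrAC subrr add0r.
  have := projected_AYBE rl N0 slope Dv Dvx; rewrite vx => /(_ Dx).
  rewrite /H Fv Fvx -/rho => ->; exact: addNr.
have qH z : quotient_mx H z.
  have q1 := qF z; have q2 := quotient_mx_translate (qF (z + x)).
  have did : \forall y \near z, derivable (fun y : C => y) y 1.
    by apply: (filterS _ (@filterT _ (nbhs z) _)) => y _; exact: derivable_idC.
  have dsh : \forall y \near z, derivable (fun y : C => y + x) y 1.
    apply: (filterS _ (@filterT _ (nbhs z) _)) => y _.
    exact: (derivable_addC (@derivable_idC R y) (@derivable_cstC R x y)).
  have l12 : linear (fun X : AA => - (leg23 rho *m leg12 X)).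
    by move=> a X Y; rewrite (@leg12P C N) mulmx_linearr opprD scalerN.
  have l13 : linear (fun X : AA => leg13 X *m leg23 rho).
    by move=> a X Y; rewrite (@leg13P C N) mulmx_linearl.
  have b1 (Y : AA) : linear (fun X : AA => leg12 X *m leg13 Y).
    by move=> a X X'; rewrite (@leg12P C N) mulmx_linearl.
  have b2 (X : AA) : linear (fun Y : AA => leg12 X *m leg13 Y).
    by move=> a Y Y'; rewrite (@leg13P C N) mulmx_linearr.
  have sc : linear (fun X : AAA => N%:R^-1 *: X).
    by move=> a X Y; rewrite scalerDr !scalerA mulrC.
  have k1 := quotient_mx_bilinear b1 b2 q1 q2.
  have k2 := quotient_mx_linear l12 q1; have k3 := quotient_mx_linear l13 q2.
  have k4 := quotient_mx_linear (@pr3P C N) (quotient_mx_add (quotient_mx_add k1 k2) k3).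
  have k5 := quotient_mx_scale did (quotient_mx_linear (tensmx_linearl M) q1).
  have k6 := quotient_mx_scale dsh (quotient_mx_linear (@ins13_linearl C N M) q2).
  have k7 := quotient_mx_cst (x *: ins23 rho M) z.
  have k8 := quotient_mx_linear sc (quotient_mx_add (quotient_mx_add k5 k6) k7).
  exact: (quotient_mx_add k4 k8).
have Hp : \forall v \near (0 : C)^', H (v + p) = 0.
  have := @near_dnbhs_translate R p 0 (fun y => H y = 0).
  by rewrite add0r; apply; exact: (quotient_mx_identity qH H0).
have Fpx : \forall v \near (0 : C)^', F (v + x + p) = F (v + x).
  have := @near_dnbhs_translate R x 0 (fun y => F (y + p) = F y).
  by rewrite add0r; apply; exact: (Fp x).
have [v [[[[Dv Fv] [Dvx Fvx]] [h0 hp]] [[f1 f2] ndv]]] := near0_ex (near0_and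
  (near0_and (near0_and good goodx0) (near0_and H0 Hp)) (near0_and (near0_and (Fp 0) Fpx) nd)).
(* Periodicity leaves the [pr3] part of [H] unchanged, so [H (v + p) - H v] is [p / N] times this
   tensor. *)
have E : F v *t M + ins13 (F (v + x)) M = 0.
  have vpx : v + p + x = v + x + p by rewrite addrAC.
  move: hp; rewrite /H vpx f1 f2 -[RHS]h0 /H => /addrI /eqP.
  rewrite -subr_eq0 -scalerBr scaler_eq0 invr_eq0 (negPf N0) => /eqP.
  have collect (a b f : AAA) : (v + p) *: a + (v + x + p) *: b + f
      - (v *: a + (v + x) *: b + f) = p *: (a + b).
    by apply/matrixP => i j; rewrite !mxE; ring.
  by rewrite collect => e; apply: (scalerI p0); rewrite scaler0.
have cP := @contract3P C N m.
have := congr1 (contract3 m) E; rewrite (linear_zero cP) (linear_add cP).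
rewrite contract3_ins12 contract3_ins13 m1 scale1r Fv => /eqP.
rewrite addr_eq0 => /eqP E2.
apply: (rank_obstruction (M := M) (X := - tract (F (v + x)) m) (Y := 0) N1 ndv).
by rewrite E2 (linear_zero (tensmx_linearr _)) addr0 (linear_opp (tensmx_linearl _)).
Qed.

End Period.

(** * The theorem *)

Section GenericLocus.
Context {R : realType} {N : nat}.
Notation C := R[i].
Notation nc := (@Normc.normc R).
Notation A := 'M[R[i]]_N.
Notation AA := 'M[R[i]]_(N * N).

Lemma generically_all (V : normedModType C) (x : V) (P : V -> Prop) :
  (forall y, P y) -> generically x P.
Proof. by move=> H; apply: generically_near; apply: (filterS _ (@filterT _ (nbhs x) _)) => y _. Qed.

Lemma generically_comp0 (V W : normedModType C) (l : V -> W) (k : W -> V) (P : W -> Prop) :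
  (forall y, differentiable l y) -> (forall y, differentiable k y) ->
  l 0 = 0 -> k 0 = 0 -> cancel k l -> generically 0 P -> generically 0 (fun y => P (l y)).
Proof.
move=> dl dk l0 k0 kl gP; apply: (@generically_comp R V W l k 0 P _ _ _ kl).
- by apply: (filterS _ (@filterT _ (nbhs (0 : V)) _)) => y _.
- exact: differentiable_continuous (dk _).
- by rewrite l0.
- by rewrite l0.
Qed.

Let df := @differentiable_fst_mod R.
Let ds := @differentiable_snd_mod R.

Lemma generically_fst (P : C -> Prop) : generically (0 : C) P ->
  generically (0 : C * C) (fun x => P x.1).
Proof.
move=> gP; apply: (@generically_comp0 (C * C)%type C (fun x => x.1) (fun u => (u, 0)) P _ _ _ _ _ gP); [| |by []|by []|by []].
- exact: df.
- by move=> y; apply: differentiable_pair; [exact: differentiable_idV|exact: differentiable_cst].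
Qed.

Lemma generically_snd (P : C -> Prop) : generically (0 : C) P ->
  generically (0 : C * C) (fun x => P x.2).
Proof.
move=> gP; apply: (@generically_comp0 (C * C)%type C (fun x => x.2) (fun u => (0, u)) P _ _ _ _ _ gP); [| |by []|by []|by []].
- exact: ds.
- by move=> y; apply: differentiable_pair; [exact: differentiable_cst|exact: differentiable_idV].
Qed.

Lemma generically_addC (P : C -> Prop) : generically (0 : C) P ->
  generically (0 : C * C) (fun x => P (x.1 + x.2)).
Proof.
move=> gP; apply: (@generically_comp0 (C * C)%type C (fun x => x.1 + x.2) (fun u => (u, 0)) P _ _ _ _ _ gP).
- by move=> y; apply: differentiableD; [exact: df|exact: ds].
- by move=> y; apply: differentiable_pair; [exact: differentiable_idV|exact: differentiable_cst].
- by rewrite addr0.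
- by [].
- by move=> u; rewrite /= addr0.
Qed.

Lemma generically_opp1 (P : C -> C -> Prop) : generically (0 : C * C) (fun x => P x.1 x.2) ->
  generically (0 : C * C) (fun x => P (- x.1) x.2).
Proof.
move=> gP; pose l (x : C * C) := (- x.1, x.2).
have dl y : differentiable l y.
  by apply: differentiable_pair; [apply: differentiableN; exact: df|exact: ds].
apply: (@generically_comp0 _ _ l l _ dl dl _ _ _ gP); rewrite /l /= ?oppr0 //.
by case=> a b /=; rewrite opprK.
Qed.

Let d11 (y : C * C * C) : differentiable (fun x : C * C * C => x.1.1) y.
Proof. exact: (differentiable_comp (df (y : (C * C)%type * C)) (df y.1)). Qed.

Let d12 (y : C * C * C) : differentiable (fun x : C * C * C => x.1.2) y.
Proof. exact: (differentiable_comp (df (y : (C * C)%type * C)) (ds y.1)). Qed.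

Let d2 (y : C * C * C) : differentiable (fun x : C * C * C => x.2) y.
Proof. exact: ds. Qed.

(** The right inverse of the linear map divides by [b * b + b' * b']; one formula thus covers the
    second arguments [v], [v'] and [v + v']. *)
Lemma generically_triple (P : C -> C -> Prop) (a b b' : C) : a != 0 -> b * b + b' * b' != 0 ->
  generically (0 : C * C) (fun x => P x.1 x.2) ->
  generically (0 : C * C * C) (fun x => P (a *: x.1.1) (b *: x.1.2 + b' *: x.2)).
Proof.
move=> a0 b0 gP; set n := b * b + b' * b' in b0.
pose l (x : C * C * C) := (a *: x.1.1, b *: x.1.2 + b' *: x.2).
pose k (y : C * C) : C * C * C := (a^-1 *: y.1, (b / n) *: y.2, (b' / n) *: y.2).
have dl y : differentiable l y.
  apply: differentiable_pair; first exact: (differentiableZ a (d11 y)).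
  exact: (differentiableD (differentiableZ b (d12 y)) (differentiableZ b' (d2 y))).
have dk y : differentiable k y.
  apply: differentiable_pair; last exact: (differentiableZ (b' / n) (ds y)).
  apply: differentiable_pair; first exact: (differentiableZ a^-1 (df y)).
  exact: (differentiableZ (b / n) (ds y)).
apply: (@generically_comp0 _ _ l k _ dl dk _ _ _ gP); rewrite /l /k /= ?scaler0 ?addr0 //.
case=> u v /=; rewrite !scalerA mulfV // scale1r -scalerDl !mulrA -mulrDl -/n mulfV //.
by rewrite scale1r.
Qed.

Variables (r : C -> C -> AA) (c0 : C -> AA) (G : C -> C -> Prop) (s d : R).
Hypothesis rl : regular_locus r c0 G s.
Hypothesis d_gt0 : 0 < d.
Notation D := (punctured_disc s).

Lemma generically_disc (e : R) : 0 < e -> generically (0 : C) (punctured_disc e).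
Proof. by move=> e0; apply/generically1P; exact: near_disc. Qed.

Lemma square_locus_generic : generically (0 : C * C) (fun x =>
  [/\ punctured_disc d x.1, D x.2, G x.1 x.2 & G (- x.1) x.2]).
Proof.
have g := locus_generic rl; have g' := generically_opp1 g.
have D1 := generically_fst (generically_disc d_gt0).
have D2 := generically_snd (generically_disc (locus_gt0 rl)).
by apply: generically2 (genericallyI D1 D2) (genericallyI g g') => x [h1 h2] [h3 h4].
Qed.

Lemma disc_locus_generic : generically (0 : C * C) (fun x =>
  [/\ D x.1, D x.2 & D (x.1 + x.2)]).
Proof.
have gD := generically_disc (locus_gt0 rl).
by apply: generically2 (genericallyI (generically_fst gD) (generically_snd gD))
  (generically_addC gD) => x [h1 h2] h3.
Qed.

Lemma QYBE_locus_generic : generically (0 : C * C * C) (fun x =>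
  QYBE_locus G s d x.1.1 x.1.2 (x.1.2 + x.2)).
Proof.
have g := locus_generic rl; have one0 : (1 : C) != 0 by exact: oner_neq0.
have N10 : (-1 : C) != 0 by rewrite oppr_eq0.
have two0 : (2 : C) != 0 by rewrite pnatr_eq0.
have s10 : (1 : C) * 1 + 0 * 0 != 0 by rewrite mulr1 mulr0 addr0.
have s01 : (0 : C) * 0 + 1 * 1 != 0 by rewrite mulr1 mulr0 add0r.
have s11 : (1 : C) * 1 + 1 * 1 != 0 by rewrite mulr1.
have D1 := generically_fst (generically_disc d_gt0).
have D2 := generically_snd (generically_disc (locus_gt0 rl)).
have k1 := generically_triple (P := fun u v => punctured_disc d u /\ D v) one0 s10 (genericallyI D1 D2).
have k2 := generically_triple (P := G) one0 s10 g.
have k3 := generically_triple (P := G) N10 s10 g.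
have k4 := generically_triple (P := G) two0 s11 g.
have k5 := generically_triple (P := G) two0 s01 g.
have k6 := generically_triple (P := G) one0 s11 g.
have k7 := generically_triple (P := G) one0 s01 g.
have H := genericallyI (genericallyI (genericallyI k1 k2) (genericallyI k3 k4))
  (genericallyI (genericallyI k5 k6) k7).
apply: genericallyS H => -[[u v] v'] /=.
have sc (z y : C) : z *: y = z * y by [].
have vx : v + v' - v = v' by rewrite addrAC subrr add0r.
rewrite /QYBE_locus vx !sc !mul1r !mulN1r !mul0r !addr0 !add0r mulr_natl mulr2n.
by move=> [[[[a1 a2] a3] [a4 a5]] [[a6 a7] a8]].
Qed.

End GenericLocus.

Section ProjectedResidue.
Context {R : realType} {N : nat}.
Notation C := R[i].
Notation A := 'M[R[i]]_N.
Notation AA := 'M[R[i]]_(N * N).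

Lemma linear_mx_differentiable (m n m' n' : nat) (L : 'M[C]_(m, n) -> 'M[C]_(m', n')) X :
  linear L -> differentiable L X.
Proof.
move=> Ll; pose F : {linear 'M[C]_(m, n) -> 'M[C]_(m', n')} :=
  HB.pack L (GRing.isLinear.Build _ _ _ _ _ Ll).
have cF : continuous F.
  by move=> Y; exact: (linear_cvg Ll (@cvg_id _ (nbhs Y))).
exact: (linear_differentiable X cF).
Qed.

Lemma meromorphic_linear (m n m' n' : nat) (L : 'M[C]_(m, n) -> 'M[C]_(m', n'))
    (f : C -> 'M[C]_(m, n)) z :
  linear L -> meromorphic_at f z -> meromorphic_at (fun y => L (f y)) z.
Proof.
move=> Ll [g [h [hg hh E]]]; exists (fun y => L (g y)), h; split; [|exact: hh|].
  apply: filterS hg => y gy.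
  exact: (differentiable_comp gy (linear_mx_differentiable (g y) Ll)).
by apply: filterS E => y Ey hy; rewrite Ey // (linear_scale Ll).
Qed.

Variables (r : C -> C -> AA) (c0 : C -> AA) (G : C -> C -> Prop) (s : R).
Hypothesis rl : regular_locus r c0 G s.
Hypothesis N0 : N%:R != 0 :> C.

Lemma projected_CYBE : meromorphic_at c0 0 -> is_CYBE_solution (fun v => pr2 (c0 v)).
Proof.
move=> mc; split; first exact: (meromorphic_linear (@pr2P C N) mc).
  by apply: generically_all => v; exact: in_tensor_square_pr2.
apply: genericallyS (disc_locus_generic rl) => -[v v'] /= [D1 D2 D3].
have vx : v + v' - v = v' by rewrite addrAC subrr add0r.
by have := residue_CYBE rl N0 D1 D3; rewrite vx => /(_ D2).
Qed.

Lemma projected_unitary : is_CYBE_unitary (fun v => pr2 (c0 v)).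
Proof.
apply: genericallyS (generically_disc (locus_gt0 rl)) => v Dv.
rewrite leg21_pr2 (residue_unitary rl (punctured_discN Dv)) opprK.
exact: (linear_opp (@pr2P C N)).
Qed.

Lemma projected_nondegenerate :
  (\forall v \near (0 : C)^', forall y, pr (tract (c0 v) (pr y)) = 0 -> pr y = 0) ->
  is_CYBE_nondegenerate (fun v => pr2 (c0 v)).
Proof.
move=> nd; apply/generically1P.
apply: filterS2 (near0_opp nd) (near_disc (locus_gt0 rl)) => v ndv Dv.
apply/nondegenerate_slP => y; rewrite leg21_pr2 (residue_unitary rl Dv) tract_pr2.
rewrite (linear_opp (tract_linearl _)) (linear_opp (@pr_linear C N)) => /eqP.
rewrite oppr_eq0 => /eqP /ndv y0 a a0.
by rewrite (prE y) y0 add0r -scalemxAr mulmx1 mxtraceZ a0 mulr0.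
Qed.

End ProjectedResidue.

Section Equivalences.
Context {R : realType} {N : nat}.
Notation C := R[i].
Notation A := 'M[R[i]]_N.
Notation AA := 'M[R[i]]_(N * N).
Variables (r : C -> C -> AA) (c0 : C -> AA) (G : C -> C -> Prop) (s : R).
Hypothesis rl : regular_locus r c0 G s.
Hypothesis N1 : (1 < N)%N.
Variables (c : C) (d : R) (M : A).
Hypotheses (c_neq0 : c != 0) (d_gt0 : 0 < d) (M_traceless : \tr M = 0).
Hypothesis slope : forall v, punctured_disc s v -> pr (residue_slope c0 v) = M.
Hypothesis square : forall t v, punctured_disc d t -> punctured_disc s v ->
  G (- t) v -> G t v -> exists k, r (- t) v *m r t v = - c *: coproduct M + k *: 1%:M.

Let N0 : N%:R != 0 :> C. Proof. by rewrite pnatr_eq0 -lt0n ltnW. Qed.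

Lemma satisfies_QYBE_iff : satisfies_QYBE r <-> M = 0.
Proof.
have gL := QYBE_locus_generic rl d_gt0; split.
  move=> gQ; have [[[u v] v'] [/= Q L]] := generically_ex (genericallyI gQ gL).
  apply: (QYBE_obstruction rl N0 c_neq0 M_traceless square L).
  by have -> : v + v' - v = v' by rewrite addrAC subrr add0r.
move=> M0; apply: genericallyS gL => -[[u v] v'] /= L.
have := QYBE_of_traceless rl N0 square M0 L.
by have -> : v + v' - v = v' by rewrite addrAC subrr add0r.
Qed.

Lemma square_scalar_iff :
  (exists f : C -> C -> C, generically (0 : C * C) (fun x => let: (u, v) := x in
     r u v *m r (- u) v = f u v *: 1%:M)) <-> M = 0.
Proof.
have gL := square_locus_generic rl d_gt0; split.
  move=> [f gf]; have [[u v] [/= E [D1 D2 g1 g2]]] := generically_ex (genericallyI gf gL).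
  exact: (square_obstruction N0 c_neq0 M_traceless square D1 D2 g2 g1 E).
move=> M0; have NN : (N * N)%:R != 0 :> C by rewrite natrM mulf_neq0.
(* The coefficient of a scalar matrix is recovered from its trace, which yields a function defined
   everywhere. *)
exists (fun u v => \tr (r u v *m r (- u) v) / (N * N)%:R).
apply: genericallyS gL => -[u v] /= [D1 D2 g1 g2].
have [k [_ ->]] := square_commute N0 square D1 D2 g2 g1.
rewrite M0 /coproduct (linear_zero (tensmx_linearl _)) (linear_zero (tensmx_linearr _)).
by rewrite addr0 scaler0 add0r mxtraceZ mxtrace1 mulfK.
Qed.

Lemma slope_scalar_iff :
  (exists f : C -> C, generically (0 : C) (fun v =>
     derive1 (fun w => c0 w - pr2 (c0 w)) v = f v *: 1%:M)) <-> M = 0.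
Proof.
have gD := generically_disc (locus_gt0 rl); split.
  move=> [f gf]; have [v [E Dv]] := generically_ex (genericallyI gf gD).
  exact: (slope_obstruction rl N0 M_traceless slope Dv E).
move=> M0; have NN : (N * N)%:R != 0 :> C by rewrite natrM mulf_neq0.
exists (fun v => \tr (derive1 (fun w => c0 w - pr2 (c0 w)) v) / (N * N)%:R).
apply: genericallyS gD => v Dv.
have [k ->] := unprojected_derive rl slope Dv.
rewrite M0 /coproduct (linear_zero (tensmx_linearl _)) (linear_zero (tensmx_linearr _)).
by rewrite addr0 scaler0 add0r mxtraceZ mxtrace1 mulfK.
Qed.

Hypothesis nondegenerate :
  \forall v \near (0 : C)^', forall y, pr (tract (c0 v) (pr y)) = 0 -> pr y = 0.

Lemma projected_AYBE_iff :
  generically (0 : C * C) (fun x => let: (v, v') := x in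
    pr3 (leg12 (pr2 (c0 v)) *m leg13 (pr2 (c0 (v + v')))
         - leg23 (pr2 (c0 v')) *m leg12 (pr2 (c0 v))
         + leg13 (pr2 (c0 (v + v'))) *m leg23 (pr2 (c0 v'))) = 0) <-> M = 0.
Proof.
have gD := disc_locus_generic rl.
have vx (v v' : C) : v + v' - v = v' by rewrite addrAC subrr add0r.
split.
  have /generically1P gn := nondegenerate.
  move=> gE; have [[v v'] [/= [E [D1 D2 D3]] nv]] :=
    generically_ex (genericallyI (genericallyI gE gD) (generically_fst gn)).
  apply: (projected_AYBE_obstruction rl N0 slope N1 D1 D3 _ nv); rewrite vx //.
move=> M0; apply: genericallyS gD => -[v v'] /= [D1 D2 D3].
have := projected_AYBE rl N0 slope D1 D3; rewrite vx => /(_ D2) ->.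
rewrite M0 (linear_zero (tensmx_linearr _)) (linear_zero (@ins13_linearr C N _)).
by rewrite (linear_zero (@ins23_linearr C N _)) !scaler0 !addr0 scaler0 oppr0.
Qed.

Lemma periodic_or_rigid : admits_period (fun v => pr2 (c0 v)) \/
  (forall a : A, a \in sl -> infinitesimal_symmetry (fun v => pr2 (c0 v)) a -> a = 0) ->
  M = 0.
Proof.
move=> [[F [p [mF gF p0 Fp]]]|rigid].
  apply: (period_obstruction rl N0 slope N1 nondegenerate _ _ p0).
  - by move=> z; exact: meromorphic_quotient_mx.
  - exact/generically1P.
  - by move=> z; exact/generically1P.
apply: rigid; first by rewrite inE M_traceless.
apply: genericallyS (generically_disc (locus_gt0 rl)) => v Dv.
exact: (projected_residue_symmetry rl N0 c_neq0 d_gt0 square Dv).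
Qed.

End Equivalences.

(** * The case N = 1 *)

Section OneByOne.
Context {R : realType}.
Notation C := R[i].

Lemma pr_mx11 (a : 'M[C]_1) : pr a = 0.
Proof. by rewrite [a]mx11_scalar pr_scalar // oner_neq0. Qed.

Lemma pr2_mx11 (t : 'M[C]_(1 * 1)) : pr2 t = 0.
Proof.
move: t; apply: tens_ext => [|z x y|a b]; first exact: pr2P.
  by rewrite scaler0 addr0.
by rewrite pr2_tens pr_mx11 (linear_zero (tensmx_linearl _)).
Qed.

Lemma mulmx11C (x y : 'M[C]_1) : x *m y = y *m x.
Proof. by rewrite [x]mx11_scalar scalar_mxC. Qed.

Lemma mulmx11_rev (x y z : 'M[C]_1) : x *m y *m z = z *m y *m x.
Proof. by rewrite [x *m y]mulmx11C mulmx11C mulmxA. Qed.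

Lemma pr3_mx11 (t : 'M[C]_(1 * 1 * 1)) : pr3 t = 0.
Proof.
move: t; apply: tens3_ext => [|z x y|a b f]; first exact: pr3P.
  by rewrite scaler0 addr0.
by rewrite pr3_tens !pr_mx11 !(linear_zero (tensmx_linearl _)).
Qed.

End OneByOne.

Theorem theorem1p4 (R : realType) (N : nat) (hN : (0 < N)%N)
    (r : R[i] -> R[i] -> 'M[R[i]]_(N * N))
    (c : nat -> R[i] -> 'M[R[i]]_(N * N))
    (r_sol : is_AYBE_solution r)
    (r_unitary : is_AYBE_unitary r)
    (r_nondegenerate : is_AYBE_nondegenerate r)
    (r_laurent : laurent_at_u0 r c) :
  let r0 := c 0%N in
  let rbar0 := fun v => pr2 (r0 v) in
  let cond_a := satisfies_QYBE r in
  let cond_b := exists s : R[i] -> R[i] -> R[i],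
    generically (0 : R[i] * R[i]) (fun x => let: (u, v) := x in
      r u v *m r (- u) v = s u v *: 1%:M) in
  let cond_c := exists s : R[i] -> R[i],
    generically (0 : R[i]) (fun v =>
      derive1 (fun w => r0 w - rbar0 w) v = s v *: 1%:M) in
  let cond_d := generically (0 : R[i] * R[i]) (fun x => let: (v, v') := x in
      pr3 (leg12 (rbar0 v) *m leg13 (rbar0 (v + v'))
           - leg23 (rbar0 v') *m leg12 (rbar0 v)
           + leg13 (rbar0 (v + v')) *m leg23 (rbar0 v')) = 0) in
  [/\ [/\ is_CYBE_solution rbar0, is_CYBE_unitary rbar0 &
          is_CYBE_nondegenerate rbar0],
      [/\ cond_a <-> cond_b, cond_b <-> cond_c & cond_c <-> cond_d] &
      admits_period rbar0 \/
        (forall a : 'M[R[i]]_N, a \in sl -> infinitesimal_symmetry rbar0 a ->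
           a = 0) ->
      [/\ cond_a, cond_b, cond_c & cond_d]].
Proof.
move=> r0 rbar0 cond_a cond_b cond_c cond_d.
(* For [N = 1] no pole along [v = 0] is forced. But [pr] vanishes and 1 by 1 matrices commute, so
   all conditions hold, and nondegeneracy only concerns the zero space [sl]. *)
have [N1|N1] := leqP N 1.
  have NE : N = 1%N by apply/eqP; rewrite eqn_leq N1.
  subst N.
  have rbar00 v : rbar0 v = 0 by exact: pr2_mx11.
  have ha : cond_a.
    apply: generically_all => -[[u v] v'].
    exact: mulmx11_rev.
  have hb : cond_b.
    exists (fun u v => (r u v *m r (- u) v : 'M[R[i]]_1) 0 0).
    by apply: generically_all => -[u v]; rewrite scalemx1; exact: mx11_scalar.
  have hc : cond_c.
    exists (fun v => (derive1 (fun w => r0 w - rbar0 w) v : 'M[R[i]]_1) 0 0).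
    by apply: generically_all => v; rewrite scalemx1; exact: mx11_scalar.
  have hd : cond_d by apply: generically_all => -[v v']; exact: pr3_mx11.
  split=> //; split.
  - split; first exact: meromorphic_linear (@pr2P _ _) (r_laurent.1 0%N).
      apply: generically_all => v; exact: in_tensor_square_pr2.
    apply: generically_all => -[v v']; rewrite !rbar00 /commutator.
    rewrite (linear_zero (@leg12P _ _)) (linear_zero (@leg13P _ _)) (linear_zero (@leg23P _ _)).
    by rewrite !mul0mx !subrr addr0.
  - by apply: generically_all => v; rewrite !rbar00 (linear_zero (@leg21P _ _)) oppr0.
  - apply: generically_all => v f _ a; rewrite inE => /eqP a0.
    suff -> : a = 0 by exact: linear0.
    by rewrite [a]mx11_scalar -[a 0 0]mulr1n -trace_mx11 a0 raddf0.
have N0 : N%:R != 0 :> R[i] by rewrite pnatr_eq0 -lt0n.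
have [G [s rl]] := regular_locus_exists r_sol r_unitary r_nondegenerate r_laurent.
have [k [d [k0 d0 ds pole]]] := simple_pole rl N1.
have nd := residue_nondegenerate rl k0 d0 ds pole N0.
have [M M0 [slope square]] := slope_constant rl N0 k0 d0 ds pole.
have ia : cond_a <-> M = 0 := satisfies_QYBE_iff rl N1 k0 d0 M0 square.
have ib : cond_b <-> M = 0 := square_scalar_iff rl N1 k0 d0 M0 square.
have ic : cond_c <-> M = 0 := slope_scalar_iff rl N1 M0 slope.
have ie : cond_d <-> M = 0 := projected_AYBE_iff rl N1 slope nd.
split; last first.
- move=> /(periodic_or_rigid rl N1 k0 d0 M0 slope square nd) M00.
  by split; [apply/ia|apply/ib|apply/ic|apply/ie].
- have both (P Q : Prop) : (P <-> M = 0) -> (Q <-> M = 0) -> (P <-> Q) by tauto.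
  by split; [exact: both ia ib|exact: both ib ic|exact: both ic ie].
split.
- exact: projected_CYBE rl N0 (r_laurent.1 0%N).
- exact: projected_unitary rl.
- exact: projected_nondegenerate rl nd.
Qed.
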